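(* Let $f\in A_1^{\mathfrak{sl}(2)}$. Then the following statements are equivalent: (i) there exists $\gamma\in \mathrm{Aut}(A_1)\times\mathrm{Aut}(\mathfrak{sl}(2))$ such that $\gamma\cdot f\in\mathcal N$; (ii) there exists $z\in\mathfrak{sl}(2)\setminus\{0\}$ such that $\mathrm{ad}(f(z)):A_1\to A_1$ has a strictly semi-simple eigenvector; (iii) there exists $z\in\mathfrak{sl}(2)\setminus\{0\}$ such that $f(z)$ is strictly semi-simple; (iv) there exists $z\in\mathfrak{sl}(2)\setminus\{0\}$ such that $\mathrm{ad}(f(z)):A_1\to A_1$ has a strictly nilpotent eigenvector; (v) there exists $z\in\mathfrak{sl}(2)\setminus\{0\}$ such that $f(z)$ is strictly nilpotent; (vi) there exists $z\in\mathfrak{sl}(2)\setminus\{0\}$ such that $\mathrm{ad}(f(z))$ can be exponentiated in $\mathrm{Aut}(A_1)$.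
   Context: The Weyl algebra $A_1$ is the complex associative unital algebra generated by $p,q$ with $pq-qp=1$, with Lie bracket $[a,b]=ab-ba$ and $\mathrm{ad}(x)(y)=[x,y]$. $A_1^{\mathfrak{sl}(2)}$ is the set of injective Lie algebra homomorphisms $\mathfrak{sl}(2)=\mathfrak{sl}(2,\mathbb C)\to A_1$. The group $\mathrm{Aut}(A_1)\times\mathrm{Aut}(\mathfrak{sl}(2))$ (algebra, resp. Lie algebra, automorphisms) acts on $A_1^{\mathfrak{sl}(2)}$ by $(\alpha,w)\cdot f=\alpha\circ f\circ w^{-1}$. Let $e_+=\begin{pmatrix}0&1\\0&0\end{pmatrix}$, $e_-=\begin{pmatrix}0&0\\1&0\end{pmatrix}$, $e_0=\begin{pmatrix}1&0\\0&-1\end{pmatrix}$. Define $f_I, f_{II}^b\in A_1^{\mathfrak{sl}(2)}$ ($b\in\mathbb C$) by $f_I(e_+)=-\frac12q^2$, $f_I(e_-)=\frac12p^2$, $f_I(e_0)=\frac12(pq+qp)$; $f_{II}^b(e_+)=(b+pq)q$, $f_{II}^b(e_-)=-p$, $f_{II}^b(e_0)=2pq+b$; and $\mathcal N=\{f_I\}\cup\{f_{II}^b: b\in\mathbb C\}$. For $x\in A_1$ put $N(x)=\{y\in A_1:\mathrm{ad}^m(x)(y)=0\text{ for some positive integer }m\}$, $C(x)=\{y\in A_1:[x,y]=0\}$, and let $D(x)$ be the linear span of $\{y\in A_1:[x,y]=\lambda y\text{ for some }\lambda\in\mathbb C\}$. An element $x\in A_1\setminus\mathbb C$ is strictly nilpotent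 if $D(x)=C(x)$, $N(x)\neq C(x)$ and $N(x)=A_1$; it is strictly semi-simple if $D(x)\ne C(x)$, $N(x)=C(x)$ and $D(x)=A_1$. (Eigenvectors of $\mathrm{ad}(f(z))$ may have eigenvalue $0$.) For $Z\in A_1$, $\mathrm{ad}(Z)$ can be exponentiated in $\mathrm{Aut}(A_1)$ if there is a group homomorphism $\Phi:\mathbb C\to\mathrm{Aut}(A_1)$ such that for all $a\in A_1$: the vector space $V_a$ spanned by $\{\Phi(t)(a):t\in\mathbb C\}$ is finite-dimensional, and the map $\Phi_a:\mathbb C\to V_a$, $\Phi_a(t)=\Phi(t)(a)$, is holomorphic with $\frac{d}{dt}\big|_{t=0}\Phi_a(t)=[Z,a]$. *)

(* Defs.v *)
From HB Require Import structures.
From mathcomp Require Import all_boot all_order all_algebra.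
From mathcomp Require Import all_classical all_reals all_analysis.
From mathcomp Require Import generic_quotient complex ring.

Set Implicit Arguments.
Unset Strict Implicit.
Unset Printing Implicit Defensive.

Import Order.TTheory GRing.Theory Num.Theory.
Import numFieldNormedType.Exports.
Local Open Scope classical_set_scope.
Local Open Scope ring_scope.

(* The Weyl algebra is given by its presentation: terms over p, q and the     *)
(* scalars, modulo the smallest congruence containing the axioms of unital    *)
(* associative F-algebras and pq = qp + 1. *)

Local Open Scope quotient_scope.

Section WeylTerms.
Variable F : fieldType.

Inductive wterm : Type :=
| WScal of F
| WP
| WQ
| WAdd of wterm & wterm
| WMul of wterm & wterm.

HB.instance Definition _ := gen_eqMixin wterm.
HB.instance Definition _ := gen_choiceMixin wterm.

Inductive wequiv : wterm -> wterm -> Prop :=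
| weq_refl x : wequiv x x
| weq_sym x y : wequiv x y -> wequiv y x
| weq_trans x y z : wequiv x y -> wequiv y z -> wequiv x z
| weq_add x x' y y' :
    wequiv x x' -> wequiv y y' -> wequiv (WAdd x y) (WAdd x' y')
| weq_mul x x' y y' :
    wequiv x x' -> wequiv y y' -> wequiv (WMul x y) (WMul x' y')
| weq_scalD c d : wequiv (WScal (c + d)) (WAdd (WScal c) (WScal d))
| weq_scalM c d : wequiv (WScal (c * d)) (WMul (WScal c) (WScal d))
| weq_addA x y z : wequiv (WAdd x (WAdd y z)) (WAdd (WAdd x y) z)
| weq_addC x y : wequiv (WAdd x y) (WAdd y x)
| weq_add0 x : wequiv (WAdd (WScal 0) x) x
| weq_mulA x y z : wequiv (WMul x (WMul y z)) (WMul (WMul x y) z)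
| weq_mul0 x : wequiv (WMul (WScal 0) x) (WScal 0)
| weq_mul1 x : wequiv (WMul (WScal 1) x) x
| weq_mulDl x y z : wequiv (WMul (WAdd x y) z) (WAdd (WMul x z) (WMul y z))
| weq_mulDr x y z : wequiv (WMul x (WAdd y z)) (WAdd (WMul x y) (WMul x z))
| weq_scalC c x : wequiv (WMul (WScal c) x) (WMul x (WScal c))
| weq_weyl : wequiv (WMul WP WQ) (WAdd (WMul WQ WP) (WScal 1)).

Definition wequivb : rel wterm := fun x y => `[< wequiv x y >].

Lemma wequivb_refl : reflexive wequivb.
Proof. by move=> x; apply/asboolP; exact: weq_refl. Qed.

Lemma wequivb_sym : symmetric wequivb.
Proof. by move=> x y; apply/asboolP/asboolP; exact: weq_sym. Qed.

Lemma wequivb_trans : transitive wequivb.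
Proof.
by move=> y x z /asboolP xy /asboolP yz; apply/asboolP; exact: weq_trans yz.
Qed.

Canonical wequiv_equiv := EquivRel wequivb wequivb_refl wequivb_sym wequivb_trans.

(* Representation by differential operators on polynomials, p acting as d/dX  *)
(* and q as multiplication by X; it shows that the presented algebra is not   *)
(* trivial. *)
Fixpoint wact (x : wterm) (u : {poly F}) : {poly F} :=
  match x with
  | WScal c => c *: u
  | WP => u^`()
  | WQ => 'X * u
  | WAdd x y => wact x u + wact y u
  | WMul x y => wact x (wact y u)
  end.

Lemma wact_linear x : linear (wact x).
Proof.
elim: x => [d|||x IHx y IHy|x IHx y IHy] c u v /=.
- by rewrite scalerDr !scalerA mulrC.
- by rewrite derivD derivZ.
- by rewrite mulrDr scalerAr.
- by rewrite IHx IHy scalerDr addrACA.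
- by rewrite IHy IHx.
Qed.

Lemma wact_equiv x y : wequiv x y -> wact x =1 wact y.
Proof.
elim=> //=.
- by move=> {}x {}y _ IH u; rewrite IH.
- by move=> {}x {}y z _ IH1 _ IH2 u; rewrite IH1.
- by move=> {}x x' {}y y' _ IH1 _ IH2 u; rewrite IH1 IH2.
- by move=> {}x x' {}y y' _ IH1 _ IH2 u; rewrite IH2 IH1.
- by move=> c d u; rewrite scalerDl.
- by move=> c d u; rewrite scalerA.
- by move=> {}x {}y z u; rewrite addrA.
- by move=> {}x {}y u; rewrite addrC.
- by move=> {}x u; rewrite scale0r add0r.
- by move=> {}x u; rewrite !scale0r.
- by move=> {}x u; rewrite scale1r.
- by move=> {}x {}y z u; have := wact_linear x 1 (wact y u) (wact z u); rewrite !scale1r.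
- move=> c {}x u; have := wact_linear x c u 0.
  have := wact_linear x (-1) 0 0.
  by rewrite scaleN1r oppr0 addr0 scaleN1r addNr => ->; rewrite !addr0.
- by move=> u; rewrite derivM derivX mul1r scale1r addrC.
Qed.

End WeylTerms.

Definition weyl (F : fieldType) := {eq_quot (@wequiv_equiv F)}.

Section WeylAlgebra.
Variable F : fieldType.
Local Notation A1 := (weyl F).
Local Notation cl := (\pi_(weyl F) : wterm F -> weyl F).
Implicit Types (x y z : A1) (c d : F).
Local Open Scope quotient_scope.

HB.instance Definition _ := Choice.on A1.
HB.instance Definition _ := EqQuotient.on A1.

Lemma weyl_eqP (a b : wterm F) : cl a = cl b <-> wequiv a b.
Proof.
split=> [/eqP|ab]; last by apply/eqP; rewrite eqquotE; apply/asboolP.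
by rewrite eqquotE => /asboolP.
Qed.

Lemma weyl_ind (P : A1 -> Prop) : (forall a, P (cl a)) -> forall x, P x.
Proof. by move=> Pcl x; rewrite -[x]reprK. Qed.

Lemma weyl_repr (a : wterm F) : wequiv (repr (cl a)) a.
Proof. by apply/weyl_eqP; rewrite reprK. Qed.

Definition weyl_scal c : A1 := cl (WScal c).
Definition weyl_p : A1 := cl (WP F).
Definition weyl_q : A1 := cl (WQ F).
Definition weyl_add x y : A1 := cl (WAdd (repr x) (repr y)).
Definition weyl_mul x y : A1 := cl (WMul (repr x) (repr y)).
Definition weyl_opp x : A1 := weyl_mul (weyl_scal (-1)) x.
Definition weyl_scale c x : A1 := weyl_mul (weyl_scal c) x.

Lemma weyl_addE a b : weyl_add (cl a) (cl b) = cl (WAdd a b).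
Proof. by apply/weyl_eqP; apply: weq_add; exact: weyl_repr. Qed.

Lemma weyl_mulE a b : weyl_mul (cl a) (cl b) = cl (WMul a b).
Proof. by apply/weyl_eqP; apply: weq_mul; exact: weyl_repr. Qed.

Let wE := (weyl_addE, weyl_mulE).

Lemma weyl_addA : associative weyl_add.
Proof.
elim/weyl_ind=> a; elim/weyl_ind=> b; elim/weyl_ind=> c.
by rewrite !wE; apply/weyl_eqP; exact: weq_addA.
Qed.

Lemma weyl_addC : commutative weyl_add.
Proof.
by elim/weyl_ind=> a; elim/weyl_ind=> b; rewrite !wE; apply/weyl_eqP; exact: weq_addC.
Qed.

Lemma weyl_add0 : left_id (weyl_scal 0) weyl_add.
Proof. by elim/weyl_ind=> a; rewrite !wE; apply/weyl_eqP; exact: weq_add0. Qed.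

Lemma weyl_mulDl : left_distributive weyl_mul weyl_add.
Proof.
elim/weyl_ind=> a; elim/weyl_ind=> b; elim/weyl_ind=> c.
by rewrite !wE; apply/weyl_eqP; exact: weq_mulDl.
Qed.

Lemma weyl_mulDr : right_distributive weyl_mul weyl_add.
Proof.
elim/weyl_ind=> a; elim/weyl_ind=> b; elim/weyl_ind=> c.
by rewrite !wE; apply/weyl_eqP; exact: weq_mulDr.
Qed.

Lemma weyl_mulA : associative weyl_mul.
Proof.
elim/weyl_ind=> a; elim/weyl_ind=> b; elim/weyl_ind=> c.
by rewrite !wE; apply/weyl_eqP; exact: weq_mulA.
Qed.

Lemma weyl_mul1 : left_id (weyl_scal 1) weyl_mul.
Proof. by elim/weyl_ind=> a; rewrite !wE; apply/weyl_eqP; exact: weq_mul1. Qed.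

Lemma weyl_mul0 : left_zero (weyl_scal 0) weyl_mul.
Proof. by elim/weyl_ind=> a; rewrite !wE; apply/weyl_eqP; exact: weq_mul0. Qed.

Lemma weyl_scalC c x : weyl_mul (weyl_scal c) x = weyl_mul x (weyl_scal c).
Proof.
by elim/weyl_ind: x => a; rewrite !wE; apply/weyl_eqP; exact: weq_scalC.
Qed.

Lemma weyl_scalD c d : weyl_scal (c + d) = weyl_add (weyl_scal c) (weyl_scal d).
Proof. by rewrite wE; apply/weyl_eqP; exact: weq_scalD. Qed.

Lemma weyl_scalM c d : weyl_scal (c * d) = weyl_mul (weyl_scal c) (weyl_scal d).
Proof. by rewrite wE; apply/weyl_eqP; exact: weq_scalM. Qed.

Lemma weyl_addN : left_inverse (weyl_scal 0) weyl_opp weyl_add.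
Proof.
move=> x; rewrite -[X in weyl_add _ X]weyl_mul1 -weyl_mulDl -weyl_scalD.
by rewrite addNr weyl_mul0.
Qed.

Lemma weyl_mulr1 : right_id (weyl_scal 1) weyl_mul.
Proof. by move=> x; rewrite -weyl_scalC weyl_mul1. Qed.

Lemma weyl_oner_neq0 : weyl_scal 1 != weyl_scal 0.
Proof.
apply/eqP => /weyl_eqP /wact_equiv /(_ 1) /= /eqP.
by rewrite scale1r scale0r oner_eq0.
Qed.

HB.instance Definition _ := GRing.isZmodule.Build A1
  weyl_addA weyl_addC weyl_add0 weyl_addN.

HB.instance Definition _ := GRing.Zmodule_isNzRing.Build A1
  weyl_mulA weyl_mul1 weyl_mulr1 weyl_mulDl weyl_mulDr weyl_oner_neq0.

Lemma weyl_scaleA c d x : weyl_scale c (weyl_scale d x) = weyl_scale (c * d) x.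
Proof. by rewrite /weyl_scale weyl_scalM weyl_mulA. Qed.

Lemma weyl_scale1 : left_id 1 weyl_scale.
Proof. exact: weyl_mul1. Qed.

Lemma weyl_scaleDr : right_distributive weyl_scale +%R.
Proof. by move=> c x y; exact: weyl_mulDr. Qed.

Lemma weyl_scaleDl x : {morph weyl_scale^~ x : c d / c + d}.
Proof. by move=> c d; rewrite /weyl_scale weyl_scalD weyl_mulDl. Qed.

HB.instance Definition _ := GRing.Zmodule_isLmodule.Build F A1
  weyl_scaleA weyl_scale1 weyl_scaleDr weyl_scaleDl.

Lemma weyl_scaleAl c x y : c *: (x * y) = c *: x * y.
Proof. exact: weyl_mulA. Qed.

HB.instance Definition _ := GRing.Lmodule_isLalgebra.Build F A1 weyl_scaleAl.

Lemma weyl_scaleAr c x y : c *: (x * y) = x * (c *: y).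
Proof.
rewrite -[LHS]/(weyl_mul _ (weyl_mul x y)) -[RHS]/(weyl_mul x (weyl_mul _ y)).
by rewrite !weyl_mulA weyl_scalC.
Qed.

HB.instance Definition _ := GRing.Lalgebra_isAlgebra.Build F A1 weyl_scaleAr.

Lemma weyl_scalE c : weyl_scal c = c%:A.
Proof. by rewrite -[RHS]/(weyl_mul _ (weyl_scal 1)) weyl_mulr1. Qed.

Lemma weyl_pq : weyl_p * weyl_q - weyl_q * weyl_p = 1.
Proof.
apply/eqP; rewrite subr_eq addrC; apply/eqP.
apply: etrans (weyl_mulE _ _) _; apply/esym; rewrite -[LHS]/(weyl_add (weyl_mul weyl_q weyl_p) (weyl_scal 1)).
rewrite [weyl_mul _ _](weyl_mulE _ _) [LHS](weyl_addE _ _).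
by apply/esym/weyl_eqP; exact: weq_weyl.
Qed.

Section UniversalProperty.
Variables (B : algType F) (P Q : B).
Hypothesis PQ : P * Q - Q * P = 1.

Fixpoint weyl_eval_term (a : wterm F) : B :=
  match a with
  | WScal c => c%:A
  | WP => P
  | WQ => Q
  | WAdd a b => weyl_eval_term a + weyl_eval_term b
  | WMul a b => weyl_eval_term a * weyl_eval_term b
  end.

Lemma weyl_eval_term_equiv a b :
  wequiv a b -> weyl_eval_term a = weyl_eval_term b.
Proof.
elim=> //=.
- by move=> {}a {}b c _ -> _ ->.
- by move=> {}a a' {}b b' _ -> _ ->.
- by move=> {}a a' {}b b' _ -> _ ->.
- by move=> c d; rewrite scalerDl.
- by move=> c d; rewrite -scalerAl mul1r scalerA.
- by move=> *; rewrite addrA.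
- by move=> *; rewrite addrC.
- by move=> *; rewrite scale0r add0r.
- by move=> *; rewrite mulrA.
- by move=> *; rewrite scale0r mul0r.
- by move=> *; rewrite scale1r mul1r.
- by move=> *; rewrite mulrDl.
- by move=> *; rewrite mulrDr.
- by move=> *; rewrite mulr_algl mulr_algr.
- by apply/eqP; rewrite addrC -subr_eq PQ scale1r.
Qed.

Lemma weyl_universal : exists2 h : {lrmorphism A1 -> B},
  h weyl_p = P /\ h weyl_q = Q &
  forall h' : {lrmorphism A1 -> B}, h' weyl_p = P -> h' weyl_q = Q -> h' =1 h.
Proof.
pose h x := weyl_eval_term (repr x).
have hE a : h (cl a) = weyl_eval_term a.
  by apply: weyl_eval_term_equiv; exact: weyl_repr.
have hD x y : h (x + y) = h x + h y.
  by elim/weyl_ind: x => a; elim/weyl_ind: y => b; rewrite -[_ + _]/(weyl_add _ _) wE !hE.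
have hM x y : h (x * y) = h x * h y.
  by elim/weyl_ind: x => a; elim/weyl_ind: y => b; rewrite -[_ * _]/(weyl_mul _ _) wE !hE.
have h1 : h 1 = 1 by rewrite hE /= scale1r.
have hZ c x : h (c *: x) = c *: h x.
  by rewrite -[c *: x]/(weyl_scal c * x) hM hE /= mulr_algl.
have hlin : linear h by move=> c x y; rewrite hD hZ.
pose m1 := GRing.isLinear.Build F A1 B *:%R h hlin.
pose m2 := GRing.isMonoidMorphism.Build A1 B h (h1, hM).
pose H : {lrmorphism A1 -> B} := HB.pack h m1 m2.
exists H; first by split; rewrite -[LHS]/(h _) hE.
move=> h' h'p h'q; elim/weyl_ind => a; rewrite -[RHS]/(h _) hE.
elim: a => [c|||a IHa b IHb|a IHa b IHb] //=.
- by rewrite -/(weyl_scal c) weyl_scalE linearZ /= rmorph1.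
- by rewrite -weyl_addE -IHa -IHb; exact: rmorphD.
- by rewrite -weyl_mulE -IHa -IHb; exact: rmorphM.
Qed.

End UniversalProperty.

End WeylAlgebra.

Definition lie (A : pzRingType) (a b : A) : A := a * b - b * a.

Section Lie.
Variables (F : fieldType) (A : algType F).
Implicit Types (x y z : A) (c : F).

Lemma lieDl x y z : lie (x + y) z = lie x z + lie y z.
Proof. by rewrite /lie mulrDl mulrDr opprD addrACA. Qed.

Lemma lieDr x y z : lie x (y + z) = lie x y + lie x z.
Proof. by rewrite /lie mulrDl mulrDr opprD addrACA. Qed.

Lemma lieZl c x y : lie (c *: x) y = c *: lie x y.
Proof. by rewrite /lie scalerBr -scalerAl -scalerAr. Qed.

Lemma lieZr c x y : lie x (c *: y) = c *: lie x y.
Proof. by rewrite /lie scalerBr -scalerAl -scalerAr. Qed.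

Lemma liexx x : lie x x = 0.
Proof. exact: subrr. Qed.

Lemma lieC x y : lie x y = - lie y x.
Proof. by rewrite /lie opprB. Qed.

End Lie.

Section Sl2.
Variable F : fieldType.

Record sl2 : Type := Sl2 { sl2_mx :> 'M[F]_2; sl2_tr : \tr sl2_mx == 0 }.

HB.instance Definition _ := [isSub for sl2_mx].
HB.instance Definition _ := [Choice of sl2 by <:].

Fact sl2_submod : GRing.submod_closed (fun x : 'M[F]_2 => \tr x == 0).
Proof.
split=> [|c x y /eqP trx /eqP try]; first by rewrite unfold_in mxtrace0.
by rewrite unfold_in mxtraceD mxtraceZ trx try mulr0 addr0.
Qed.

HB.instance Definition _ := GRing.SubChoice_isSubLmodule.Build F 'M[F]_2
  (fun x : 'M[F]_2 => \tr x == 0) sl2 sl2_submod.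

Fact sl2_lie_tr (x y : sl2) : \tr (lie (x : 'M[F]_2) y) == 0.
Proof. by rewrite /lie linearB /= [X in X - _]mxtrace_mulC subrr. Qed.

Definition sl2_lie (x y : sl2) : sl2 := Sl2 (sl2_lie_tr x y).

Fact sl2_ep_tr : \tr (delta_mx 0 1 : 'M[F]_2) == 0.
Proof. by rewrite /mxtrace !big_ord_recl big_ord0 !mxE /= !addr0. Qed.

Fact sl2_em_tr : \tr (delta_mx 1 0 : 'M[F]_2) == 0.
Proof. by rewrite /mxtrace !big_ord_recl big_ord0 !mxE /= !addr0. Qed.

Fact sl2_e0_tr : \tr (delta_mx 0 0 - delta_mx 1 1 : 'M[F]_2) == 0.
Proof.
by rewrite /mxtrace !big_ord_recl big_ord0 !mxE /= subr0 sub0r addr0 subrr.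
Qed.

Definition sl2_ep : sl2 := Sl2 sl2_ep_tr.
Definition sl2_em : sl2 := Sl2 sl2_em_tr.
Definition sl2_e0 : sl2 := Sl2 sl2_e0_tr.

Lemma sl2_decomp (x : sl2) :
  x = (x : 'M[F]_2) 0 1 *: sl2_ep + (x : 'M[F]_2) 1 0 *: sl2_em
      + (x : 'M[F]_2) 0 0 *: sl2_e0.
Proof.
apply: val_inj; apply/matrixP => i j; rewrite /= !mxE.
have x11 : sl2_mx x 1 1 = - sl2_mx x 0 0.
  have := sl2_tr x; rewrite /mxtrace !big_ord_recl big_ord0 addr0 addrC addr_eq0.
  by rewrite (_ : lift ord0 ord0 = 1) //; [move/eqP|exact/val_inj].
have o2 (k : 'I_2) : k = 0 \/ k = 1.
  by case: k => [[|[|//]] ?]; [left|right]; exact/val_inj.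
have [] := (o2 i, o2 j); case=> -> [] ->; rewrite /= ?(mulr1, mulr0, subr0, sub0r, addr0, add0r, mulrN1) //.
Qed.

(* Linear extension of e_+ |-> vp, e_- |-> vm, e_0 |-> v0. *)
Definition sl2_extend (V : lmodType F) (vp vm v0 : V) (x : sl2) : V :=
  (x : 'M[F]_2) 0 1 *: vp + (x : 'M[F]_2) 1 0 *: vm + (x : 'M[F]_2) 0 0 *: v0.


Lemma sl2_extend_ep (V : lmodType F) (vp vm v0 : V) :
  sl2_extend vp vm v0 sl2_ep = vp.
Proof. by rewrite /sl2_extend /= !mxE /= scale1r !scale0r !addr0. Qed.

Lemma sl2_extend_em (V : lmodType F) (vp vm v0 : V) :
  sl2_extend vp vm v0 sl2_em = vm.
Proof. by rewrite /sl2_extend /= !mxE /= scale1r !scale0r addr0 add0r. Qed.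

Lemma sl2_extend_e0 (V : lmodType F) (vp vm v0 : V) :
  sl2_extend vp vm v0 sl2_e0 = v0.
Proof. by rewrite /sl2_extend /= !mxE /= !subr0 scale1r !scale0r !add0r. Qed.

Lemma sl2_extend_linear (V : lmodType F) (vp vm v0 : V) :
  linear (sl2_extend vp vm v0).
Proof.
move=> c x y; rewrite /sl2_extend /= !mxE !scalerDl !scalerDr !scalerA.
by rewrite [LHS](AC (2*2*2) ((1*3*5)*(2*4*6))).
Qed.

Lemma sl2_mx11 (x : sl2) : (x : 'M[F]_2) 1 1 = - (x : 'M[F]_2) 0 0.
Proof.
have := sl2_tr x; rewrite /mxtrace !big_ord_recl big_ord0 addr0 addrC addr_eq0.
by rewrite (_ : lift ord0 ord0 = 1) //; [move/eqP|exact/val_inj].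
Qed.

Lemma sl2_lieE (x y : sl2) i j : (sl2_lie x y : 'M[F]_2) i j =
  (x : 'M[F]_2) i 0 * (y : 'M[F]_2) 0 j + (x : 'M[F]_2) i 1 * (y : 'M[F]_2) 1 j
  - ((y : 'M[F]_2) i 0 * (x : 'M[F]_2) 0 j
     + (y : 'M[F]_2) i 1 * (x : 'M[F]_2) 1 j).
Proof.
have lift0 : lift ord0 ord0 = 1 :> 'I_2 by exact/val_inj.
rewrite -[LHS]/((sl2_mx x *m sl2_mx y - sl2_mx y *m sl2_mx x) i j) !mxE.
by rewrite !big_ord_recl !big_ord0 !addr0 lift0.
Qed.

Lemma sl2_extend_lie (A : algType F) (vp vm v0 : A) :
  lie vp vm = v0 -> lie v0 vp = 2 *: vp -> lie v0 vm = - 2 *: vm ->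
  forall x y, sl2_extend vp vm v0 (sl2_lie x y)
            = lie (sl2_extend vp vm v0 x) (sl2_extend vp vm v0 y).
Proof.
move=> pm zp zm x y; rewrite /sl2_extend !(lieDl, lieDr, lieZl, lieZr) !liexx.
rewrite (lieC vm vp) (lieC vp v0) (lieC vm v0) pm zp zm.
rewrite !sl2_lieE !sl2_mx11.
move: (sl2_mx x 0 0) (sl2_mx x 0 1) (sl2_mx x 1 0) => x1 x2 x3.
move: (sl2_mx y 0 0) (sl2_mx y 0 1) (sl2_mx y 1 0) => y1 y2 y3.
rewrite !scaler0 -!scaleN1r !scalerA !(addr0, add0r).
rewrite [RHS](AC (2*2*2) ((2*5)*(4*6)*(1*3))) /=.
by congr (_ + _ + _); rewrite -[RHS]scalerDl; congr (_ *: _); ring.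
Qed.

End Sl2.

Section AdjointAction.
Variables (F : fieldType) (A : algType F).
Implicit Types (x y z : A) (l : F).

Definition lin_span (V : lmodType F) (S : set V) : set V :=
  [set u | exists n (c : 'I_n -> F) (s : 'I_n -> V),
     (forall i, S (s i)) /\ u = \sum_i c i *: s i].

(* N(x), C(x) and D(x). *)
Definition ad_nil x : set A :=
  [set y | exists2 m : nat, (0 < m)%N & iter m (lie x) y = 0].

Definition centralizer x : set A := [set y | lie x y = 0].

Definition ad_diag x : set A :=
  lin_span [set y | exists l, lie x y = l *: y].

Definition is_scalar x : Prop := exists c : F, x = c%:A.

Definition strictly_nilpotent x : Prop :=
  [/\ ~ is_scalar x, ad_diag x = centralizer x,
      ad_nil x <> centralizer x & ad_nil x = setT].

Definition strictly_semisimple x : Prop :=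
  [/\ ~ is_scalar x, ad_diag x <> centralizer x,
      ad_nil x = centralizer x & ad_diag x = setT].

Definition ad_eigenvector x y : Prop := y <> 0 /\ exists l, lie x y = l *: y.

Definition is_basis (V : lmodType F) n (v : 'I_n -> V) (W : set V) : Prop :=
  (forall c : 'I_n -> F, \sum_i c i *: v i = 0 -> forall i, c i = 0)
  /\ lin_span (range v) = W.

End AdjointAction.

Section Automorphisms.
Variable F : fieldType.

Record alg_aut (A : algType F) : Type := AlgAut {
  alg_aut_map :> {lrmorphism A -> A};
  alg_aut_bij : bijective alg_aut_map }.

Record sl2_aut : Type := Sl2Aut {
  sl2_aut_map :> sl2 F -> sl2 F;
  sl2_aut_inv : sl2 F -> sl2 F;
  sl2_aut_linear : linear sl2_aut_map;
  sl2_aut_lie : {morph sl2_aut_map : x y / sl2_lie x y};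
  sl2_aut_mapK : cancel sl2_aut_map sl2_aut_inv;
  sl2_aut_invK : cancel sl2_aut_inv sl2_aut_map }.

Definition sl2_embedding (A : algType F) : set (sl2 F -> A) :=
  [set f | [/\ linear f,
               forall x y, f (sl2_lie x y) = lie (f x) (f y) & injective f]].

Definition aut_act (A : algType F) (g : alg_aut A * sl2_aut) (f : sl2 F -> A) :
  sl2 F -> A := g.1 \o f \o sl2_aut_inv g.2.

Lemma aut_act_embedding (A : algType F) (g : alg_aut A * sl2_aut) f :
  sl2_embedding f -> sl2_embedding (aut_act g f).
Proof.
case: g => a [w v w_lin w_lie wK vK] [f_lin f_lie f_inj].
have v_lin : linear v.
  by move=> c x y; rewrite -[RHS]wK w_lin !vK.
have v_lie x y : v (sl2_lie x y) = sl2_lie (v x) (v y).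
  by rewrite -[RHS]wK w_lie !vK.
split=> [c x y|x y|x y]; rewrite /aut_act /=.
- by rewrite v_lin f_lin linearP.
- by rewrite v_lie f_lie /lie rmorphB !rmorphM.
- by move=> /(bij_inj (alg_aut_bij a)) /f_inj /(can_inj vK).
Qed.

End Automorphisms.

Section NormalForms.
Variable F : fieldType.
Local Notation A1 := (weyl F).
Local Notation p := (weyl_p F).
Local Notation q := (weyl_q F).

Definition f_I : sl2 F -> A1 :=
  sl2_extend (- (2^-1 *: q ^+ 2)) (2^-1 *: p ^+ 2) (2^-1 *: (p * q + q * p)).

Definition f_II (b : F) : sl2 F -> A1 :=
  sl2_extend ((b%:A + p * q) * q) (- p) (2 *: (p * q) + b%:A).

Definition normal_forms : set (sl2 F -> A1) := [set f_I] `|` range f_II.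

Definition weyl_act (x : A1) (u : {poly F}) : {poly F} := wact (repr x) u.

Lemma weyl_actE a u : weyl_act (\pi_(weyl F)%qT a) u = wact a u.
Proof. by apply: wact_equiv; exact: weyl_repr. Qed.

Lemma weyl_actD x y u : weyl_act (x + y) u = weyl_act x u + weyl_act y u.
Proof. exact: weyl_actE. Qed.

Lemma weyl_actM x y u : weyl_act (x * y) u = weyl_act x (weyl_act y u).
Proof. exact: weyl_actE. Qed.

Lemma weyl_actZ c x u : weyl_act (c *: x) u = c *: weyl_act x u.
Proof. by rewrite [LHS]weyl_actE /= [X in X = _]weyl_actE. Qed.

Lemma weyl_act1 u : weyl_act 1 u = u.
Proof. by rewrite [LHS]weyl_actE /= scale1r. Qed.

Lemma weyl_act0 u : weyl_act 0 u = 0.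
Proof. by rewrite [LHS]weyl_actE /= scale0r. Qed.

Lemma weyl_actN x u : weyl_act (- x) u = - weyl_act x u.
Proof. by rewrite -!scaleN1r weyl_actZ. Qed.

Lemma weyl_act_p u : weyl_act p u = u^`().
Proof. exact: weyl_actE. Qed.

Lemma weyl_act_q u : weyl_act q u = 'X * u.
Proof. exact: weyl_actE. Qed.

Let pqE : p * q = q * p + 1.
Proof. by rewrite -(weyl_pq F) addrC subrK. Qed.

Lemma lieMr (x y z : A1) : lie x (y * z) = lie x y * z + y * lie x z.
Proof. by rewrite /lie mulrBl mulrBr !mulrA addrA subrK. Qed.

Lemma lieMl (x y z : A1) : lie (x * y) z = x * lie y z + lie x z * y.
Proof. by rewrite /lie mulrBl mulrBr !mulrA addrA subrK. Qed.

Let lpq : lie p q = 1. Proof. exact: weyl_pq. Qed.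
Let lqp : lie q p = -1. Proof. by rewrite lieC lpq. Qed.

Let lpqq : lie (p * q) q = q. Proof. by rewrite lieMl liexx mulr0 add0r lpq mul1r. Qed.
Let lqpq : lie (q * p) q = q. Proof. by rewrite lieMl liexx mul0r addr0 lpq mulr1. Qed.
Let lpqp : lie (p * q) p = - p.
Proof. by rewrite lieMl liexx mul0r addr0 lqp mulrN1. Qed.
Let lqpp : lie (q * p) p = - p.
Proof. by rewrite lieMl liexx mulr0 add0r lqp mulN1r. Qed.
Let lieNl (x y : A1) : lie (- x) y = - lie x y.
Proof. by rewrite -!scaleN1r lieZl. Qed.
Let lieNr (x y : A1) : lie x (- y) = - lie x y.
Proof. by rewrite -!scaleN1r lieZr. Qed.

Lemma f_II_embedding (b : F) : (2 : F) != 0 -> sl2_embedding (f_II b).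
Proof.
move=> F2; have lb (x : A1) : lie b%:A x = 0.
  by rewrite /lie -scalerAl mul1r -scalerAr mulr1 subrr.
have lb' (x : A1) : lie x b%:A = 0 by rewrite lieC lb oppr0.
split; first exact: sl2_extend_linear.
  apply: sl2_extend_lie.
  - rewrite lieNr lieMl lieDl lb add0r lpqp lqp mulrN1 mulNr -opprD opprK.
    by rewrite scaler_nat mulr2n addrC addrA addrAC addrC addrA.
  - rewrite lieDl lb addr0 lieZl; congr (_ *: _).
    by rewrite lieMr lieDr lb' liexx addr0 mul0r add0r lpqq.
  - by rewrite lieDl lb addr0 lieZl lieNr lpqp scaleNr scalerN.
move=> x y fxy; apply/eqP; rewrite -subr_eq0; apply/eqP.
have {fxy} : f_II b (x - y) = 0.
  have := sl2_extend_linear ((b%:A + p * q) * q) (- p) (2 *: (p * q) + b%:A) (-1) y x.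
  by rewrite -!/(f_II b) fxy !scaleN1r addNr addrC => ->.
move: (x - y) => {y} {}x fx0.
have key u i : (weyl_act (f_II b x) u)`_i = 0 by rewrite fx0 weyl_act0 coef0.
have actE := (weyl_actD, weyl_actZ, weyl_actN, weyl_actM, weyl_act_p, weyl_act_q,
  weyl_act1).
have kE := (coefD, coefZ, coefN, coef_deriv, coefXM, coefX, coef1).
have := (key 1 0, key 1 1, key 'X 0, key 'X 1, key 'X 2%N).
rewrite /f_II /sl2_extend !(actE, kE) /=.
rewrite !(mulr0n, mulr1n, mul0rn, oppr0, mulr0, mul0r, addr0, add0r, mulr1).
case=> [[[[h0 h1] /eqP h2] h3] h4].
rewrite mulrN1 oppr_eq0 in h2.
rewrite [x]sl2_decomp (eqP h2) scale0r addr0.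
have [b2|b2] := eqVneq (b + 2) 0.
  have b3 : b + 3%:R = 1 by rewrite -[RHS]add0r -b2; ring.
  have b4 : 2 * 2%:R + b = 2.
    rewrite -[RHS]add0r -b2; ring.
  rewrite b3 mulr1 in h4; rewrite b4 in h3.
  move/eqP: h3; rewrite mulf_eq0 (negbTE F2) orbF => /eqP ->.
  by rewrite h4 !scale0r addr0.
move/eqP: h0; rewrite mulf_eq0 [2 + b]addrC (negbTE b2) orbF => /eqP ->.
move/eqP: h1; rewrite mulf_eq0 (negbTE b2) orbF => /eqP ->.
by rewrite !scale0r addr0.
Qed.

Lemma f_I_embedding : (2 : F) != 0 -> sl2_embedding f_I.
Proof.
move=> F2; split; first exact: sl2_extend_linear.
  apply: sl2_extend_lie.
  - rewrite lieNl lieZl lieZr !expr2 lieMr !lieMl lqp.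
    rewrite !(mulrN1, mulN1r, mulNr, mulrN) -!opprD !(mulNr, mulrN) -opprD.
    rewrite !scalerN opprK mulrDl mulrDr -[q * p + q * p]mulr2n -[p * q + p * q]mulr2n.
    by rewrite -mulrnDl -scaler_nat (scalerA _ 2) mulVf // scale1r addrC.
  - rewrite lieNr lieZl lieZr !expr2 lieMr !lieDl lpqq lqpq mulrDl mulrDr.
    rewrite -[_ + _ + _]mulr2n -[q * q + q * q]mulr2n -!scaler_nat !scalerN.
    by rewrite !scalerA; congr (- (_ *: _)); field.
  - rewrite lieZl lieZr !expr2 lieMr !lieDl lpqp lqpp -opprD mulNr mulrN mulrDl mulrDr.
    rewrite -opprD -[_ + _ + _]mulr2n -[p * p + p * p]mulr2n -!scaler_nat !scalerN.
    by rewrite scaleNr !scalerA; congr (- (_ *: _)); field.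
move=> x y fxy; apply/eqP; rewrite -subr_eq0; apply/eqP.
have {fxy} : f_I (x - y) = 0.
  have := sl2_extend_linear (- (2^-1 *: q ^+ 2)) (2^-1 *: p ^+ 2) (2^-1 *: (p * q + q * p)) (-1) y x.
  by rewrite -!/f_I fxy !scaleN1r addNr addrC => ->.
move: (x - y) => {y} {}x fx0.
have key u i : (weyl_act (f_I x) u)`_i = 0 by rewrite fx0 weyl_act0 coef0.
have actE := (weyl_actD, weyl_actZ, weyl_actN, weyl_actM, weyl_act_p, weyl_act_q,
  weyl_act1).
have kE := (coefD, coefZ, coefN, coef_deriv, coefXM, coefX, coef1).
have := (key 1 0, key 1 2%N, key ('X * 'X) 0).
rewrite /f_I /sl2_extend !expr2 !(actE, kE) /=.
rewrite !(mulr0n, mulr1n, mul0rn, oppr0, mulr0, mul0r, addr0, add0r, mulr1).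
case=> [[/eqP h0 /eqP h1] /eqP h2]; have F2i := F2; rewrite -invr_eq0 in F2i.
rewrite mulf_eq0 (negbTE F2i) orbF in h0.
rewrite mulf_eq0 oppr_eq0 (negbTE F2i) orbF in h1.
rewrite mulVf // mulr1 in h2.
by rewrite [x]sl2_decomp (eqP h0) (eqP h1) (eqP h2) !scale0r !addr0.
Qed.

Lemma normal_forms_embedding : (2 : F) != 0 ->
  normal_forms `<=` sl2_embedding (A := A1).
Proof.
by move=> F2 _ [->|[b _ <-]]; [exact: f_I_embedding|exact: f_II_embedding].
Qed.

End NormalForms.

Section Exponentiation.
Variable R : realType.
Local Notation C := R[i].

(* The library puts the norm topology of C on the regular module C^o, so     *)
(* derivability in the direction 1 is complex differentiability.              *)
Definition holomorphic (g : C -> C) : Prop :=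
  forall t : C, derivable (g : C^o -> C^o) t 1.

(* Finite-dimensional complex vector spaces carry no canonical topology in    *)
(* the library: holomorphy of a map into V_a and its derivative are expressed *)
(* by the coordinates in a basis of V_a; the choice of basis is immaterial.   *)
Definition exponentiable (A : algType C) (Z : A) : Prop :=
  exists2 Phi : C -> alg_aut A,
    forall s t a, Phi (s + t) a = Phi s (Phi t a) &
    forall a : A, exists n (v : 'I_n -> A) (c : 'I_n -> C -> C),
      [/\ is_basis v (lin_span (range (fun t => Phi t a))),
          forall t, Phi t a = \sum_i c i t *: v i,
          forall i, holomorphic (c i) &
          \sum_i 'D_1 (c i : C^o -> C^o) 0 *: v i = lie Z a].

End Exponentiation.

(* Main.v *)
Require Import Defs.
From mathcomp Require Import all_boot all_order all_algebra.
From mathcomp Require Import all_classical all_reals all_analysis.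
From mathcomp Require Import complex ring zify.

Set Implicit Arguments.
Unset Strict Implicit.
Unset Printing Implicit Defensive.

Import Order.TTheory GRing.Theory Num.Theory.
Local Open Scope ring_scope.

(** The theorem rests on a result of Dixmier: if ad x is locally finite on the Weyl
  algebra, then some automorphism maps x to a polynomial in q, or to l pq + m with
  l nonzero (locally_finite_normalizable). Strictly semi-simple, strictly nilpotent
  and exponentiable elements all have this property, so each of (ii) to (vi) allows
  one to assume that f(z), or an eigenvector of ad f(z), is of this form.

  Dixmier's result is proved with Newton polygons. Write elements as sums of
  q^i p^j and give q and p weights u and v. The leading form of a commutator is the
  Poisson bracket of the leading forms (lie_top); if the weight of x exceeds u + v,
  its leading form f therefore defines a locally nilpotent derivation {f, .} of the
  polynomial ring (locally_finite_poisson_nil). For such a derivation the order of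
  nilpotency is additive on products, which restricts how p and q may divide the
  partial derivatives of f (der_nil_dvd, der_nil_dvd2). Consequently an edge of the
  Newton polygon that starts at q^n has an integral slope s, and a shear
  p -> p + c q^s removes q^n and lowers the degree (newton_step). This stops at
  elements that are affine in p, where the normal form is immediate.

  If f(z) = g(q), then z may be taken to be e_-, and [e_0, e_-] = - 2 e_- forces
  f(e_0) to be affine in p; so f(e_0) becomes l pq + m (lie_poly_q_eigen,
  conj_normal_poly_q). If f(e_0) = l pq + m, then f(e_+) and f(e_-) have opposite
  integral weights under ad(pq), and comparing degrees in [e_+, e_-] = e_0 leaves
  only the normal forms (conj_normal_pos). An eigenvector in place of f(z) itself
  leads to one of these cases as well (conj_normal_eigenvector).

  Conversely, in a normal form e_0 is mapped to l pq + m, for which every q^i p^j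
  is an eigenvector, and e_- to a polynomial in p, which is locally nilpotent and
  generates a group of shears (poly_q_exponentiable). *)

(** * Locally nilpotent derivations *)

Section Derivation.
Variables (R : pzRingType) (D : R -> R).
Hypothesis DD : {morph D : x y / x + y}.
Hypothesis DM : forall x y, D (x * y) = D x * y + x * D y.

Lemma der0 : D 0 = 0.
Proof. by apply: (addrI (D 0)); rewrite -DD !addr0. Qed.

Lemma der_sum I (r : seq I) (P : pred I) (G : I -> R) :
  D (\sum_(i <- r | P i) G i) = \sum_(i <- r | P i) D (G i).
Proof. exact: (big_morph D DD der0). Qed.

Lemma der_mulrn x n : D (x *+ n) = D x *+ n.
Proof. by elim: n => [|n IHn]; rewrite ?mulr0n ?der0 // !mulrS DD IHn. Qed.

Lemma iter_der0 n : iter n D 0 = 0.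
Proof. by elim: n => //= n ->; exact: der0. Qed.

Lemma iter_derD n : {morph iter n D : x y / x + y}.
Proof. by elim: n => // n IHn x y; rewrite !iterS IHn DD. Qed.

Lemma iter_der_eq0 m n x : (m <= n)%N -> iter m D x = 0 -> iter n D x = 0.
Proof. by move=> /subnK <- x0; rewrite iterD x0 iter_der0. Qed.

Lemma iter_derM n x y : iter n D (x * y) =
  \sum_(k < n.+1) (iter k D x * iter (n - k) D y) *+ 'C(n, k).
Proof.
elim: n => [|n IHn]; first by rewrite big_ord1 subnn bin0.
rewrite iterS IHn der_sum.
transitivity (\sum_(k < n.+1) (iter k.+1 D x * iter (n - k) D y) *+ 'C(n, k) +
              \sum_(k < n.+1) (iter k D x * iter (n.+1 - k) D y) *+ 'C(n, k)).
  rewrite -big_split /=; apply: eq_bigr => k _.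
  by rewrite der_mulrn DM mulrnDl -iterS subSn // -ltnS.
rewrite [RHS]big_ord_recl [X in _ + X]big_ord_recl !subn0 !bin0 /= addrCA.
congr (_ + _).
under [X in _ = X]eq_bigr do rewrite /bump /= add1n binS mulrnDr subSS.
rewrite [RHS]big_split /= addrC; congr (_ + _).
rewrite [RHS]big_ord_recr /= bin_small // mulr0n addr0.
by apply: eq_bigr => k _; rewrite /bump /= add1n subSS.
Qed.

Definition der_nil x := exists n, iter n D x = 0.

Lemma der_nilD x y : der_nil x -> der_nil y -> der_nil (x + y).
Proof.
move=> [m xm] [n yn]; exists (maxn m n).
by rewrite iter_derD !(iter_der_eq0 _ xm, iter_der_eq0 _ yn) ?addr0 ?leq_maxl ?leq_maxr.
Qed.

Lemma der_nilM x y : der_nil x -> der_nil y -> der_nil (x * y).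
Proof.
move=> [m xm] [n yn]; exists (m + n)%N; rewrite iter_derM big1 // => k _.
have [mk|km] := leqP m k; first by rewrite (iter_der_eq0 mk) // mul0r mul0rn.
by rewrite (iter_der_eq0 _ yn) ?mulr0 ?mul0rn //; lia.
Qed.

Lemma der_nil_order x : der_nil x -> x != 0 ->
  exists2 k, iter k D x != 0 & iter k.+1 D x = 0.
Proof.
move=> [n xn] x0; have ex : exists n, iter n D x == 0 by exists n; exact/eqP.
case: (ex_minnP ex) => -[|k] /eqP xk kmin; first by case/eqP: x0.
by exists k => //; apply/negP => /kmin; rewrite ltnn.
Qed.

End Derivation.

Section DerivationDomain.
Variables (R : idomainType) (D : R -> R).
Hypothesis char0 : forall (x : R) n, (x *+ n.+1 == 0) = (x == 0).
Hypothesis DD : {morph D : x y / x + y}.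
Hypothesis DM : forall x y, D (x * y) = D x * y + x * D y.

(** The leading terms of iter (i + j) D (x * y), for the orders i of x and j of y,
  do not cancel in characteristic 0: orders of nilpotency are additive. *)
Lemma iter_derM_neq0 x y k : der_nil D x -> der_nil D y -> y != 0 ->
  iter k D x != 0 -> iter k D (x * y) != 0.
Proof.
move=> nx ny y0 xk; have x0 : x != 0.
  by apply: contra_neq xk => ->; exact: iter_der0.
have [i xi xi1] := der_nil_order nx x0; have [j yj yj1] := der_nil_order ny y0.
have: iter (i + j) D (x * y) != 0.
  have ij : (i < (i + j).+1)%N by rewrite ltnS leq_addr.
  rewrite iter_derM // (bigD1 (Ordinal ij)) //= big1 ?addr0 => [|k' kk'].
    rewrite addKn; have := bin_gt0 (i + j) i; rewrite leq_addr.
    by case: 'C(_, _) => // n _; rewrite char0 mulf_neq0.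
  have [lik|lki] := ltnP i k'; first by rewrite (iter_der_eq0 _ lik) // mul0r mul0rn.
  have {}lki : (k' < i)%N.
    by rewrite ltn_neqAle lki andbT; apply: contra_neq kk' => kk'; exact: val_inj.
  by rewrite (iter_der_eq0 _ _ yj1) ?mulr0 ?mul0rn //; lia.
apply: contra_neq => xy0; apply: iter_der_eq0 xy0 => //.
rewrite leqNgt; apply: contraNN xk => ijk.
by apply/eqP; apply: iter_der_eq0 xi1 => //; lia.
Qed.

(** Otherwise the order of nilpotency of D x = x * g, which is one less than that
  of x, would be at least that of x. *)
Lemma der_nil_dvd x g : der_nil D x -> der_nil D g ->
  D x = x * g -> D x = 0.
Proof.
move=> nx ng Dx; have [->|x0] := eqVneq x 0; first exact: der0.
have [->|g0] := eqVneq (D x) 0; first by [].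
have [k xk xk1] := der_nil_order nx x0.
have gn0 : g != 0 by apply: contra_neq g0 => g0; rewrite Dx g0 mulr0.
have := iter_derM_neq0 nx ng gn0 xk.
by rewrite -Dx -iterSr xk1 eqxx.
Qed.

(** Otherwise each of x and y would have a larger order of nilpotency than the
  other. *)
Lemma der_nil_dvd2 x y g h :
  der_nil D x -> der_nil D y -> der_nil D g -> der_nil D h ->
  D x = y * g -> D y = x * h -> D x = 0 \/ D y = 0.
Proof.
move=> nx ny ng nh Dx Dy.
have [->|g0] := eqVneq (D x) 0; first by left.
have [->|h0] := eqVneq (D y) 0; first by right.
have x0 : x != 0 by apply: contra_neq g0 => ->; exact: der0.
have [k xk xk1] := der_nil_order nx x0.
have gn0 : g != 0 by apply: contra_neq g0 => g0; rewrite Dx g0 mulr0.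
have hn0 : h != 0 by apply: contra_neq h0 => h0; rewrite Dy h0 mulr0.
have := iter_derM_neq0 nx nh hn0 xk; rewrite -Dy -iterSr => yk.
by have := iter_derM_neq0 ny ng gn0 yk; rewrite -Dx -iterSr iterS xk1 der0 ?eqxx.
Qed.

End DerivationDomain.

(** * Normal ordering *)

Section NormalOrder.
Variable F : numFieldType.
Local Notation A1 := (weyl F).
Local Notation p := (weyl_p F).
Local Notation q := (weyl_q F).
Local Notation M := {poly {poly F}}.
Implicit Types (g : {poly F}) (P Q : M) (a b : A1).

Lemma pq_qp : p * q = q * p + 1.
Proof. by rewrite -(weyl_pq F) addrC subrK. Qed.

(** In a symbol, the outer variable stands for p and the inner one for q, so
  that the noncommutative evaluation, which puts coefficients on the left, is
  the normal ordering q^i p^j. *)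
Definition op P : A1 := (map_poly (horner_alg q) P).[p].

Definition dq P : M := map_poly (@deriv F) P.

Lemma op0 : op 0 = 0.
Proof. by rewrite /op rmorph0 horner0. Qed.

Lemma opD : {morph op : P Q / P + Q}.
Proof. by move=> P Q; rewrite /op rmorphD hornerD. Qed.

Lemma opN : {morph op : P / - P}.
Proof. by move=> P; rewrite /op rmorphN hornerN. Qed.

Lemma opB : {morph op : P Q / P - Q}.
Proof. by move=> P Q; rewrite opD opN. Qed.

Lemma opC g : op g%:P = horner_alg q g.
Proof. by rewrite /op map_polyC hornerC. Qed.

Lemma opCM g P : op (g%:P * P) = horner_alg q g * op P.
Proof. by rewrite /op rmorphM /= map_polyC hornerCM. Qed.

Lemma opMX P : op (P * 'X) = op P * p.
Proof. by rewrite /op rmorphM /= map_polyX hornerMX. Qed.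

Lemma opX : op 'X = p.
Proof. by rewrite /op map_polyX hornerX. Qed.

Lemma opq : op 'X%:P = q.
Proof. by rewrite opC; exact: horner_algX. Qed.

Lemma op1 : op 1 = 1.
Proof. by rewrite -[1]/(1%:P) opC rmorph1. Qed.

Lemma op_scalar (c : F) : op c%:P%:P = c%:A.
Proof. by rewrite opC; exact: horner_algC. Qed.

Lemma opZ (c : F) P : op (c%:P%:P * P) = c *: op P.
Proof. by rewrite opCM horner_algC mulr_algl. Qed.

Lemma op_qM P : op ('X%:P * P) = q * op P.
Proof. by rewrite opCM horner_algX. Qed.

Lemma coef_dq P i j : (dq P)`_j`_i = P`_j`_i.+1 *+ i.+1.
Proof. by rewrite coef_map_id0 ?linear0 // coef_deriv. Qed.

Lemma coef_dp P i j : (P^`())`_j`_i = P`_j.+1`_i *+ j.+1.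
Proof. by rewrite coef_deriv coefMn. Qed.

Lemma dqD : {morph dq : P Q / P + Q}.
Proof. exact: raddfD. Qed.

Lemma dq0 : dq 0 = 0.
Proof. exact: raddf0. Qed.

Lemma dqC g : dq g%:P = g^`()%:P.
Proof. by rewrite /dq map_polyC. Qed.

Lemma dqMX P : dq (P * 'X) = dq P * 'X.
Proof.
apply/polyP => j; rewrite coefMX !coef_map_id0 ?linear0 // coefMX.
by case: j => [|j] /=; rewrite ?linear0 // coef_map_id0 ?linear0.
Qed.

Lemma dqM P Q : dq (P * Q) = dq P * Q + P * dq Q.
Proof.
elim/poly_ind: P => [|P c IHP]; first by rewrite dq0 !mul0r dq0 addr0.
have dqCM g : dq (g%:P * Q) = g^`()%:P * Q + g%:P * dq Q.
  apply/polyP => j; rewrite coefD !coefCM !coef_map_id0 ?linear0 // coefCM.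
  exact: derivM.
rewrite mulrDl !dqD !dqC dqCM -mulrA ['X * Q]mulrC mulrA !dqMX IHP; ring.
Qed.

Lemma lie_pq_poly g : lie p (horner_alg q g) = horner_alg q g^`().
Proof.
elim/poly_ind: g => [|g c IHg].
  by rewrite deriv0 !rmorph0 /lie mulr0 mul0r subrr.
rewrite derivD derivC addr0 derivM derivX mulr1 !rmorphD !rmorphM /= horner_algX.
rewrite horner_algC lieDr lieMr IHg [lie p q]weyl_pq mulr1.
by rewrite /lie -scalerAr -scalerAl mulr1 mul1r subrr addr0.
Qed.

Lemma op_pM P : p * op P = op (P * 'X + dq P).
Proof.
elim/poly_ind: P => [|P c IHP]; first by rewrite mul0r dq0 addr0 op0 mulr0.
have pc : p * horner_alg q c = horner_alg q c * p + horner_alg q c^`().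
  by rewrite -lie_pq_poly addrC subrK.
rewrite opD opMX opC mulrDr mulrA IHP pc -opMX -!opC -opMX -!opD; congr op.
rewrite dqD dqC dqMX; ring.
Qed.

Definition poly_antideriv g : {poly F} :=
  \poly_(i < (size g).+1) (g`_i.-1 / i%:R).

Lemma poly_antiderivK g : (poly_antideriv g)^`() = g.
Proof.
apply/polyP => i; rewrite coef_deriv coef_poly ltnS.
case: ltnP => [_|gi]; last by rewrite mul0rn nth_default.
by rewrite -[LHS]mulr_natr divfK // pnatr_eq0.
Qed.

Lemma weyl_act_poly g u : weyl_act (horner_alg q g) u = g * u.
Proof.
elim/poly_ind: g u => [|g c IHg] u; first by rewrite rmorph0 weyl_act0 mul0r.
rewrite rmorphD rmorphM /= horner_algX horner_algC weyl_actD weyl_actM.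
by rewrite weyl_act_q weyl_actZ weyl_act1 IHg mulrDl mul_polyC mulrA.
Qed.

(** On polynomials, q and p act as multiplication by the variable and as the
  derivation. Applied to 1, op P gives the constant term of P in p; the other
  terms are reached by induction, as every polynomial is a derivative. *)
Lemma op_inj : injective op.
Proof.
suff: forall P, (forall u, weyl_act (op P) u = 0) -> P = 0.
  move=> H P Q PQ; apply/eqP; rewrite -subr_eq0; apply/eqP/H => u.
  by rewrite opB PQ subrr weyl_act0.
elim/poly_ind => // P c IHP act0.
have actE u : weyl_act (op (P * 'X + c%:P)) u = weyl_act (op P) u^`() + c * u.
  by rewrite opD opMX opC weyl_actD weyl_actM weyl_act_p weyl_act_poly.
have c0 : c = 0.
  have w0 : weyl_act (op P) 0 = 0.
    rewrite /weyl_act; have := wact_linear (repr (op P)) (-1) 0 0.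
    by rewrite scaler0 addr0 scaleN1r addNr.
  by have := act0 1; rewrite actE -[1]/(1%:P) derivC mulr1 w0 add0r.
rewrite c0 addr0 IHP ?mul0r // => u.
by have := act0 (poly_antideriv u); rewrite actE poly_antiderivK c0 mul0r addr0.
Qed.

Lemma op_surj a : exists P, op P = a.
Proof.
elim/weyl_ind: a => t.
suff [P PE] : exists P, forall Q, exists2 Q', op Q' = \pi_(weyl F)%qT t * op Q & True.
  by case: (PE 1) => Q' Q'E _; exists Q'; rewrite Q'E op1 mulr1.
exists 0; elim: t => [c|||x IHx y IHy|x IHx y IHy] Q.
- by exists (c%:P%:P * Q) => //; rewrite opZ -/(weyl_scal c) weyl_scalE mulr_algl.
- by exists (Q * 'X + dq Q) => //; rewrite -op_pM.
- by exists ('X%:P * Q) => //; rewrite op_qM.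
- have [Q1 E1 _] := IHx Q; have [Q2 E2 _] := IHy Q; exists (Q1 + Q2) => //.
  by rewrite opD E1 E2 -mulrDl -weyl_addE.
- have [Q2 E2 _] := IHy Q; have [Q1 E1 _] := IHx Q2; exists Q1 => //.
  by rewrite E1 E2 mulrA -weyl_mulE.
Qed.

Definition sym a : M := sval (cid (op_surj a)).

Lemma symK : cancel sym op.
Proof. by move=> a; rewrite /sym; case: (cid _). Qed.

Lemma opK : cancel op sym.
Proof. by move=> P; apply: op_inj; rewrite symK. Qed.

Lemma symD : {morph sym : a b / a + b}.
Proof. by move=> a b; apply: op_inj; rewrite opD !symK. Qed.

Lemma symZ (c : F) a : sym (c *: a) = c%:P%:P * sym a.
Proof. by apply: op_inj; rewrite opZ !symK. Qed.

Lemma sym0 : sym 0 = 0.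
Proof. by apply: op_inj; rewrite op0 !symK. Qed.

Lemma sym_eq0 a : (sym a == 0) = (a == 0).
Proof. by rewrite -(can_eq symK) sym0. Qed.

(** By the Leibniz rule, p^j b(q) is the sum of the C(j, k) b^(k)(q) p^(j - k). *)
Lemma op_mul n P Q : (size P <= n)%N ->
  op P * op Q = op (\sum_(k < n) P^`N(k) * iter k dq Q).
Proof.
elim/poly_ind: P n Q => [|P c IHP] n Q.
  move=> _; rewrite op0 mul0r big1 ?op0 // => k _.
  by rewrite nderivn_poly0 ?size_poly0 // mul0r.
case: n => [|n szP].
  by rewrite leqn0 size_poly_eq0 => /eqP ->; rewrite op0 mul0r big_ord0 op0.
have {}szP : (size P <= n)%N.
  move: szP; rewrite size_MXaddC.
  by case: eqVneq => [->|//] /=; rewrite size_poly0.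
rewrite opD opMX opC mulrDl -mulrA op_pM (IHP n) // -opCM -opD; congr op.
rewrite [RHS]big_ord_recl nderivn0 /= mulrDl [RHS]addrAC; congr (_ + _).
have itE k : iter k dq (Q * 'X + dq Q) = iter k dq Q * 'X + iter k.+1 dq Q.
  by elim: k => //= k ->; rewrite dqD dqMX.
under eq_bigr do rewrite itE mulrDr.
rewrite big_split /=.
under [X in _ = _ + X]eq_bigr do
  rewrite /bump /= add1n nderivnMXaddC mulrDl.
rewrite big_split /= [X in _ = _ + X]addrC addrA; congr (_ + _).
transitivity (\sum_(k < n.+1) P^`N(k) * (iter k dq Q * 'X)).
  by rewrite big_ord_recr /= nderivn_poly0 // mul0r addr0.
rewrite big_ord_recl nderivn0 /=; congr (_ + _); first by ring.
by apply: eq_bigr => k _; rewrite /bump /= add1n; ring.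
Qed.

End NormalOrder.

(** * Weights and leading forms *)

Section Weights.
Variable F : numFieldType.
Local Notation A1 := (weyl F).
Local Notation M := {poly {poly F}}.
Variables u v : nat.
Implicit Types (P Q : M) (d e : int).

(** The variables q and p have the weights u and v. Bounds on weights are
  integers, as differentiation may make them negative. *)
Definition wle d P := forall i j, P`_j`_i != 0 -> (u * i + v * j)%N%:Z <= d.

Definition top d P : M := \poly_(j < size P) \poly_(i < size P`_j)
  (if (u * i + v * j)%N%:Z == d then P`_j`_i else 0).

Lemma coef_top d P i j :
  (top d P)`_j`_i = if (u * i + v * j)%N%:Z == d then P`_j`_i else 0.
Proof.
rewrite coef_poly; case: ltnP => [_|jP]; last first.
  by rewrite [P`_j]nth_default // coef0 if_same.
by rewrite coef_poly; case: ltnP => // iP; rewrite nth_default // if_same.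
Qed.

Lemma wle_coef0 d P i j : wle d P -> d < (u * i + v * j)%N%:Z -> P`_j`_i = 0.
Proof. by move=> Pd dij; apply/eqP; apply: contraLR dij => /Pd; lia. Qed.

Lemma wleW d e P : d <= e -> wle d P -> wle e P.
Proof. by move=> de Pd i j /Pd; lia. Qed.

Lemma wle0 d : wle d 0.
Proof. by move=> i j; rewrite !coef0 eqxx. Qed.

Lemma wleD d P Q : wle d P -> wle d Q -> wle d (P + Q).
Proof.
move=> Pd Qd i j; rewrite !coefD; have [->|/Pd //] := eqVneq P`_j`_i 0.
by rewrite add0r => /Qd.
Qed.

Lemma wleN d P : wle d P -> wle d (- P).
Proof. by move=> Pd i j; rewrite !coefN oppr_eq0 => /Pd. Qed.

Lemma wleB d P Q : wle d P -> wle d Q -> wle d (P - Q).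
Proof. by move=> Pd Qd; apply: wleD => //; exact: wleN. Qed.

Lemma wle_sum d I (r : seq I) (K : pred I) (G : I -> M) :
  (forall i, K i -> wle d (G i)) -> wle d (\sum_(i <- r | K i) G i).
Proof.
by move=> Gd; elim/big_ind: _ => // [|P Q]; [exact: wle0|exact: wleD].
Qed.

Lemma topD d : {morph top d : P Q / P + Q}.
Proof.
move=> P Q; apply/polyP => j; apply/polyP => i; rewrite !coefD !coef_top !coefD.
by case: ifP; rewrite ?addr0.
Qed.

Lemma topN d : {morph top d : P / - P}.
Proof.
move=> P; apply/polyP => j; apply/polyP => i; rewrite !coefN !coef_top !coefN.
by case: ifP; rewrite ?oppr0.
Qed.

Lemma topB d : {morph top d : P Q / P - Q}.
Proof. by move=> P Q; rewrite topD topN. Qed.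

Lemma top0 d : top d 0 = 0.
Proof. by apply/polyP => j; apply/polyP => i; rewrite coef_top !coef0 if_same. Qed.

Lemma top_sum d I (r : seq I) (K : pred I) (G : I -> M) :
  top d (\sum_(i <- r | K i) G i) = \sum_(i <- r | K i) top d (G i).
Proof. exact: (big_morph _ (topD d) (top0 d)). Qed.

Lemma top_gt d e P : wle d P -> d < e -> top e P = 0.
Proof.
move=> Pd de; apply/polyP => j; apply/polyP => i; rewrite coef_top !coef0.
by case: eqP => // ije; apply: wle_coef0 Pd _; rewrite ije.
Qed.

Lemma wt_split i j k l : (l <= j)%N -> (k <= i)%N -> (u * i + v * j)%N%:Z =
  (u * k + v * l)%N%:Z + (u * (i - k) + v * (j - l))%N%:Z.
Proof.
by move=> lj ki; rewrite -{1}(subnKC lj) -{1}(subnKC ki) !mulnDr; lia.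
Qed.

Lemma coef_mul2 P Q i j : (P * Q)`_j`_i =
  \sum_(l < j.+1) \sum_(k < i.+1) P`_l`_k * Q`_(j - l)`_(i - k).
Proof. by rewrite coefM coef_sum; apply: eq_bigr => l _; rewrite coefM. Qed.

Lemma wleM d e P Q : wle d P -> wle e Q -> wle (d + e) (P * Q).
Proof.
move=> Pd Qe i j; rewrite coef_mul2; apply: contraR => ij; apply/eqP.
rewrite big1 // => l _; rewrite big1 // => k _.
have [->|/Pd Pd1] := eqVneq P`_l`_k 0; first by rewrite mul0r.
have [->|/Qe Qe1] := eqVneq Q`_(j - l)`_(i - k) 0; first by rewrite mulr0.
case/negP: ij; move: Pd1 Qe1; case: l k => l /= + [k /= +]; rewrite !ltnS => lj ki.
by rewrite (wt_split lj ki); lia.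
Qed.

Lemma topM d e P Q : wle d P -> wle e Q -> top (d + e) (P * Q) = top d P * top e Q.
Proof.
move=> Pd Qe; apply/polyP => j; apply/polyP => i; rewrite coef_top !coef_mul2.
case: eqP => ijde.
  apply: eq_bigr => -[l /= +] _; rewrite ltnS => lj.
  apply: eq_bigr => -[k /= +] _; rewrite ltnS => ki.
  rewrite !coef_top.
  have [P0|Pd1] := eqVneq P`_l`_k 0; first by rewrite P0 if_same !mul0r.
  have [Q0|Qe1] := eqVneq Q`_(j - l)`_(i - k) 0; first by rewrite Q0 if_same !mulr0.
  have := wt_split lj ki; move: (Pd _ _ Pd1) (Qe _ _ Qe1) => {}Pd1 {}Qe1 ij.
  have -> : (u * k + v * l)%N%:Z == d by apply/eqP; lia.
  by have -> : (u * (i - k) + v * (j - l))%N%:Z == e by apply/eqP; lia.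
rewrite big1 // => -[l /= +] _; rewrite ltnS => lj.
rewrite big1 // => -[k /= +] _; rewrite ltnS => ki.
rewrite !coef_top; case: eqP => [kl|_]; last by rewrite mul0r.
case: eqP => [kl'|_]; last by rewrite mulr0.
by case: ijde; rewrite (wt_split lj ki) kl kl'.
Qed.

Lemma wle_nderivn d P k : wle d P -> wle (d - (k * v)%N%:Z) P^`N(k).
Proof.
move=> Pd i j; rewrite coef_nderivn coefMn.
have [->|/Pd] := eqVneq P`_(k + j)`_i 0; first by rewrite mul0rn eqxx.
by rewrite mulnDr mulnC; lia.
Qed.

Lemma wle_dp d P : wle d P -> wle (d - v%:Z) P^`().
Proof. by move/(wle_nderivn (k := 1)); rewrite mul1n nderivn1. Qed.

Lemma wle_dq d P : wle d P -> wle (d - u%:Z) (dq P).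
Proof.
move=> Pd i j; rewrite coef_dq.
have [->|/Pd] := eqVneq P`_j`_i.+1 0; first by rewrite mul0rn eqxx.
by rewrite mulnS; lia.
Qed.

Lemma wle_dq_iter d P k : wle d P -> wle (d - (k * u)%N%:Z) (iter k (@dq F) P).
Proof.
elim: k => [|k IHk] Pd; first by rewrite mul0n subr0.
by rewrite mulSn PoszD opprD addrCA addrC; apply: wle_dq; exact: IHk.
Qed.

Lemma top_dp d P : top (d - v%:Z) P^`() = (top d P)^`().
Proof.
apply/polyP => j; apply/polyP => i; rewrite coef_top !coef_dp coef_top mulnS.
have -> : ((u * i + (v + v * j))%N%:Z == d) = ((u * i + v * j)%N%:Z == d - v%:Z).
  by apply/eqP/eqP; lia.
by case: ifP; rewrite ?mul0rn.
Qed.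

Lemma top_dq d P : top (d - u%:Z) (dq P) = dq (top d P).
Proof.
apply/polyP => j; apply/polyP => i; rewrite coef_top !coef_dq coef_top mulnS.
have -> : ((u + u * i + v * j)%N%:Z == d) = ((u * i + v * j)%N%:Z == d - u%:Z).
  by apply/eqP/eqP; lia.
by case: ifP; rewrite ?mul0rn.
Qed.

Lemma wle_bounded n (s : 'I_n -> M) : exists d, forall i, wle d (s i).
Proof.
suff bnd P : exists d, wle d P.
  elim: n s => [|n IHn] s; first by exists 0; case.
  have [d sd] := IHn (s \o lift ord0); have [e se] := bnd (s ord0).
  exists (Num.max d e) => i; case: (unliftP ord0 i) => [j|] ->.
    by apply: wleW (sd j); rewrite le_max lexx.
  by apply: wleW se; rewrite le_max lexx orbT.
exists (\sum_(j < size P) (u * size (P`_j)%R + v * size P)%N)%N%:Z => i j Pij.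
have jP : (j < size P)%N.
  by rewrite ltnNge; apply: contra Pij => jP; rewrite (nth_default _ jP) coef0.
have iP : (i < size (P`_j)%R)%N.
  by rewrite ltnNge; apply: contra Pij => iP; rewrite (nth_default _ iP).
rewrite lez_nat (bigD1 (Ordinal jP)) //= (leq_trans _ (leq_addr _ _)) //.
by rewrite leq_add // leq_mul2l ltnW ?orbT.
Qed.

(** The Poisson bracket, normalised by {p, q} = 1. *)
Definition poisson P Q : M := P^`() * dq Q - dq P * Q^`().

Lemma poissonDr P : {morph poisson P : Q R / Q + R}.
Proof. by move=> Q R; rewrite /poisson dqD derivD; ring. Qed.

Lemma poissonMr P Q R : poisson P (Q * R) = poisson P Q * R + Q * poisson P R.
Proof. by rewrite /poisson dqM derivM; ring. Qed.

Lemma op_mul_rem d e P Q : wle d P -> wle e Q ->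
  exists2 R, wle (d + e - (2 * (u + v))%N%:Z) R &
             op P * op Q = op (P * Q + P^`() * dq Q + R).
Proof.
move=> Pd Qe.
exists (\sum_(k < size P) P^`N(k.+2) * iter k.+2 (@dq F) Q).
  apply: wle_sum => k _.
  apply: wleW (wleM (wle_nderivn (k := k.+2) Pd) (wle_dq_iter (k := k.+2) Qe)).
  by rewrite !mulSn; lia.
rewrite (@op_mul _ (size P).+2); last by lia.
by rewrite 2!big_ord_recl /= nderivn0 addrA /bump /= add1n nderivn1.
Qed.

Hypothesis uv0 : (0 < u + v)%N.

Lemma op_mul_top d e P Q : wle d P -> wle e Q ->
  wle (d + e) (sym (op P * op Q)) /\
  top (d + e) (sym (op P * op Q)) = top d P * top e Q.
Proof.
move=> Pd Qe; have [R Rd ->] := op_mul_rem Pd Qe; rewrite opK -(topM Pd Qe).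
have Rd' : wle (d + e - (u + v)%N%:Z) (P^`() * dq Q + R).
  apply: wleD; last by apply: wleW Rd; lia.
  by apply: wleW (wleM (wle_dp Pd) (wle_dq Qe)); lia.
rewrite -addrA; split; first by apply: wleD (wleM Pd Qe) (wleW _ Rd'); lia.
by rewrite topD (top_gt Rd') ?addr0 //; lia.
Qed.

(** In the two products the terms without derivatives cancel, those with one
  derivative in each factor give the Poisson bracket, and every further pair of
  derivatives lowers the weight by u + v again. *)
Lemma lie_top d e P Q : wle d P -> wle e Q ->
  wle (d + e - (u + v)%N%:Z) (sym (lie (op P) (op Q))) /\
  top (d + e - (u + v)%N%:Z) (sym (lie (op P) (op Q))) =
    poisson (top d P) (top e Q).
Proof.
move=> Pd Qe; have [R Rd PQ] := op_mul_rem Pd Qe.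
have [S Sd QP] := op_mul_rem Qe Pd.
have -> : sym (lie (op P) (op Q)) = poisson P Q + (R - S).
  by rewrite /lie PQ QP -opB opK /poisson; ring.
have RS : wle (d + e - (2 * (u + v))%N%:Z) (R - S).
  by apply: wleB => //; apply: wleW Sd; lia.
have de1 : d + e - (u + v)%N%:Z = (d - v%:Z) + (e - u%:Z) by lia.
have de2 : d + e - (u + v)%N%:Z = (d - u%:Z) + (e - v%:Z) by lia.
have d1 : wle (d + e - (u + v)%N%:Z) (P^`() * dq Q).
  by rewrite de1; apply: wleM; [exact: wle_dp|exact: wle_dq].
have d2 : wle (d + e - (u + v)%N%:Z) (dq P * Q^`()).
  by rewrite de2; apply: wleM; [exact: wle_dq|exact: wle_dp].
split.
  by apply: wleD; [exact: wleB|apply: wleW RS; lia].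
rewrite topD (top_gt RS) ?addr0; last by lia.
rewrite topB {1}de1 de2 !topM ?top_dp ?top_dq //; do ?[exact: wle_dp|exact: wle_dq].
Qed.

End Weights.

Arguments wle {F}.
Arguments top {F}.

(** * Locally finite elements *)

Section LocallyFinite.
Variables (F : fieldType) (A : algType F).

Definition locally_finite (x : A) := forall a,
  exists n (s : 'I_n -> A), forall m, lin_span (range s) (iter m (lie x) a).

Lemma nilpotent_locally_finite (x : A) :
  ad_nil x = setT -> locally_finite x.
Proof.
move=> xnil a; have [n _ an] : ad_nil x a by rewrite xnil.
exists n, (fun i : 'I_n => iter i (lie x) a) => m.
have [nm|mn] := leqP n m; last first.
  exists 1%N, (fun=> 1), (fun=> iter m (lie x) a); split.
    by move=> _; exists (Ordinal mn).
  by rewrite big_ord1 scale1r.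
exists 0%N, (fun=> 0), (fun=> 0); split; first by case.
by rewrite big_ord0 (iter_der_eq0 (@lieDr _ _ x) nm an).
Qed.

Lemma iter_lie_eigen (x y : A) (l : F) m :
  lie x y = l *: y -> iter m (lie x) y = l ^+ m *: y.
Proof.
move=> xy; elim: m => [|m IHm]; first by rewrite scale1r.
by rewrite iterS IHm lieZr xy scalerA exprSr.
Qed.

Lemma iter_lie_sum (x : A) n (c : 'I_n -> F) (s : 'I_n -> A) m :
  iter m (lie x) (\sum_i c i *: s i) = \sum_i c i *: iter m (lie x) (s i).
Proof.
elim: m => //= m ->; rewrite (der_sum (@lieDr _ _ x)).
by apply: eq_bigr => i _; rewrite lieZr.
Qed.

Lemma diagonalizable_locally_finite (x : A) :
  ad_diag x = setT -> locally_finite x.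
Proof.
move=> xdiag a; have [n [c [s [sE ->]]]] : ad_diag x a by rewrite xdiag.
exists n, s => m; have [l lE] := choice sE.
exists n, (fun i => c i * l i ^+ m), s; split; first by move=> i; exists i.
rewrite iter_lie_sum; apply: eq_bigr => i _.
by rewrite (iter_lie_eigen _ (lE i)) scalerA.
Qed.

Lemma strictly_semisimple_lf (x : A) :
  strictly_semisimple x -> ~ is_scalar x /\ locally_finite x.
Proof. by case=> ? _ _ /diagonalizable_locally_finite. Qed.

Lemma strictly_nilpotent_lf (x : A) :
  strictly_nilpotent x -> ~ is_scalar x /\ locally_finite x.
Proof. by case=> ? _ _ /nilpotent_locally_finite. Qed.

End LocallyFinite.

Section LocallyFiniteWeyl.
Variable F : numFieldType.
Local Notation A1 := (weyl F).
Local Notation M := {poly {poly F}}.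

Lemma poly2_mulrn_eq0 (P : M) n : (P *+ n.+1 == 0) = (P == 0).
Proof.
apply/eqP/eqP => [Pn|->]; last by rewrite mul0rn.
apply/polyP => j; apply/polyP => i; apply/eqP.
by have /eqP := congr1 (fun Q : M => Q`_j`_i) Pn; rewrite !coefMn !coef0 mulrn_eq0.
Qed.

Lemma wle_span u v n (s : 'I_n -> A1) :
  exists d, forall a, lin_span (range s) a -> wle u v d (sym a).
Proof.
have [d sd] := wle_bounded u v (@sym F \o s).
exists d => _ [m [c [t [ts ->]]]].
rewrite (big_morph (@sym F) (@symD F) (@sym0 F)); apply: wle_sum => i _.
rewrite symZ -[d]add0r; apply: wleM => [j k|].
  by rewrite coefC; case: k => [|k]; rewrite ?coefC ?coef0 ?eqxx //; case: j => [|j];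
    rewrite ?eqxx // !muln0.
by have [k _ <-] := ts i; exact: sd.
Qed.

(** If the weight of x exceeds that of pq, then each bracket with the leading
  form of x raises the weight; as the weights of all ad(x)^m y stay bounded, the
  leading forms have to vanish eventually. *)
Lemma locally_finite_poisson_nil u v d (x : A1) (Q : M) : (0 < u + v)%N ->
  locally_finite x -> wle u v d (sym x) -> (u + v)%N%:Z < d ->
  der_nil (poisson (top u v d (sym x))) Q.
Proof.
move=> uv0 xlf xd duv; set D := poisson _.
have nil_homog e R : wle u v e R -> top u v e R = R -> der_nil D R.
  move=> Re tR; have [n [s ss]] := xlf (op R).
  have [N sN] := wle_span u v s.
  have it m : wle u v (e + (d - (u + v)%N%:Z) * m%:Z) (sym (iter m (lie x) (op R))) /\
     top u v (e + (d - (u + v)%N%:Z) * m%:Z) (sym (iter m (lie x) (op R))) =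
       iter m D R.
    elim: m => [|m [IH1 IH2]]; first by rewrite mulr0 addr0 opK.
    have [] := lie_top uv0 xd IH1; rewrite !symK -/(iter m.+1 _ _) IH2.
    suff -> : d + (e + (d - (u + v)%N%:Z) * m%:Z) - (u + v)%N%:Z =
              e + (d - (u + v)%N%:Z) * m.+1%:Z by [].
    by rewrite -[m.+1]addn1 PoszD; ring.
  exists `|N - e|.+1; have [_ <-] := it `|N - e|.+1.
  apply: (top_gt (sN _ (ss _))).
  have : `|N - e|.+1%:Z <= (d - (u + v)%N%:Z) * `|N - e|.+1%:Z.
    by rewrite ler_peMl //; lia.
  by move: (_ * _) => k; lia.
have DD : {morph D : y z / y + z} by exact: poissonDr.
have DM : forall y z, D (y * z) = D y * z + y * D z by exact: poissonMr.
have nilX : der_nil D 'X.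
  apply: (@nil_homog v%:Z) => [i j|].
    rewrite coefX; case: j => [|[|j]] /=; rewrite ?coef0 ?coef1 ?eqxx //.
    by case: i => [|i]; rewrite ?eqxx // muln0 muln1.
  apply/polyP => j; apply/polyP => i; rewrite coef_top coefX.
  case: j => [|[|j]] /=; rewrite ?coef0 ?coef1 ?if_same //.
  by case: i => [|i] /=; rewrite ?if_same // muln0 muln1 eqxx.
have nilq : der_nil D 'X%:P.
  apply: (@nil_homog u%:Z) => [i j|].
    rewrite coefC; case: j => [|j] /=; rewrite ?coef0 ?coefX ?eqxx //.
    by case: i => [|[|i]]; rewrite ?eqxx // muln0 muln1 addn0.
  apply/polyP => j; apply/polyP => i; rewrite coef_top coefC.
  case: j => [|j] /=; rewrite ?coef0 ?coefX ?if_same //.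
  by case: i => [|[|i]] /=; rewrite ?if_same // muln0 muln1 addn0 eqxx.
have nilc (c : F) : der_nil D c%:P%:P.
  by exists 1%N; rewrite /= /D /poisson dqC !derivC polyC0 !mulr0 subrr.
have nilC (g : {poly F}) : der_nil D g%:P.
  elim/poly_ind: g => [|g c IHg]; first exact: (nilc 0).
  by rewrite polyCD polyCM; apply: der_nilD => //; exact: der_nilM.
elim/poly_ind: Q => [|Q c IHQ]; first exact: (nilc 0).
by apply: der_nilD => //; exact: der_nilM.
Qed.

End LocallyFiniteWeyl.

(** * Automorphisms of the Weyl algebra *)

Section WeylAut.
Variable F : numFieldType.
Local Notation A1 := (weyl F).
Local Notation p := (weyl_p F).
Local Notation q := (weyl_q F).
Implicit Types (h : {lrmorphism A1 -> A1}) (al be : alg_aut A1).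

Lemma weyl_hom_ext h h' : h p = h' p -> h q = h' q -> h =1 h'.
Proof.
move=> hp hq; have hpq : h p * h q - h q * h p = 1.
  by rewrite -!rmorphM -rmorphB weyl_pq rmorph1.
have [k _ ext] := weyl_universal hpq => a.
by rewrite (ext h) // (ext h').
Qed.

Lemma lie_morph (A B : algType F) (h : {lrmorphism A -> B}) x y :
  h (lie x y) = lie (h x) (h y).
Proof. by rewrite /lie rmorphB !rmorphM. Qed.

Lemma iter_lie_morph (A B : algType F) (h : {lrmorphism A -> B}) m x y :
  h (iter m (lie x) y) = iter m (lie (h x)) (h y).
Proof. by elim: m => //= m IHm; rewrite lie_morph IHm. Qed.

Lemma lrmorph_horner h a g : h (horner_alg a g) = horner_alg (h a) g.
Proof.
elim/poly_ind: g => [|g c IHg]; first by rewrite !rmorph0.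
by rewrite !rmorphD !rmorphM /= !horner_algX !horner_algC linearZ /= rmorph1 IHg.
Qed.

Lemma weyl_aut (P Q P' Q' : A1) : lie P Q = 1 -> lie P' Q' = 1 ->
  (forall h, h p = P -> h q = Q -> h P' = p /\ h Q' = q) ->
  (forall h, h p = P' -> h q = Q' -> h P = p /\ h Q = q) ->
  exists al, al p = P /\ al q = Q.
Proof.
move=> PQ PQ' hK kK.
have [h [hp hq] _] := weyl_universal PQ; have [k [kp kq] _] := weyl_universal PQ'.
have [hP' hQ'] := hK _ hp hq; have [kP kQ] := kK _ kp kq.
have bij : bijective h.
  exists k => a.
    by apply: (@weyl_hom_ext (k \o h) idfun) => /=; rewrite ?hp ?hq.
  by apply: (@weyl_hom_ext (h \o k) idfun) => /=; rewrite ?kp ?kq.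
by exists (AlgAut bij).
Qed.

Lemma lie_scalar (A : algType F) (c : F) (x : A) : lie x c%:A = 0.
Proof. by rewrite /lie -scalerAr -scalerAl mulr1 mul1r subrr. Qed.

Lemma lie_horner_q g : lie q (horner_alg q g) = 0.
Proof.
elim/poly_ind: g => [|g c IHg]; first by rewrite rmorph0 /lie mulr0 mul0r subrr.
by rewrite rmorphD rmorphM /= horner_algX horner_algC lieDr lieMr IHg liexx
  lie_scalar mul0r mulr0 !addr0.
Qed.

Lemma aut_triangular g : exists al, al p = p + horner_alg q g /\ al q = q.
Proof.
have lie1 (g' : {poly F}) : lie (p + horner_alg q g') q = 1.
  by rewrite lieDl (lieC (horner_alg q g')) lie_horner_q oppr0 addr0; exact: weyl_pq.
apply: (@weyl_aut _ _ (p + horner_alg q (- g)) q) => // h hp hq; split => //.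
  by rewrite rmorphD /= lrmorph_horner hp hq rmorphN /= ?addrK ?subrK.
by rewrite rmorphD /= lrmorph_horner hp hq rmorphN /= ?addrK ?subrK.
Qed.

Lemma aut_shift (c : F) : exists al, al p = p /\ al q = q + c%:A.
Proof.
have lie1 (c' : F) : lie p (q + c'%:A) = 1.
  by rewrite lieDr lie_scalar addr0; exact: weyl_pq.
apply: (@weyl_aut _ _ p (q + (- c)%:A)) => // h hp hq; split => //;
  by rewrite rmorphD /= hq linearZ /= rmorph1 scaleNr ?addrK ?subrK.
Qed.

Lemma aut_swap : exists al, al p = - q /\ al q = p.
Proof.
have lNl (x y : A1) : lie (- x) y = - lie x y by rewrite -!scaleN1r lieZl.
have lNr (x y : A1) : lie x (- y) = - lie x y by rewrite -!scaleN1r lieZr.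
have lqp : lie q p = -1 by rewrite lieC; congr (- _); exact: weyl_pq.
apply: (@weyl_aut _ _ q (- p)); rewrite ?lNl ?lNr ?lqp ?opprK // => h hp hq;
  by rewrite rmorphN /= hp hq opprK.
Qed.

Lemma aut_scale (s : F) : s != 0 -> exists al, al p = s *: p /\ al q = s^-1 *: q.
Proof.
move=> s0; apply: (@weyl_aut _ _ (s^-1 *: p) (s *: q)).
- by rewrite lieZl lieZr scalerA mulfV // scale1r; exact: weyl_pq.
- by rewrite lieZl lieZr scalerA mulVf // scale1r; exact: weyl_pq.
- by move=> h hp hq; rewrite !linearZ /= hp hq !scalerA mulVf ?mulfV // !scale1r.
- by move=> h hp hq; rewrite !linearZ /= hp hq !scalerA mulVf ?mulfV // !scale1r.
Qed.

Lemma aut_comp al be : exists ga : alg_aut A1, forall a, ga a = al (be a).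
Proof.
have bij : bijective (al \o be) by exact: bij_comp (alg_aut_bij al) (alg_aut_bij be).
by exists (@AlgAut F A1 (alg_aut_map al \o alg_aut_map be : {lrmorphism A1 -> A1}) bij).
Qed.

Lemma aut_id : exists al, forall a : A1, al a = a.
Proof.
have bij : bijective (idfun : A1 -> A1) by exists id.
by exists (@AlgAut F A1 (idfun : {lrmorphism A1 -> A1}) bij).
Qed.

Lemma locally_finite_aut al x : locally_finite x -> locally_finite (al x).
Proof.
move=> xlf b; have [be alK beK] := alg_aut_bij al.
have [n [s ss]] := xlf (be b); exists n, (al \o s) => m.
have [k [c [t [ts E]]]] := ss m; exists k, c, (al \o t); split.
  by move=> i; have [j _ st] := ts i; exists j => //=; rewrite st.
by rewrite -[b]beK -iter_lie_morph E linear_sum /=; apply: eq_bigr => i _; rewrite linearZ.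
Qed.

End WeylAut.

(** * Leading forms under homomorphisms *)

Section LeadingMorph.
Variable F : numFieldType.
Local Notation A1 := (weyl F).
Local Notation p := (weyl_p F).
Local Notation q := (weyl_q F).
Local Notation M := {poly {poly F}}.

Lemma op_sum I (r : seq I) (K : pred I) (G : I -> M) :
  op (\sum_(i <- r | K i) G i) = \sum_(i <- r | K i) op (G i).
Proof. exact: (big_morph _ (@opD F) (@op0 F)). Qed.

Lemma opE (P : M) : op P =
  \sum_(j < size P) \sum_(i < size P`_j) P`_j`_i *: (q ^+ i * p ^+ j).
Proof.
rewrite -{1}[P]coefK poly_def op_sum; apply: eq_bigr => j _.
have opMXn (R : M) n : op (R * 'X^n) = op R * p ^+ n.
  by elim: n => [|n IHn]; rewrite ?mulr1 // !exprSr !mulrA opMX IHn.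
rewrite -mul_polyC opMXn opC -{1}[P`_j]coefK poly_def linear_sum /= mulr_suml.
apply: eq_bigr => i _; rewrite linearZ /= rmorphXn /= horner_algX.
by rewrite mulr_algl scalerAl.
Qed.

Lemma wle_const u v (c : F) : wle u v 0 c%:P%:P.
Proof.
move=> i j; rewrite coefC; case: j => [|j] /=; rewrite ?coef0 ?coefC ?eqxx //.
by case: i => [|i]; rewrite ?eqxx // !muln0.
Qed.

Lemma top_const u v (c : F) : top u v 0 c%:P%:P = c%:P%:P.
Proof.
apply/polyP => j; apply/polyP => i; rewrite coef_top coefC.
case: j => [|j] /=; rewrite ?coef0 ?coefC ?if_same //.
by case: i => [|i] /=; rewrite ?if_same // !muln0 eqxx.
Qed.

Lemma op_exp_top u v (uv0 : (0 < u + v)%N) (A : M) d n : wle u v d A ->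
  wle u v (d * n%:Z) (sym (op A ^+ n)) /\
  top u v (d * n%:Z) (sym (op A ^+ n)) = top u v d A ^+ n.
Proof.
move=> Ad; elim: n => [|n [IH1 IH2]].
  rewrite mulr0 !expr0 -op1 opK -[1]/(1%:P%:P).
  by split; [exact: wle_const|rewrite top_const].
have := op_mul_top uv0 Ad IH1; rewrite symK -exprS IH2 -exprS.
suff -> : d + d * n%:Z = d * n.+1%:Z by [].
by rewrite -[n.+1]add1n PoszD; ring.
Qed.

Lemma morph_top (h : {lrmorphism A1 -> A1}) (u v u' v' : nat) (A B P : M) d :
  (0 < u' + v')%N ->
  h q = op A -> wle u' v' u%:Z A -> h p = op B -> wle u' v' v%:Z B -> wle u v d P ->
  wle u' v' d (sym (h (op P))) /\
  top u' v' d (sym (h (op P))) = \sum_(j < size P) \sum_(i < size P`_j)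
    (if (u * i + v * j)%N%:Z == d then P`_j`_i else 0)%:P%:P *
    (top u' v' u%:Z A ^+ i * top u' v' v%:Z B ^+ j).
Proof.
move=> uv0 hq Au hp Bv Pd; rewrite {1 2}[op P]opE raddf_sum.
have symS := big_morph (@sym F) (@symD F) (@sym0 F).
rewrite symS top_sum.
suff main j i : wle u' v' d (sym (h (P`_j`_i *: (q ^+ i * p ^+ j)))) /\
  top u' v' d (sym (h (P`_j`_i *: (q ^+ i * p ^+ j)))) =
    (if (u * i + v * j)%N%:Z == d then P`_j`_i else 0)%:P%:P *
    (top u' v' u%:Z A ^+ i * top u' v' v%:Z B ^+ j).
  split; first by apply: wle_sum => j _; rewrite raddf_sum symS; apply: wle_sum => i _;
    have [] := main j i.
  apply: eq_bigr => j _; rewrite raddf_sum symS top_sum; apply: eq_bigr => i _.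
  by have [] := main j i.
have [P0|Pij] := eqVneq P`_j`_i 0.
  by rewrite P0 scale0r rmorph0 sym0 top0 if_same mul0r; split=> //; exact: wle0.
have dij := Pd _ _ Pij; rewrite linearZ /= symZ rmorphM !rmorphXn /= hq hp.
have [Ai Ait] := op_exp_top uv0 i Au; have [Bj Bjt] := op_exp_top uv0 j Bv.
have := op_mul_top uv0 Ai Bj; rewrite !symK => -[AB ABt].
have wtE : u%:Z * i%:Z + v%:Z * j%:Z = (u * i + v * j)%N%:Z by lia.
rewrite wtE in AB ABt.
have cAB := wleM (@wle_const u' v' P`_j`_i) AB; rewrite add0r in cAB.
split; first exact: wleW cAB.
have := topM (@wle_const u' v' P`_j`_i) AB; rewrite add0r ABt top_const Ait Bjt.
case: eqP => [<- -> //|/eqP dneq _]; rewrite mul0r; apply: (top_gt cAB).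
by rewrite lt_neqAle dneq.
Qed.

End LeadingMorph.

Lemma hom_scale (F : fieldType) (A B : algType F) (h : {lrmorphism A -> B}) c x :
  h (c *: x) = c *: h x.
Proof. exact: linearZ. Qed.

Lemma horner_alg_scale (F : fieldType) (A : algType F) (a : A) c g :
  horner_alg a (c *: g) = c *: horner_alg a g.
Proof. by rewrite linearZ /= mulr_algl. Qed.

(** * Normal forms of locally finite elements *)

Section NormalElement.
Variable F : numClosedFieldType.
Local Notation A1 := (weyl F).
Local Notation p := (weyl_p F).
Local Notation q := (weyl_q F).
Local Notation M := {poly {poly F}}.
Implicit Types (P : M) (x y : A1) (al : alg_aut A1).

Lemma aut_horner al a g : al (horner_alg a g) = horner_alg (al a) g.
Proof. exact: lrmorph_horner. Qed.

Definition normal_elt y :=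
  (exists g, y = horner_alg q g) \/
  (exists l m : F, l != 0 /\ y = l *: (p * q) + m%:A).

Definition normalizable x := exists al, normal_elt (al x).

Lemma normalizable_aut al x : normalizable (al x) -> normalizable x.
Proof.
move=> [be bax]; have [ga gaE] := aut_comp be al.
by exists ga; rewrite gaE.
Qed.

Lemma horner_alg_comp (A : algType F) (a : A) (r g : {poly F}) :
  horner_alg (horner_alg a r) g = horner_alg a (g \Po r).
Proof.
elim/poly_ind: g => [|g c IHg]; first by rewrite comp_poly0 !rmorph0.
rewrite comp_poly_MXaddC !rmorphD !rmorphM /= IHg.
by rewrite !horner_algC !horner_algX.
Qed.

(** Translating q removes the coefficient a, then shearing p by a polynomial in q
  removes all of g(q) but its constant term. *)
Lemma affine_weight (a b : F) g : b != 0 -> exists al (l m : F),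
  l != 0 /\ al (horner_alg q (b *: 'X + a%:P) * p + horner_alg q g) =
            l *: (p * q) + m%:A.
Proof.
move=> b0.
have hX (r : A1) : horner_alg r (b *: 'X + a%:P) = b *: r + a%:A.
  by rewrite rmorphD /= horner_alg_scale horner_algX horner_algC.
have [al [alp alq]] := aut_shift (- (a / b)).
have alqE : al q = horner_alg q ('X + (- (a / b))%:P).
  by rewrite rmorphD /= horner_algX horner_algC.
have [g' [c gE]] : exists g' c, g \Po ('X + (- (a / b))%:P) = g' * 'X + c%:P.
  elim/poly_ind: (g \Po _) => [|g' c _]; last by exists g', c.
  by exists 0, 0; rewrite mul0r add0r.
have [be [bep beq]] := aut_triangular (- (b^-1 *: g')).
have [ga gaE] := aut_comp be al; exists ga, b, (c - b); split=> //; rewrite gaE.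
rewrite rmorphD rmorphM /= !aut_horner alp hX {1}alq alqE horner_alg_comp gE.
have -> : b *: (q + (- (a / b))%:A) + a%:A = b *: q.
  by rewrite scalerDr scalerA mulrN mulrCA mulfV // mulr1 scaleNr addrNK.
rewrite rmorphD rmorphM /= hom_scale bep beq aut_horner beq.
rewrite (rmorphD (horner_alg q)) (rmorphM (horner_alg q)) /=.
rewrite horner_algX horner_algC pq_qp rmorphN /= horner_alg_scale -scalerAl mulrBr.
rewrite -scalerAr scalerBr scalerA mulfV // scale1r scalerDr scalerBl.
have -> : q * horner_alg q g' = horner_alg q g' * q.
  by apply/eqP; rewrite -subr_eq0; apply/eqP; exact: lie_horner_q.
rewrite !addrA subrK -!addrA; congr (_ + _).
by rewrite addrCA subrr addr0.
Qed.

Lemma affine_normalizable (a b : F) g :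
  normalizable (horner_alg q (b *: 'X + a%:P) * p + horner_alg q g).
Proof.
have [b0|b0] := eqVneq b 0; last first.
  by have [al [l [m lm]]] := affine_weight a g b0; exists al; right; exists l, m.
have [a0|a0] := eqVneq a 0.
  have [al alE] := aut_id F; exists al; left; exists g.
  by rewrite alE b0 a0 scale0r add0r rmorph0 mul0r add0r.
have [al [alp alq]] := aut_triangular (- (a^-1 *: g)); apply: (@normalizable_aut al).
have [be [bep beq]] := aut_swap F; exists be; left; exists (- a *: 'X).
rewrite b0 scale0r add0r horner_algC mulr_algl rmorphD /= hom_scale alp.
rewrite aut_horner alq rmorphN /= horner_alg_scale scalerDr scalerN scalerA mulfV //.
by rewrite scale1r subrK hom_scale bep horner_alg_scale horner_algX scalerN scaleNr.
Qed.

(** These monomials span the elements that are affine in p with a coefficient of p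
  that is affine in q. *)
Lemma low_normalizable P :
  (forall i j, (0 < j)%N -> P`_j`_i != 0 -> j = 1%N /\ (i <= 1)%N) ->
  normalizable (op P).
Proof.
move=> low.
have -> : P = (P`_1`_1 *: 'X + (P`_1`_0)%:P)%:P * 'X + (P`_0)%:P.
  apply/polyP => j; apply/polyP => i; rewrite !coefD coefMX !coefC.
  case: j => [|[|j]] /=; rewrite ?coef0 ?add0r ?addr0 //.
    rewrite coefD coefZ coefX coefC; case: i => [|[|i]] /=;
      rewrite ?mulr0 ?mulr1 ?addr0 ?add0r //.
    by apply/eqP; apply: contraT => /low - /(_ isT) [].
  by apply/eqP; apply: contraT => /low - /(_ isT) [].
by rewrite opD opMX !opC; exact: affine_normalizable.
Qed.

(** Under p -> p + c q^s the coefficient of q^n becomes a polynomial in c which is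
  not constant, so that some c makes it vanish. *)
Lemma triangular_kill s n P : (0 < s)%N -> wle 1 s n%:Z P ->
  (exists j, [/\ (0 < j)%N, (s * j <= n)%N & P`_j`_(n - s * j) != 0]) ->
  exists al, wle 1 s n%:Z (sym (al (op P))) /\ (sym (al (op P)))`_0`_n = 0.
Proof.
move=> s0 Pn [j0 [j0_gt0 sj0 Pj0]].
pose phi : {poly F} :=
  \poly_(j < size P) (if (s * j <= n)%N then P`_j`_(n - s * j) else 0).
have j0P : (j0 < size P)%N.
  by rewrite ltnNge; apply: contra Pj0 => /leq_sizeP ->; rewrite ?coef0.
have phij0 : phi`_j0 != 0 by rewrite coef_poly j0P sj0.
have /closed_rootP [c /rootP phic] : size phi != 1%N.
  apply: contraNneq phij0 => sz1.
  by apply/eqP/(leq_sizeP _ 1%N); rewrite ?sz1.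
have [al [alp alq]] := aut_triangular (c *: 'X^s); exists al.
have alq' : al q = op 'X%:P by rewrite opq.
have alp' : al p = op ('X + (c *: 'X^s)%:P) by rewrite opD opX opC.
have wq : wle 1 s 1%N%:Z ('X%:P : M).
  move=> i j; rewrite coefC; case: j => [|j] /=; rewrite ?coef0 ?coefX ?eqxx //.
  by case: i => [|[|i]]; rewrite ?eqxx // muln0.
have tq : top 1 s 1%N%:Z ('X%:P : M) = 'X%:P.
  apply/polyP => j; apply/polyP => i; rewrite coef_top coefC.
  case: j => [|j] /=; rewrite ?coef0 ?coefX ?if_same //.
  by case: i => [|[|i]] /=; rewrite ?if_same // muln0 muln1 addn0 eqxx.
have wp : wle 1 s s%:Z ('X + (c *: 'X^s)%:P : M).
  move=> i j; rewrite !coefD coefX coefC; case: j => [|[|j]] /=.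
  - by rewrite coef0 add0r coefZ coefXn; case: (i =P s) => [->|_]; rewrite ?mulr0 ?eqxx // mul1n muln0 addn0.
  - by rewrite coef0 addr0 coef1; case: i => [|i]; rewrite ?eqxx // muln0 muln1.
  - by rewrite !coef0 addr0 eqxx.
have tp : top 1 s s%:Z ('X + (c *: 'X^s)%:P : M) = 'X + (c *: 'X^s)%:P.
  apply/polyP => j; apply/polyP => i; rewrite coef_top !coefD coefX coefC.
  case: j => [|[|j]] /=; last by rewrite coef0 addr0 if_same.
    rewrite coef0 add0r coefZ coefXn mul1n muln0 addn0 eqz_nat.
    by case: (i =P s) => _; rewrite ?mulr0.
  rewrite coef0 addr0 coef1; case: i => [|i]; rewrite ?if_same //.
  by rewrite muln0 muln1 eqxx.
have [Wal Tal] := morph_top (isT : (0 < 1 + s)%N) alq' wq alp' wp Pn.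
split=> //.
have -> : (sym (al (op P)))`_0`_n = (top 1 s n%:Z (sym (al (op P))))`_0`_n.
  by rewrite coef_top mul1n muln0 addn0 eqxx.
rewrite Tal tq tp !coef_sum -[RHS]phic horner_poly; apply: eq_bigr => j _.
rewrite !coef_sum.
have termE (i : nat) (k : F) : (k%:P%:P * ('X%:P ^+ i * ('X + (c *: 'X^s)%:P) ^+ j) : M)`_0`_n =
    if n == (i + s * j)%N then k * c ^+ j else 0.
  rewrite -horner_coef0 !(hornerM, horner_exp, hornerD, hornerC, hornerX) add0r.
  rewrite exprZn -exprM -scalerAr -exprD mul_polyC !coefZ coefXn.
  by case: eqP; rewrite ?mulr1 ?mulr0.
under eq_bigr do rewrite termE.
case: leqP => [sjn|nsj]; last first.
  by rewrite mul0r big1 // => i _; case: eqP => // E; move: nsj; rewrite E ltnNge leq_addl.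
have [iP|Pi] := ltnP (n - s * j) (size P`_j).
  rewrite (bigD1 (Ordinal iP)) //= subnK // !eqxx big1 ?addr0; last first.
    move=> i /negP ni; case: eqP => // E; case: ni; apply/eqP/val_inj => /=.
    by rewrite E addnK.
  by rewrite mul1n subnK // eqxx.
rewrite [P`_j`_(n - s * j)]nth_default // mul0r big1 // => i _.
by case: eqP => // E; have := ltn_ord i; rewrite ltnNge (leq_trans Pi) // E addnK.
Qed.

End NormalElement.

Section NormalizeLocallyFinite.
Variable F : numClosedFieldType.
Local Notation A1 := (weyl F).
Local Notation p := (weyl_p F).
Local Notation q := (weyl_q F).
Local Notation M := {poly {poly F}}.
Implicit Types (P : M) (x y : A1) (al : alg_aut A1).

Lemma swap_top n P : wle 1 1 n%:Z P ->
  exists al, wle 1 1 n%:Z (sym (al (op P))) /\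
    forall i j, (i + j)%N = n -> (sym (al (op P)))`_j`_i = (-1) ^+ i * P`_i`_j.
Proof.
move=> Pn; have [al [alp alq]] := aut_swap F; exists al.
have alq' : al q = op 'X by rewrite opX.
have alp' : al p = op (- 'X%:P) by rewrite opN opq.
have wq : wle 1 1 1%N%:Z ('X : M).
  move=> i j; rewrite coefX; case: j => [|[|j]] /=; rewrite ?coef0 ?eqxx //.
  by rewrite coef1; case: i => [|i]; rewrite ?eqxx.
have tq : top 1 1 1%N%:Z ('X : M) = 'X.
  apply/polyP => j; apply/polyP => i; rewrite coef_top coefX.
  case: j => [|[|j]] /=; rewrite ?coef0 ?if_same //.
  by rewrite coef1; case: i => [|i] /=; rewrite ?if_same.
have wp : wle 1 1 1%N%:Z (- 'X%:P : M).
  apply: wleN => i j; rewrite coefC; case: j => [|j] /=; rewrite ?coef0 ?coefX ?eqxx //.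
  by case: i => [|[|i]]; rewrite ?eqxx.
have tp : top 1 1 1%N%:Z (- 'X%:P : M) = - 'X%:P.
  rewrite topN; congr (- _); apply/polyP => j; apply/polyP => i; rewrite coef_top coefC.
  case: j => [|j] /=; rewrite ?coef0 ?coefX ?if_same //.
  by case: i => [|[|i]] /=; rewrite ?if_same.
have [Wal Tal] := morph_top (isT : (0 < 1 + 1)%N) alq' wq alp' wp Pn.
split=> // i j ijn.
have -> : (sym (al (op P)))`_j`_i = (top 1 1 n%:Z (sym (al (op P))))`_j`_i.
  by rewrite coef_top !mul1n ijn eqxx.
rewrite Tal tq tp !coef_sum.
have termE (i' j' : nat) (k : F) : (k%:P%:P * ('X ^+ i' * (- 'X%:P) ^+ j') : M)`_j`_i =
    if (i' == j) && (j' == i) then k * (-1) ^+ j' else 0.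
  have -> : (- 'X%:P) ^+ j' = ((-1) ^+ j' *: 'X^j')%:P :> M.
    by rewrite -polyCN -polyC_exp -scaleN1r exprZn.
  rewrite coefCM mul_polyC coefZ coefMC coefXn eq_sym.
  case: eqP => _ /=; last by rewrite mul0r coef0 mulr0.
  rewrite mul1r coefZ coefXn [i == _]eq_sym.
  by case: eqP => _; rewrite ?mulr1 ?mulr0.
have inner j' : (\sum_(i' < size P`_j')
   (if (1 * i' + 1 * j')%N%:Z == n%:Z then P`_j'`_i' else 0)%:P%:P *
    ('X ^+ i' * (- 'X%:P) ^+ j') : M)`_j`_i =
   if j' == i then (-1) ^+ i * P`_i`_j else 0.
  rewrite !coef_sum; under eq_bigr do rewrite termE.
  case: (j' =P i) => [->|_]; last by rewrite big1 // => i' _; rewrite andbF.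
  have [jP|Pj] := ltnP j (size P`_i).
    rewrite (bigD1 (Ordinal jP)) //= eqxx big1 ?addr0; last first.
      move=> k kj; case: eqP => // E; case/eqP: kj; exact/val_inj.
    by rewrite !mul1n eqz_nat addnC ijn eqxx mulrC.
  rewrite [P`_i`_j]nth_default // mulr0 big1 // => k _.
  by case: eqP => // E; have := ltn_ord k; rewrite E ltnNge Pj.
have [iP|Pi] := ltnP i (size P).
  rewrite (bigD1 (Ordinal iP)) //= inner eqxx big1 ?addr0 // => k ki.
  by rewrite inner; case: eqP => // E; case/eqP: ki; exact/val_inj.
rewrite [P`_i]nth_default // coef0 mulr0 big1 // => k _.
by rewrite inner; case: eqP => // E; have := ltn_ord k; rewrite E ltnNge Pi.
Qed.

Lemma factor_p P : P`_0 = 0 -> exists Q, P = 'X * Q.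
Proof.
elim/poly_ind: P => [|Q c _]; first by exists 0; rewrite mulr0.
by rewrite coefD coefMX coefC add0r => ->; exists Q; rewrite addr0 mulrC.
Qed.

Lemma factor_q P : (forall j, P`_j`_0 = 0) -> exists Q, P = 'X%:P * Q.
Proof.
elim/poly_ind: P => [|P c IHP] P0; first by exists 0; rewrite mulr0.
have [j|Q ->] := IHP; first by have := P0 j.+1; rewrite coefD coefMX coefC /= addr0.
have [d ->] : exists d, c = 'X * d.
  have := P0 0; rewrite coefD coefMX coefC add0r /=.
  elim/poly_ind: c {P0} => [|d c' _]; first by exists 0; rewrite mulr0.
  by rewrite coefD coefMX coefC add0r => ->; exists d; rewrite addr0 mulrC.
by exists (Q * 'X + d%:P); rewrite polyCM mulrDr mulrA.
Qed.

Lemma poissonX P : poisson P 'X = - dq P.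
Proof. by rewrite /poisson -[X in dq X]mul1r dqMX derivX mulr1 -[1]/(1%:P) dqC -[1]/(1%:P) derivC mul0r mulr0 add0r. Qed.

Lemma poissonq P : poisson P 'X%:P = P^`().
Proof. by rewrite /poisson dqC derivX derivC mulr1 mulr0 subr0. Qed.

(** A shear removes q^n from the leading form f.
  Then p divides f, hence f_q = - {f, p}; by local nilpotency f_q = 0, that is, f
  is a multiple of p^n, and p and q are exchanged. *)
Lemma flatten_top n x : locally_finite x -> wle 1 1 n%:Z (sym x) -> (2 < n)%N ->
  exists al, wle 1 1 n%:Z (sym (al x)) /\
    forall i j, (0 < j)%N -> (i + j)%N = n -> (sym (al x))`_j`_i = 0.
Proof.
move=> xlf xn n3.
have [flat|nflat] := pselect (forall i j, (0 < j)%N -> (i + j)%N = n -> (sym x)`_j`_i = 0).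
  by have [al alE] := aut_id F; exists al; rewrite alE.
have [al [yn y0]] : exists al, wle 1 1 n%:Z (sym (al x)) /\ (sym (al x))`_0`_n = 0.
  have := triangular_kill (isT : (0 < 1)%N) xn; rewrite symK; apply.
  apply: contrapT => H; apply: nflat => i j j0 ijn; apply/eqP; apply: contraT => xij.
  case: H; exists j; split => //; rewrite mul1n -ijn ?leq_addl //.
  by rewrite addnK.
set y := al x in yn y0.
have ylf : locally_finite y by exact: locally_finite_aut.
set f := top 1 1 n%:Z (sym y).
have fnil Q : der_nil (poisson f) Q.
  by apply: locally_finite_poisson_nil; rewrite // lez_nat.
have [g fg] : exists g, f = 'X * g.
  apply: factor_p; apply/polyP => i; rewrite coef_top coef0.
  by case: eqP => //; rewrite mul1n muln0 addn0 => -[->].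
have dqf : dq f = 0.
  apply: oppr_inj; rewrite oppr0 -poissonX.
  apply: (@der_nil_dvd _ _ (@poly2_mulrn_eq0 F) (poissonDr f) (poissonMr f) _ (- dq g)) => //.
  by rewrite poissonX fg mulrC dqMX mulrN mulrC.
have [be [zn zE]] := swap_top yn; rewrite !symK in zn zE.
have [ga gaE] := aut_comp be al; exists ga; rewrite gaE -/y; split => // i j j0 ijn.
rewrite zE //; apply/eqP; rewrite mulf_eq0; apply/orP; right.
case: j j0 ijn => // j _ ijn.
have := congr1 (fun P => P`_i`_j) dqf; rewrite coef_dq !coef0 coef_top.
rewrite !mul1n addnC ijn eqxx => /eqP.
by rewrite mulrn_eq0.
Qed.

(** The Poisson bracket with a quadratic form need not be locally nilpotent, but
  removing p^2 already makes a quadratic element affine in p. *)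
Lemma quadratic_normalizable n x : wle 1 1 n%:Z (sym x) -> (n <= 2)%N ->
  normalizable x.
Proof.
move=> xn n2.
have lown y : wle 1 1 n%:Z (sym y) -> (sym y)`_n`_0 = 0 -> normalizable y.
  move=> yn y0; rewrite -[y]symK; apply: low_normalizable => i j j0 yij.
  have := yn _ _ yij; rewrite !mul1n lez_nat => ijn.
  suff : ~ (i = 0%N /\ j = n /\ n = 2%N) by lia.
  by case=> ij [jn _]; move: yij; rewrite ij jn y0 eqxx.
have [y0|y0] := eqVneq (sym x)`_n`_0 0; first exact: lown.
have [n0|n0] := posnP n.
  rewrite -[x]symK; apply: low_normalizable => i j j0 yij.
  by have := xn _ _ yij; rewrite !mul1n lez_nat; lia.
have [al [yn yE]] : exists al, wle 1 1 n%:Z (sym (al x)) /\ (sym (al x))`_0`_n = 0.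
  have := triangular_kill (isT : (0 < 1)%N) xn; rewrite symK; apply.
  by exists n; rewrite mul1n leqnn subnn.
have [be [zn zE]] := swap_top yn; rewrite !symK in zn zE.
apply: (@normalizable_aut F al); apply: (@normalizable_aut F be); apply: lown => //.
by rewrite zE // yE mulr0.
Qed.

End NormalizeLocallyFinite.

Section Newton.
Variable F : numClosedFieldType.
Local Notation A1 := (weyl F).
Local Notation p := (weyl_p F).
Local Notation q := (weyl_q F).
Local Notation M := {poly {poly F}}.
Implicit Types (P : M) (x y : A1) (al : alg_aut A1).

(** If q^n occurs, then q^i0 p^j0 is the other end, or an inner point, of the edge of
  the Newton polygon that starts at q^n. *)
Lemma newton_slope n P : wle 1 1 n%:Z P ->
  (exists i j, (0 < j)%N /\ P`_j`_i != 0) ->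
  exists i0 j0, [/\ (0 < j0)%N, P`_j0`_i0 != 0 &
    forall i j, (0 < j)%N -> P`_j`_i != 0 -> ((n - i0) * j <= (n - i) * j0)%N].
Proof.
move=> Pn [i [j [j0 Pij]]].
have bnd i' j' : P`_j'`_i' != 0 -> (i' < n.+1)%N /\ (j' < n.+1)%N.
  by move/Pn; rewrite !mul1n lez_nat; lia.
have [lti ltj] := bnd _ _ Pij.
pose C (k : 'I_n.+1 * 'I_n.+1) := (0 < k.2)%N && (P`_k.2`_k.1 != 0).
have Ck : C (Ordinal lti, Ordinal ltj) by rewrite /C /= j0.
pose key (k : 'I_n.+1 * 'I_n.+1) : rat := (n - k.1)%N%:R / k.2%:R.
have [[a b] /andP[/= b0 Pab] kmin] := arg_minP key Ck.
exists a, b; split => // i' j' j'0 Pij'; have [lti' ltj'] := bnd _ _ Pij'.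
have := kmin (Ordinal lti', Ordinal ltj'); rewrite /C /= j'0 Pij' => /(_ isT).
rewrite /key /= ler_pdivrMr ?ltr0n // mulrAC ler_pdivlMr ?ltr0n //.
by rewrite -!natrM ler_nat.
Qed.

(** Let f be the leading form of x for the weights given by the edge of the Newton
  polygon that starts at q^n. It contains q^n and a monomial in which p occurs.
  As {f, .} is locally nilpotent, q does not divide f_p, so that f contains a
  power of p; nor can p divide f_p while q divides f_q, so that f contains a
  monomial linear in p. Hence the slope is an integer s > 1, and a shear
  p -> p + c q^s that removes q^n lowers the degree. *)
Lemma newton_step n x : locally_finite x -> wle 1 1 n%:Z (sym x) ->
  (forall i j, (0 < j)%N -> (i + j)%N = n -> (sym x)`_j`_i = 0) ->
  (sym x)`_0`_n != 0 ->
  ~ (forall i j, (0 < j)%N -> (sym x)`_j`_i != 0 -> j = 1%N /\ (i <= 1)%N) ->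
  (0 < n)%N /\ exists al, wle 1 1 n.-1%:Z (sym (al x)).
Proof.
move=> xlf xn flat x0n nlow; set P := sym x in xn flat x0n nlow *.
have deg i j : P`_j`_i != 0 -> (i + j <= n)%N.
  by move/xn; rewrite !mul1n lez_nat.
have deg1 i j : (0 < j)%N -> P`_j`_i != 0 -> (i + j < n)%N.
  move=> j0 Pij; rewrite ltn_neqAle deg // andbT; apply: contraNneq Pij => E.
  by apply/eqP; exact: flat.
have [i1 [j1 [j1_gt0 Pij1 high]]] : exists i j,
    [/\ (0 < j)%N, P`_j`_i != 0 & ~ (j = 1%N /\ (i <= 1)%N)].
  apply: contrapT => H; apply: nlow => i j j0 Pij; apply: contrapT => H'.
  by apply: H; exists i, j.
have [|i0 [j0 [j0_gt0 Pij0 slope]]] := newton_slope xn.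
  by exists i1, j1.
have ij0 := deg1 _ _ j0_gt0 Pij0.
have n0 : (0 < n)%N by lia.
split=> //.
pose u := j0; pose v := (n - i0)%N; pose d := (n * j0)%N%:Z.
have uv : (u < v)%N by rewrite /u /v; lia.
have Pd : wle u v d P.
  move=> i j Pij; rewrite /u /v lez_nat; have := deg _ _ Pij => ij.
  have [j0'|jgt0] := posnP j; first by rewrite j0' muln0 addn0 mulnC leq_mul2r; lia.
  have := slope _ _ jgt0 Pij => sl; rewrite (leq_trans (leq_add (leqnn _) sl)) //.
  by rewrite mulnC -mulnDl leq_mul2r; lia.
(* otherwise every monomial containing p would be p or qp *)
have duv : (u + v)%N%:Z < d.
  rewrite ltNge; apply/negP => duv; case: high.
  have := le_trans (Pd _ _ Pij1) duv; rewrite lez_nat => {}duv.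
  case: j1 j1_gt0 {Pij1} duv => [//|[_|j1 _]] duv.
    by split=> //; move: duv; rewrite muln1 leq_add2r -{2}[u]muln1 leq_pmul2l.
  by nia.
set f := top u v d P.
have fnil Q : der_nil (poisson f) Q.
  by apply: locally_finite_poisson_nil => //; rewrite /u; lia.
have coef_f i j : f`_j`_i = if (u * i + v * j == n * j0)%N then P`_j`_i else 0.
  by rewrite coef_top eqz_nat.
have f0n : f`_0`_n = P`_0`_n by rewrite coef_f muln0 addn0 mulnC eqxx.
have fij0 : f`_j0`_i0 = P`_j0`_i0.
  by rewrite coef_f /u /v mulnC -mulnDl subnKC ?eqxx //; lia.
have fp0 : f^`() != 0.
  apply: contraNneq Pij0 => f'0; have := congr1 (fun Q : M => Q`_j0.-1`_i0) f'0.
  by rewrite coef_dp prednK // !coef0 fij0 => /eqP; rewrite mulrn_eq0 eqn0Ngt j0_gt0.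
have fq0 : dq f != 0.
  apply: contraNneq x0n => f'0; have := congr1 (fun Q : M => Q`_0`_n.-1) f'0.
  by rewrite coef_dq prednK // !coef0 f0n => /eqP; rewrite mulrn_eq0 eqn0Ngt n0.
(* otherwise q would divide f_p = {f, q} *)
have [m [m0 fm]] : exists m, (0 < m)%N /\ f`_m`_0 != 0.
  apply: contrapT => H; case/eqP: fp0.
  have [g fg] : exists g, f^`() = 'X%:P * g.
    apply: factor_q => j; rewrite coef_dp; apply/eqP.
    rewrite mulrn_eq0 /=; apply: contraT => fj; case: H.
    by exists j.+1.
  rewrite -poissonq.
  apply: (@der_nil_dvd _ _ (@poly2_mulrn_eq0 F) (poissonDr f) (poissonMr f) _ g) => //.
  by rewrite poissonq.
have {}fm : (v * m = n * u)%N.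
  by move: fm; rewrite coef_f muln0 add0n; case: ifP => [/eqP //|_]; rewrite eqxx.
(* Otherwise p would divide f_p = {f, q}. Also q would divide f_q = - {f, p}, since
  on an edge from q^n to p^m with m < n no monomial is linear in q. *)
have [i fi1] : exists i, f`_1`_i != 0.
  apply: contrapT => H.
  have [g fg] : exists g, f^`() = 'X * g.
    apply: factor_p; apply/polyP => i; rewrite coef_dp coef0; apply/eqP.
    by rewrite mulrn_eq0 /=; apply: contraT => fj; case: H; exists i.
  have [h fh] : exists h, dq f = 'X%:P * h.
    apply: factor_q => j; rewrite coef_dq; apply/eqP.
    rewrite mulrn_eq0 /= coef_f muln1; case: ifP => [/eqP E|_]; rewrite ?eqxx //.
    exfalso; have [jm|jm] := ltnP j m; last by move: E fm; rewrite /u; nia.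
    by move: E fm; rewrite [(n * u)%N]mulnC; nia.
  have [] := @der_nil_dvd2 _ _ (@poly2_mulrn_eq0 F) (poissonDr f) (poissonMr f)
    'X%:P 'X g (- h) => //.
  - by rewrite poissonq.
  - by rewrite poissonX fh mulrN.
  - by rewrite poissonq => /eqP; rewrite (negbTE fp0).
  - by rewrite poissonX => /eqP; rewrite oppr_eq0 (negbTE fq0).
have uiv : (u * i + v = n * u)%N.
  by move: fi1; rewrite coef_f muln1; case: ifP => [/eqP //|_]; rewrite eqxx.
have lein : (i <= n)%N by nia.
pose s := (n - i)%N.
have vE : v = (u * s)%N by rewrite mulnBr; lia.
have s2 : (1 < s)%N by move: uv; rewrite vE /u; nia.
have Ps : wle 1 s n%:Z P.
  move=> i' j' /Pd; rewrite vE !lez_nat mul1n -mulnA -mulnDr mulnC leq_mul2r.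
  by rewrite /u; lia.
have [al [W1 W2]] : exists al, wle 1 s n%:Z (sym (al x)) /\ (sym (al x))`_0`_n = 0.
  have := triangular_kill (ltnW s2) Ps; rewrite symK; apply.
  have E : (s * j0 = n - i0)%N by rewrite mulnC -/u -vE.
  exists j0; rewrite E; split => //; first by lia.
  by rewrite subKn //; lia.
exists al => i' j' Pij'; have := W1 _ _ Pij'; rewrite !mul1n !lez_nat => wij.
have [j'0|j'0] := posnP j'; last by nia.
suff : i' != n by move: wij; rewrite j'0; lia.
by apply: contraNneq Pij' => ->; rewrite j'0 W2.
Qed.

(** A theorem of Dixmier, by induction on the degree. *)
Theorem locally_finite_normalizable x : locally_finite x -> normalizable x.
Proof.
move=> xlf; have [d xd] : exists d : nat, wle 1 1 d%:Z (sym x).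
  have [d xd] := wle_bounded 1 1 (fun _ : 'I_1 => sym x).
  by exists `|d|%N; apply: wleW (xd ord0); lia.
elim/ltn_ind: d x xlf xd => n IHn x xlf xn.
have [n2|n3] := leqP n 2; first exact: quadratic_normalizable xn n2.
have [al [yn flat]] := flatten_top xlf xn n3.
apply: (@normalizable_aut F al); move: (locally_finite_aut al xlf) yn flat.
move: (al x) => {al xlf xn} x xlf xn flat.
have [x0|x0] := eqVneq (sym x)`_0`_n 0.
  apply: (IHn n.-1) => //; first by lia.
  move=> i j xij; have := xn _ _ xij; rewrite !mul1n !lez_nat => ijn.
  suff : (i + j)%N != n by lia.
  apply: contraNneq xij => ijn'; have [j0|j0] := posnP j; last by rewrite flat.
  by move: ijn'; rewrite j0 addn0 => ->; apply/eqP.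
have [low|nlow] := pselect (forall i j, (0 < j)%N -> (sym x)`_j`_i != 0 ->
    j = 1%N /\ (i <= 1)%N).
  by rewrite -[x]symK; exact: low_normalizable.
have [n0 [al aln]] := newton_step xlf xn flat x0 nlow.
apply: (@normalizable_aut F al); apply: (IHn n.-1) => //; first by lia.
exact: locally_finite_aut.
Qed.

End Newton.

(** * Commutators with normal forms *)

Section Commutators.
Variable F : numClosedFieldType.
Local Notation A1 := (weyl F).
Local Notation p := (weyl_p F).
Local Notation q := (weyl_q F).
Local Notation M := {poly {poly F}}.
Implicit Types (P : M) (x y : A1) (al : alg_aut A1).

Lemma lie_p_op P : lie p (op P) = op (dq P).
Proof. by rewrite /lie op_pM -opMX -opB addrAC subrr add0r. Qed.

Lemma lie_q_op P : lie q (op P) = - op P^`().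
Proof.
elim/poly_ind: P => [|P c IHP].
  by rewrite op0 deriv0 op0 /lie mulr0 mul0r subrr oppr0.
rewrite opD opMX opC lieDr lieMr lie_horner_q addr0 IHP.
have -> : lie q p = -1 by rewrite lieC; congr (- _); exact: weyl_pq.
rewrite derivD derivC addr0 derivM derivX mulr1 opD opMX mulrN1 mulNr.
by rewrite opprD.
Qed.

Lemma lie_scalarl (c : F) x : lie c%:A x = 0.
Proof. by rewrite lieC lie_scalar oppr0. Qed.

(** On symbols, ad(pq) is the Euler operator q d/dq - p d/dp. *)
Lemma coef_lie_pq x i j :
  (sym (lie (p * q) x))`_j`_i = (i%:R - j%:R) * (sym x)`_j`_i.
Proof.
rewrite -[x]symK opK; move: (sym x) => {x} P.
have -> : p * q = q * p + (1 : F)%:A by rewrite pq_qp scale1r.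
rewrite lieDl lie_scalarl addr0 lieMl lie_p_op lie_q_op mulNr -opMX -op_qM -opB opK.
rewrite !coefD !coefN coefCM coefXM coefMX mulrBl.
congr (_ - _).
  by rewrite coef_dq; case: i => [|i] /=; rewrite ?mul0r // mulr_natl.
by case: j => [|j] /=; rewrite ?mul0r ?coef0 // coef_dp mulr_natl.
Qed.

Lemma coef_lie_weight (l m : F) x i j :
  (sym (lie (l *: (p * q) + m%:A) x))`_j`_i = l * (i%:R - j%:R) * (sym x)`_j`_i.
Proof.
by rewrite lieDl lie_scalarl addr0 lieZl symZ !coefCM coef_lie_pq mulrA.
Qed.

Lemma sym_weight (l m : F) :
  sym (l *: (p * q) + m%:A) = (l *: 'X)%:P * 'X + (l + m)%:P%:P.
Proof.
apply: op_inj; rewrite symK opD opMX op_scalar opC horner_alg_scale horner_algX.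
by rewrite pq_qp scalerDr scalerDl addrA scalerAl.
Qed.

Lemma coef11_weight (l m : F) : (sym (l *: (p * q) + m%:A))`_1`_1 = l.
Proof.
by rewrite sym_weight !coefD coefMX !coefC /= coefZ coefX mulr1 ?coef0 ?addr0.
Qed.

Lemma ad_poly_q_nil g y : der_nil (lie (horner_alg q g)) y.
Proof.
set x := horner_alg q g.
have DD : {morph lie x : a b / a + b} by exact: lieDr.
have DM a b : lie x (a * b) = lie x a * b + a * lie x b by exact: lieMr.
have nilq h : der_nil (lie x) (horner_alg q h).
  by exists 1%N; rewrite /= /lie -!rmorphM mulrC subrr.
have nilp : der_nil (lie x) p.
  have [m xm] := nilq (- g^`()); exists m.+1.
  by rewrite iterSr lieC lie_pq_poly -rmorphN.
rewrite -[y]symK; elim/poly_ind: (sym y) => [|P c IHP].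
  by rewrite op0; exists 1%N; rewrite /= /lie mulr0 mul0r subrr.
rewrite opD opMX opC; apply: der_nilD => //; exact: der_nilM.
Qed.

Lemma nil_eigen0 (x y : A1) (c : F) : der_nil (lie x) y -> lie x y = c *: y ->
  c != 0 -> y = 0.
Proof.
move=> [n yn] xy c0.
have it k : iter k (lie x) y = c ^+ k *: y.
  by elim: k => [|k IHk]; rewrite ?scale1r // iterS IHk lieZr xy scalerA exprSr.
apply/eqP; move: yn; rewrite it => /eqP.
by rewrite scaler_eq0 expf_eq0 (negbTE c0) andbF.
Qed.

Lemma deriv_eq0_const (g : {poly F}) : g^`() = 0 -> g = (g`_0)%:P.
Proof.
move=> g0; apply/polyP => -[|i]; rewrite coefC //=.
have /eqP := congr1 (fun h : {poly F} => h`_i) g0.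
by rewrite coef_deriv coef0 mulrn_eq0 => /eqP.
Qed.

(** In op_mul, the terms with two or more derivatives have lower degree in p. *)
Lemma coef_lie_poly_q (h : A1) g m : size (sym h) = m.+2 ->
  (sym (lie h (horner_alg q g)))`_m = lead_coef (sym h) * g^`() *+ m.+1.
Proof.
rewrite -{2}[h]symK; set H := sym h => szH.
have -> : sym (lie (op H) (horner_alg q g)) =
    \sum_(k < m.+1) H^`N(k.+1) * iter k.+1 (@dq F) g%:P.
  have gH : op g%:P * op H = op (H * g%:P) by rewrite [H * _]mulrC opCM opC.
  rewrite -opC /lie gH (@op_mul _ m.+2) ?szH // big_ord_recl nderivn0 /=.
  by rewrite -opB addrAC subrr add0r opK.
have itC k : iter k (@dq F) g%:P = (g^`(k))%:P.
  by elim: k => [|k IHk]; rewrite ?derivn0 // iterS IHk dqC derivnS.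
rewrite coef_sum; under eq_bigr do rewrite itC coefMC coef_nderivn.
rewrite big_ord_recl big1 ?addr0 => [|k _].
  by rewrite /= bin1 add1n mulrnAl lead_coefE szH.
by rewrite nth_default ?mul0rn ?mul0r // szH lift0; lia.
Qed.

Lemma lie_poly_q_eq0 (h : A1) g : g^`() != 0 -> lie h (horner_alg q g) = 0 ->
  exists g', h = horner_alg q g'.
Proof.
move=> g'0 hg; exists (sym h)`_0; rewrite -opC -{1}[h]symK; congr op.
apply: size1_polyC; rewrite leqNgt; apply/negP => sz.
have szh : size (sym h) = (size (sym h)).-2.+2 by lia.
have /eqP := coef_lie_poly_q g szh; rewrite hg sym0 coef0 eq_sym.
rewrite -mulr_natr !mulf_eq0 (negbTE g'0) orbF lead_coef_eq0 -size_poly_eq0 szh /=.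
by move=> /eqP/(congr1 (fun P : {poly F} => P`_0))/eqP;
  rewrite -polyC_natr coefC coef0 pnatr_eq0.
Qed.

(** As the right-hand side does not contain p, the element h is affine in p, with a
  coefficient b(q) of p such that b g' = c g. Comparing degrees in q, b has degree
  one. *)
Lemma lie_poly_q_eigen (h : A1) g (c : F) : c != 0 -> g != 0 ->
  lie h (horner_alg q g) = c *: horner_alg q g ->
  exists al (l m : F), l != 0 /\ al h = l *: (p * q) + m%:A.
Proof.
move=> c0 g0 hg.
have cg0 : c *: g != 0 by rewrite scaler_eq0 negb_or c0.
have g'0 : g^`() != 0.
  apply: contra_neq cg0 => /deriv_eq0_const gE.
  have : horner_alg q (c *: g) = 0.
    by rewrite horner_alg_scale -hg gE horner_algC lie_scalar.
  by rewrite -opC -op0 => /op_inj /eqP; rewrite polyC_eq0 => /eqP.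
have symE : sym (lie h (horner_alg q g)) = (c *: g)%:P.
  by rewrite hg -horner_alg_scale -opC opK.
have natM0 n : (n.+1%:R : {poly F}) != 0.
  by rewrite -polyC_natr polyC_eq0 pnatr_eq0.
have sz : (size (sym h) <= 2)%N.
  rewrite leqNgt; apply/negP => sz.
  have szh : size (sym h) = (size (sym h)).-2.+2 by lia.
  have /eqP := coef_lie_poly_q g szh; rewrite symE coefC.
  have -> : (size (sym h)).-2 == 0%N = false by lia.
  rewrite eq_sym -mulr_natr !mulf_eq0 (negbTE g'0) (negbTE (natM0 _)) !orbF.
  by rewrite lead_coef_eq0 -size_poly_eq0 szh.
have sz2 : size (sym h) = 2%N.
  apply/eqP; rewrite eqn_leq sz leqNgt; apply/negP => szh.
  move: cg0; rewrite -polyC_eq0 -symE -[h]symK (size1_polyC (_ : (size (sym h) <= 1)%N)) //.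
  by rewrite opC /lie -!rmorphM mulrC subrr sym0 eqxx.
have hE : sym h = ((sym h)`_1)%:P * 'X + ((sym h)`_0)%:P.
  apply/polyP => -[|[|i]]; rewrite coefD coefMX !coefC /= ?add0r ?addr0 //.
  by rewrite nth_default // sz2.
have h1g : (sym h)`_1 * g^`() = c *: g.
  have := coef_lie_poly_q g sz2; rewrite symE coefC eqxx lead_coefE sz2 /=.
  by rewrite mulr1n => <-.
have h10 : (sym h)`_1 != 0 by apply: contra_neq cg0 => E; rewrite -h1g E mul0r.
have szg' : size g^`() = (size g).-1.
  have sg0 : (0 < size g)%N by rewrite size_poly_gt0.
  have sg1 : (1 < size g)%N.
    rewrite ltnNge; apply: contra g'0 => /size1_polyC ->; by rewrite derivC.
  apply/eqP; rewrite eqn_leq; apply/andP; split.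
    by rewrite -ltnS prednK // lt_size_deriv.
  have E : ((size g).-2 < size g^`())%N.
    rewrite ltnNge; apply: contra g0 => /leq_sizeP /(_ _ (leqnn _)) /eqP.
    rewrite coef_deriv mulrn_eq0 /= -lead_coef_eq0 lead_coefE.
    by have -> : (size g).-2.+1 = (size g).-1 by lia.
  by move: E; lia.
have szh1 : size ((sym h)`_1) = 2%N.
  have := congr1 (fun P : {poly F} => size P) h1g.
  rewrite /= size_mul // size_scale // szg'.
  have : (0 < size g^`())%N by rewrite size_poly_gt0.
  by rewrite szg'; move: (size (sym h)`_1) (size g) => s t; lia.
have h1E : (sym h)`_1 = (sym h)`_1`_1 *: 'X + ((sym h)`_1`_0)%:P.
  apply/polyP => -[|[|i]]; rewrite coefD coefZ coefX coefC /= ?mulr0 ?mulr1 ?add0r ?addr0 //.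
  by rewrite nth_default // szh1.
have b0 : (sym h)`_1`_1 != 0.
  have : lead_coef (sym h)`_1 != 0 by rewrite lead_coef_eq0.
  by rewrite lead_coefE szh1.
rewrite -[h]symK hE opD opMX !opC h1E.
exact: affine_weight.
Qed.

End Commutators.

(** * Elements commuting with pq *)

Section Diagonal.
Variable F : numClosedFieldType.
Local Notation A1 := (weyl F).
Local Notation p := (weyl_p F).
Local Notation q := (weyl_q F).
Local Notation M := {poly {poly F}}.
Implicit Types (P : M) (x y : A1).

Definition diagonal_symbol P := forall i j, i != j -> P`_j`_i = 0.

(** Since q^j (qp) = (qp - j) q^j, each q^j p^j is a polynomial in qp. *)
Lemma diagonal_poly_qp P : diagonal_symbol P -> exists g, op P = horner_alg (q * p) g.
Proof.
move=> diagP; set t := q * p.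
have qt n : q ^+ n * t = (t - n%:R) * q ^+ n.
  elim: n => [|n IHn]; first by rewrite mul1r mulr1 subr0.
  have qt1 : q * t = (t - 1) * q by rewrite mulrBl mul1r /t -[q * p * q]mulrA pq_qp mulrDr mulr1 addrK.
  rewrite exprS -mulrA IHn mulrA mulrBr qt1 (commr_nat q n) -mulrBl.
  by rewrite mulrS opprD addrA mulrA.
have powers n : exists g, q ^+ n * p ^+ n = horner_alg t g.
  elim: n => [|n [g gE]]; first by exists 1; rewrite mulr1 rmorph1.
  exists (('X - n%:R%:P) * g); rewrite rmorphM rmorphB /= horner_algX horner_algC.
  rewrite -gE scaler_nat mulrA -qt exprSr exprS /t !mulrA.
  by [].
rewrite opE; elim/big_ind: _ => [|x y [g ->] [h ->]|j _].
- by exists 0; rewrite rmorph0.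
- by exists (g + h); rewrite rmorphD.
elim/big_ind: _ => [|x y [g ->] [h ->]|i _].
- by exists 0; rewrite rmorph0.
- by exists (g + h); rewrite rmorphD.
have [ij|ij] := eqVneq (i : nat) (j : nat); last first.
  by exists 0; rewrite diagP // scale0r rmorph0.
move: (P`_j`_i) => c; rewrite ij; have [g ->] := powers j; exists (c *: g).
by rewrite horner_alg_scale.
Qed.

Lemma diagonal_comm P Q : diagonal_symbol P -> diagonal_symbol Q -> lie (op P) (op Q) = 0.
Proof.
move=> /diagonal_poly_qp[g ->] /diagonal_poly_qp[h ->].
by rewrite /lie -!rmorphM mulrC subrr.
Qed.

Lemma coef_Xdp P i j : ('X * P^`())`_j`_i = P`_j`_i *+ j.
Proof. by rewrite coefXM; case: j => [|j]; rewrite ?coef0 // coef_dp. Qed.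

Lemma coef_qdq P i j : ('X%:P * dq P)`_j`_i = P`_j`_i *+ i.
Proof. by rewrite coefCM coefXM; case: i => [|i] //; rewrite coef_dq. Qed.

Lemma degree_exists P : P != 0 -> exists n : nat,
  wle 1 1 n%:Z P /\ exists i j, (i + j)%N = n /\ P`_j`_i != 0.
Proof.
move=> P0; have [d Pd] := wle_bounded 1 1 (fun _ : 'I_1 => P).
have ex : exists n : nat, `[< wle 1 1 n%:Z P >].
  by exists `|d|%N; apply/asboolP; apply: wleW (Pd ord0); lia.
case: (ex_minnP ex) => n /asboolP Pn nmin; exists n; split => //.
apply: contrapT => H; case: n Pn nmin H => [|n] Pn nmin H.
  case/eqP: P0; apply/polyP => j; apply/polyP => i; rewrite !coef0.
  apply/eqP; apply: contraT => Pij; case: H; exists i, j; split => //.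
  by have := Pn _ _ Pij; rewrite !mul1n lez_nat leqn0 => /eqP.
suff /asboolP/nmin : wle 1 1 n%:Z P by rewrite ltnn.
move=> i j Pij; have := Pn _ _ Pij; rewrite !mul1n !lez_nat leq_eqVlt.
by case/orP=> // /eqP E; case: H; exists i, j.
Qed.

(** Let V1 be the part of the symbol of v off the diagonal and m > 1 the degree of
  op H in qp. The leading form of [op H, V1] is the bracket of a (qp)^m with that
  of V1; it is off the diagonal, does not vanish unless V1 = 0, and has a degree
  larger than that of V1. *)
Lemma diagonal_lie_eigen (H : M) (v : A1) (k e : F) : diagonal_symbol H -> (2 < size H)%N ->
  lie (op H) v = k *: v + e *: op H -> lie (op H) v = 0.
Proof.
move=> diagH szH; set V := sym v => HV.
pose V0 : M := \poly_(j < size V) (V`_j`_j *: 'X^j).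
have coefV0 i j : V0`_j`_i = if i == j then V`_j`_j else 0.
  rewrite coef_poly; case: ltnP => [_|jV]; last first.
    by rewrite [V`_j]nth_default // !coef0 if_same.
  by rewrite coefZ coefXn; case: eqP => _; rewrite ?mulr1 ?mulr0.
have diagV0 : diagonal_symbol V0 by move=> i j /negPf ij; rewrite coefV0 ij.
pose V1 := V - V0.
have coefV1 i j : V1`_j`_i = if i == j then 0 else V`_j`_i.
  by rewrite !coefB coefV0; case: eqP => [->|_]; rewrite ?subrr ?subr0.
have HV1 : lie (op H) v = lie (op H) (op V1).
  by rewrite -[v]symK -/V -[V](subrK V0) opD lieDr (diagonal_comm diagH diagV0) addr0.
have [V10|V10] := eqVneq V1 0.
  by rewrite HV1 V10 op0 /lie mulr0 mul0r subrr.
exfalso; have [n [V1n [i1 [j1 [ijn Vij]]]]] := degree_exists V10.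
pose m := (size H).-1; have m2 : (1 < m)%N by rewrite /m -subn1; lia.
pose a := H`_m`_m.
have a0 : a != 0.
  have lH0 : H`_m != 0.
    by rewrite -lead_coefE lead_coef_eq0 -size_poly_gt0 (leq_trans _ szH).
  apply: contraNneq lH0 => am; apply/eqP/polyP => i; rewrite coef0.
  by have [->|im] := eqVneq i m; [|exact: diagH].
have Hm : wle 1 1 (m + m)%N%:Z H.
  move=> i j Hij; have := Hij; have [->|ij] := eqVneq i j; last first.
    by rewrite diagH // eqxx.
  move=> _; rewrite !mul1n lez_nat; suff : (j <= m)%N by lia.
  rewrite leqNgt; apply: contra Hij => mj; rewrite [H`_j]nth_default ?coef0 //.
  exact: leq_trans (leqSpred _) mj.
pose Ht := top 1 1 (m + m)%N%:Z H.
have HtE : Ht = (a *: 'X^m)%:P * 'X^m.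
  apply/polyP => j; apply/polyP => i; rewrite coef_top coefCM coefXn !mul1n eqz_nat.
  have [->|ij] := eqVneq i j; last first.
    rewrite diagH // if_same; case: (j =P m) => [jm|_]; last by rewrite mulr0 coef0.
    rewrite mulr1 coefZ coefXn; case: (i =P m) => [im|_]; last by rewrite mulr0.
    by move: ij; rewrite im jm eqxx.
  have -> : (j + j == m + m)%N = (j == m) by apply/eqP/eqP; lia.
  by case: eqP => [->|_]; rewrite ?mulr0 ?coef0 // mulr1 coefZ coefXn eqxx mulr1.
set Vt := top 1 1 n%:Z V1.
have [_ TE] := lie_top (isT : (0 < 1 + 1)%N) Hm V1n; rewrite -/Ht -/Vt -HV1 HV in TE.
have W0 i j : i != j -> (poisson Ht Vt)`_j`_i = 0.
  move=> ij; rewrite -TE coef_top symD !symZ opK !coefD !coefCM diagH // mulr0 addr0.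
  case: eqP => // E; rewrite -/V; suff -> : V`_j`_i = 0 by rewrite mulr0.
  have := coefV1 i j; rewrite (negPf ij) => <-; apply: (wle_coef0 V1n).
  by rewrite E; lia.
have HtX : 'X * Ht^`() = Ht *+ m.
  apply/polyP => j; apply/polyP => i; rewrite coef_Xdp !coefMn HtE coefCM coefXn.
  by case: (j =P m) => [->|_] //; rewrite mulr0 !coef0 !mul0rn.
have Htq : 'X%:P * dq Ht = Ht *+ m.
  apply/polyP => j; apply/polyP => i; rewrite coef_qdq !coefMn HtE coefCM coefXn.
  case: (j =P m) => _; last by rewrite mulr0 !coef0 !mul0rn.
  by rewrite mulr1 coefZ coefXn; case: (i =P m) => [->|_] //; rewrite mulr0 !mul0rn.
have key : 'X * ('X%:P * poisson Ht Vt) = Ht *+ m * ('X%:P * dq Vt - 'X * Vt^`()).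
  transitivity (('X * Ht^`()) * ('X%:P * dq Vt) - ('X%:P * dq Ht) * ('X * Vt^`())).
    by rewrite /poisson; ring.
  by rewrite HtX Htq mulrBr.
have ij1 : i1 != j1 by apply: contraNneq Vij => ->; rewrite coefV1 eqxx.
have shiftL (P : M) : ('X * ('X%:P * P))`_(j1 + m)`_(i1 + m) = P`_(j1 + m).-1`_(i1 + m).-1.
  have m0 n' : (n' + m == 0)%N = false by lia.
  by rewrite coefXM m0 coefCM coefXM m0.
have shiftR (P : M) : (Ht *+ m * P)`_(j1 + m)`_(i1 + m) = a * P`_j1`_i1 *+ m.
  rewrite HtE mulrnAl !coefMn -mulrA coefCM coefXnM ltnNge leq_addl addnK /=.
  by rewrite -scalerAl coefZ coefXnM ltnNge leq_addl addnK.
have := shiftL (poisson Ht Vt); rewrite W0; last by lia.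
rewrite key shiftR !coefB coef_qdq coef_Xdp coef_top !mul1n eqz_nat ijn eqxx.
move=> /eqP; rewrite mulrn_eq0 mulf_eq0 (negPf a0) /=.
have -> : (m == 0)%N = false by lia.
rewrite -(mulr_natr _ i1) -(mulr_natr _ j1) -mulrBr mulf_eq0 (negPf Vij) /= subr_eq0 eqr_nat.
by rewrite (negPf ij1).
Qed.

End Diagonal.

(** * Conjugation in sl(2) *)

Section Sl2Conj.
Variable F : numClosedFieldType.
Local Notation sl2 := (sl2 F).
Local Notation ep := (sl2_ep F).
Local Notation em := (sl2_em F).
Local Notation e0 := (sl2_e0 F).

Lemma sl2_ord (k : 'I_2) : k = 0 \/ k = 1.
Proof. by case: k => [[|[|//]] ?]; [left|right]; exact/val_inj. Qed.

Lemma sl2_eqP (x y : sl2) : x 0 0 = y 0 0 -> x 0 1 = y 0 1 -> x 1 0 = y 1 0 -> x = y.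
Proof.
move=> h00 h01 h10; rewrite [x]sl2_decomp [y]sl2_decomp.
by rewrite h00 h01 h10.
Qed.

Let sE := (sl2_lieE, mxE).

Lemma sl2_lie_e0ep : sl2_lie e0 ep = 2 *: ep.
Proof. by apply: sl2_eqP; rewrite ?sE /= ?mxE /=; ring. Qed.

Lemma sl2_lie_e0em : sl2_lie e0 em = - 2 *: em.
Proof. by apply: sl2_eqP; rewrite ?sE /= ?mxE /=; ring. Qed.

Lemma sl2_lie_epem : sl2_lie ep em = e0.
Proof. by apply: sl2_eqP; rewrite ?sE /= ?mxE /=; ring. Qed.

Lemma sl2_conj_tr (g h : 'M[F]_2) (x : sl2) : h * g = 1 -> \tr (g * x * h) == 0.
Proof.
move=> hg; rewrite -[g * x * h]/(g *m x *m h) mxtrace_mulC mulmxA.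
by rewrite -[h *m g]/(h * g) hg mul1mx; exact: sl2_tr.
Qed.

Lemma sl2_conj_aut (g h : 'M[F]_2) : h * g = 1 ->
  exists w : sl2_aut F, forall x, (w x : 'M[F]_2) = g * x * h.
Proof.
move=> hg; have gh : g * h = 1 by apply: mulmx1C.
pose w x := Sl2 (sl2_conj_tr x hg); pose w' x := Sl2 (sl2_conj_tr x gh).
have w_lin : linear w.
  move=> c x y; apply: val_inj => /=.
  by rewrite mulrDr mulrDl -scalerAr -scalerAl.
have w_lie : {morph w : x y / sl2_lie x y}.
  move=> x y; apply: val_inj; rewrite /= /lie mulrBr mulrBl.
  by congr (_ - _); rewrite !mulrA; [rewrite -(mulrA (g * sl2_mx x) h g)|rewrite -(mulrA (g * sl2_mx y) h g)];
    rewrite hg mulr1.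
have wK : cancel w w'.
  by move=> x; apply: val_inj; rewrite /= !mulrA hg mul1r -mulrA hg mulr1.
have w'K : cancel w' w.
  by move=> x; apply: val_inj; rewrite /= !mulrA gh mul1r -mulrA gh mulr1.
by exists (Sl2Aut w_lin w_lie wK w'K).
Qed.

Lemma sl2_aut_comp (w1 w2 : sl2_aut F) : exists w : sl2_aut F,
  (forall x, w x = w1 (w2 x)) /\
  forall x, sl2_aut_inv w x = sl2_aut_inv w2 (sl2_aut_inv w1 x).
Proof.
case: w1 => [w1 v1 lin1 lie1 K1 K1']; case: w2 => [w2 v2 lin2 lie2 K2 K2'].
have lin : linear (w1 \o w2) by move=> c x y /=; rewrite lin2 lin1.
have lie : {morph w1 \o w2 : x y / sl2_lie x y} by move=> x y /=; rewrite lie2 lie1.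
by exists (Sl2Aut lin lie (can_comp K1 K2) (can_comp K2' K1')).
Qed.

Definition mx2 (a b c d : F) : 'M[F]_2 :=
  \matrix_(i, j) (if i == 0 then (if j == 0 then a else b) else if j == 0 then c else d).

Lemma mul_mx2 (A B : 'M[F]_2) i j : (A * B) i j = A i 0 * B 0 j + A i 1 * B 1 j.
Proof.
rewrite [LHS]mxE !big_ord_recl big_ord0 addr0.
by rewrite (_ : lift ord0 ord0 = 1) //; exact/val_inj.
Qed.

Lemma mx2_eqP (A B : 'M[F]_2) : A 0 0 = B 0 0 -> A 0 1 = B 0 1 ->
  A 1 0 = B 1 0 -> A 1 1 = B 1 1 -> A = B.
Proof.
by move=> *; apply/matrixP => i j; case: (sl2_ord i) => ->; case: (sl2_ord j) => ->.
Qed.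

Lemma sl2_aut_upper (t : F) : exists w : sl2_aut F, forall x : sl2,
  [/\ w x 0 0 = x 0 0 + t * x 1 0,
      w x 0 1 = x 0 1 - 2 * t * x 0 0 - t ^+ 2 * x 1 0 & w x 1 0 = x 1 0].
Proof.
have [|w wE] := @sl2_conj_aut (mx2 1 t 0 1) (mx2 1 (- t) 0 1).
  by apply: mx2_eqP; rewrite mul_mx2 !mxE /=; ring.
by exists w => x; rewrite !wE !mul_mx2 !mxE /= !sl2_mx11; split; ring.
Qed.

Lemma sl2_aut_flip : exists w : sl2_aut F, forall x : sl2,
  [/\ w x 0 0 = - x 0 0, w x 0 1 = x 1 0 & w x 1 0 = x 0 1].
Proof.
have [|w wE] := @sl2_conj_aut (mx2 0 1 1 0) (mx2 0 1 1 0).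
  by apply: mx2_eqP; rewrite mul_mx2 !mxE /=; ring.
by exists w => x; rewrite !wE !mul_mx2 !mxE /= !sl2_mx11; split; ring.
Qed.

Lemma sl2_aut_lower (t : F) : exists w : sl2_aut F, forall x : sl2,
  [/\ w x 0 0 = x 0 0 - t * x 0 1, w x 0 1 = x 0 1 &
      w x 1 0 = x 1 0 + 2 * t * x 0 0 - t ^+ 2 * x 0 1].
Proof.
have [|w wE] := @sl2_conj_aut (mx2 1 0 t 1) (mx2 1 0 (- t) 1).
  by apply: mx2_eqP; rewrite mul_mx2 !mxE /=; ring.
by exists w => x; rewrite !wE !mul_mx2 !mxE /= !sl2_mx11; split; ring.
Qed.

(** A unipotent conjugation, whose parameter is a root of a quadratic polynomial,
  makes z triangular; a second one makes it diagonal unless z is nilpotent. *)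
Lemma sl2_jordan (z : sl2) : z <> 0 -> exists (w : sl2_aut F) (a : F),
  a != 0 /\ (w z = a *: e0 \/ w z = a *: em).
Proof.
have main (x : sl2) : x <> 0 -> x 0 1 = 0 -> exists (w : sl2_aut F) (a : F),
    a != 0 /\ (w x = a *: e0 \/ w x = a *: em).
  move=> x0 x01; have [x00|x00] := eqVneq (x 0 0) 0.
    have [w wE] := sl2_aut_upper 0; have [w00 w01 w10] := wE x.
    exists w, (x 1 0); split.
      by apply/eqP => x10; apply: x0; apply: sl2_eqP; rewrite ?x00 ?x01 ?x10 !mxE.
    right; apply: sl2_eqP; rewrite ?w00 ?w01 ?w10 ?x00 ?x01 !mxE /=; ring.
  have [w wE] := sl2_aut_lower (- (x 1 0 / (2 * x 0 0))).
  have [w00 w01 w10] := wE x; exists w, (x 0 0); split => //.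
  left; apply: sl2_eqP; rewrite ?w00 ?w01 ?w10 ?x01 !mxE /=; try ring.
  by field.
move=> z0.
suff [w1 [w1z0 w1z]] : exists w : sl2_aut F, w z <> 0 /\ w z 0 1 = 0.
  have [w2 [a [a0 H]]] := main _ w1z0 w1z; have [w [wE _]] := sl2_aut_comp w2 w1.
  by exists w, a; rewrite wE.
have wz0 (w : sl2_aut F) : w z <> 0.
  move=> wz; apply: z0; rewrite -[z](sl2_aut_mapK w) wz.
  have w0 : w 0 = 0.
    by have := sl2_aut_linear w (-1) 0 0; rewrite scaler0 addr0 scaleN1r addNr.
  by rewrite -[in LHS]w0 sl2_aut_mapK.
have [z10|z10] := eqVneq (z 1 0) 0; last first.
  pose phi : {poly F} := \poly_(i < 3) [:: z 0 1; - (2 * z 0 0); - z 1 0]`_i.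
  have /closed_rootP [t /rootP phit] : size phi != 1%N.
    have : phi`_2 != 0 by rewrite coef_poly /= oppr_eq0.
    by apply: contraNneq => sz1; apply/eqP/(leq_sizeP _ 1%N); rewrite ?sz1.
  have [w wE] := sl2_aut_upper t; exists w; split=> //; have [_ -> _] := wE z.
  rewrite -[RHS]phit horner_poly !big_ord_recl big_ord0 /= /bump /= !add1n /=.
  by ring.
have [z00|z00] := eqVneq (z 0 0) 0.
  have [w wE] := sl2_aut_flip; exists w; split=> //; by have [_ -> _] := wE z.
have [w wE] := sl2_aut_upper (z 0 1 / (2 * z 0 0)).
by exists w; split=> //; have [_ -> _] := wE z; rewrite z10; field.
Qed.

End Sl2Conj.

(** * Embeddings of sl(2) *)

Section Embeddings.
Variable F : numClosedFieldType.
Local Notation A1 := (weyl F).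
Local Notation p := (weyl_p F).
Local Notation q := (weyl_q F).
Local Notation M := {poly {poly F}}.
Local Notation sl2 := (sl2 F).
Local Notation ep := (sl2_ep F).
Local Notation em := (sl2_em F).
Local Notation e0 := (sl2_e0 F).
Implicit Types (f : sl2 -> A1) (al : alg_aut A1).

Lemma emb_rel f : sl2_embedding f ->
  [/\ lie (f e0) (f ep) = 2 *: f ep, lie (f e0) (f em) = - 2 *: f em &
      lie (f ep) (f em) = f e0].
Proof.
case=> f_lin f_lie _; have fZ (c : F) x : f (c *: x) = c *: f x.
  have f0 : f 0 = 0.
    by have := f_lin (-1) 0 0; rewrite scaler0 addr0 scaleN1r addNr.
  by have := f_lin c x 0; rewrite !addr0 f0 addr0.
by rewrite -!f_lie sl2_lie_e0ep sl2_lie_e0em sl2_lie_epem !fZ.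
Qed.

Lemma embZ f (c : F) x : sl2_embedding f -> f (c *: x) = c *: f x.
Proof.
case=> f_lin _ _.
have f0 : f 0 = 0.
  by have := f_lin (-1) 0 0; rewrite scaler0 addr0 scaleN1r addNr.
by have := f_lin c x 0; rewrite !addr0 f0 addr0.
Qed.

Lemma emb_neq0 f x : sl2_embedding f -> x != 0 -> f x != 0.
Proof.
move=> femb; apply: contra_neq => fx; have [_ _ inj] := femb; apply: inj.
by rewrite fx -[0 in RHS](scale0r (0 : sl2)) (embZ _ _ femb) scale0r.
Qed.

Lemma ep_neq0 : ep != 0.
Proof.
by apply/eqP => /(congr1 (fun x : sl2 => x 0 1)) /eqP; rewrite /= !mxE /= oner_eq0.
Qed.

Lemma em_neq0 : em != 0.
Proof.
by apply/eqP => /(congr1 (fun x : sl2 => x 1 0)) /eqP; rewrite /= !mxE /= oner_eq0.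
Qed.

Lemma e0_neq0 : e0 != 0.
Proof.
apply/eqP => /(congr1 (fun x : sl2 => x 0 0)) /eqP.
by rewrite /= !mxE /= subr0 oner_eq0.
Qed.

Lemma emb_ext f f' : linear f -> linear f' -> f ep = f' ep -> f em = f' em ->
  f e0 = f' e0 -> f = f'.
Proof.
move=> lin lin' Ep Em E0; apply/funext => x; rewrite [x]sl2_decomp.
set a := sl2_mx x 0 1; set b := sl2_mx x 1 0; set c := sl2_mx x 0 0.
have f0 (g : sl2 -> A1) : linear g -> g 0 = 0.
  by move=> g_lin; have := g_lin (-1) 0 0; rewrite scaler0 addr0 scaleN1r addNr.
have fZ (g : sl2 -> A1) k y : linear g -> g (k *: y) = k *: g y.
  by move=> g_lin; have := g_lin k y 0; rewrite !addr0 (f0 _ g_lin) addr0.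
by rewrite -addrA !lin !lin' !fZ // Ep Em E0.
Qed.

Definition conj_normal f :=
  exists g : alg_aut A1 * sl2_aut F, normal_forms (aut_act g f).

Lemma conj_normal_act g f : conj_normal (aut_act g f) -> conj_normal f.
Proof.
case: g => a w [[a' w'] nf].
have [b bE] := aut_comp a' a; have [u [_ uE]] := sl2_aut_comp w' w.
exists (b, u); suff -> : aut_act (b, u) f = aut_act (a', w') (aut_act (a, w) f) by [].
by apply/funext => x; rewrite /aut_act /= bE uE.
Qed.

Definition sl2_aut_id : sl2_aut F := @Sl2Aut F id id (fun _ _ _ => erefl)
  (fun _ _ => erefl) (fun _ => erefl) (fun _ => erefl).

Lemma conj_normal_refl f : normal_forms f -> conj_normal f.
Proof.
have [al alE] := aut_id F; exists (al, sl2_aut_id).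
by rewrite (_ : aut_act _ f = f) //; apply/funext => x; rewrite /aut_act /= alE.
Qed.

Lemma conj_normal_alg al f : sl2_embedding f -> exists f',
  [/\ sl2_embedding f', forall x, f' x = al (f x) & conj_normal f' -> conj_normal f].
Proof.
move=> femb; exists (aut_act (al, sl2_aut_id) f); split=> //; first exact: aut_act_embedding.
exact: conj_normal_act.
Qed.

Lemma conj_normal_sl2 (w : sl2_aut F) f : sl2_embedding f -> exists f',
  [/\ sl2_embedding f', forall x, f' (w x) = f x & conj_normal f' -> conj_normal f].
Proof.
move=> femb; have [al alE] := aut_id F.
exists (aut_act (al, w) f); split=> [|x|].
- exact: aut_act_embedding.
- by rewrite /aut_act /= sl2_aut_mapK alE.
- exact: conj_normal_act.
Qed.

(** The Jordan form of z reduces everything to the two cases z = e_0 and z = e_-. *)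
Lemma conj_normal_jordan f z : sl2_embedding f -> z <> 0 ->
  (forall f' c, sl2_embedding f' -> c != 0 -> f' e0 = c *: f z -> conj_normal f') ->
  (forall f' c, sl2_embedding f' -> c != 0 -> f' em = c *: f z -> conj_normal f') ->
  conj_normal f.
Proof.
move=> femb z0 He0 Hem; have [w [a [a0 wz]]] := sl2_jordan z0.
have [f' [f'emb f'E cf]] := conj_normal_sl2 w femb; apply: cf.
have ai0 : a^-1 != 0 by rewrite invr_eq0.
case: wz => wz; [apply: (He0 _ a^-1)|apply: (Hem _ a^-1)] => //;
  by rewrite -f'E wz (embZ _ _ f'emb) scalerA mulVf // scale1r.
Qed.

Lemma f_II_e0 b : f_II b e0 = 2 *: (p * q) + b%:A.
Proof. exact: sl2_extend_e0. Qed.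

Lemma f_II_em b : f_II b em = - p.
Proof. exact: sl2_extend_em. Qed.

Lemma f_I_e0 : f_I (F := F) e0 = p * q + (- 2^-1)%:A.
Proof.
rewrite [LHS]sl2_extend_e0; have -> : q * p = p * q - 1 by rewrite pq_qp addrK.
rewrite addrA -mulr2n scalerBr -[p * q *+ 2]scaler_nat scalerA mulVf ?scale1r ?pnatr_eq0 //.
by rewrite scaleNr.
Qed.

Lemma two_neq0 : (2 : F) != 0.
Proof. by rewrite pnatr_eq0. Qed.

Lemma dq_weight1_eq0 (x : A1) (m : F) : dq (sym x) = 0 ->
  lie (2 *: (p * q) + m%:A) x = 2 *: x -> x = 0.
Proof.
move=> dx ex; apply/eqP; rewrite -sym_eq0; apply/eqP/polyP => j; apply/polyP => i.
rewrite !coef0; case: i => [|i]; last first.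
  have /eqP := congr1 (fun P : M => P`_j`_i) dx.
  by rewrite coef_dq !coef0 mulrn_eq0 => /eqP.
have /eqP := congr1 (fun y => (sym y)`_j`_0) ex.
rewrite coef_lie_weight symZ !coefCM -subr_eq0 -mulrBl mulf_eq0 => /orP[|/eqP //].
rewrite sub0r mulrN -{2}[2]mulr1 -opprD -mulrDr oppr_eq0 mulf_eq0 (negPf two_neq0) /=.
by rewrite -mulrSr pnatr_eq0.
Qed.

(** After scaling, f agrees with the normal form on e_0 and e_-. On e_+ the
  difference x of the two satisfies [x, e_-] = 0, so that it contains no q,
  while its weight under ad(pq) is 1. *)
Lemma conj_normal_II f b m : sl2_embedding f -> f e0 = 2 *: (p * q) + m%:A ->
  f em = b *: p -> conj_normal f.
Proof.
move=> femb fe0 fem.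
have b0 : b != 0.
  have := emb_neq0 femb em_neq0; rewrite fem; apply: contra_neq => ->.
  by rewrite scale0r.
have s0 : - b^-1 != 0 by rewrite oppr_eq0 invr_eq0.
have [al [alp alq]] := aut_scale s0.
have [f' [f'emb f'E cf]] := conj_normal_alg al femb; apply: cf.
suff -> : f' = f_II m by apply: conj_normal_refl; right; exists m.
have f'em : f' em = - p.
  by rewrite f'E fem hom_scale alp scalerA mulrN mulfV // scaleN1r.
have f'e0 : f' e0 = 2 *: (p * q) + m%:A.
  rewrite f'E fe0 rmorphD /= !hom_scale rmorphM rmorph1 /= alp alq.
  by rewrite -scalerAl -scalerAr (scalerA (- b^-1)) mulfV // scale1r.
have [f'lin _ _] := f'emb; have [IIlin _ _] := f_II_embedding m two_neq0.
apply: emb_ext => //; last by rewrite f'e0 f_II_e0.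
  have [r1 _ r3] := emb_rel f'emb; have [t1 _ t3] := emb_rel (f_II_embedding m two_neq0).
  apply/eqP; rewrite -subr_eq0; apply/eqP.
  apply: (@dq_weight1_eq0 _ m); last first.
    rewrite -scaleN1r lieDr lieZr -{1}f'e0 r1 -f_II_e0 t1.
    by move: (f' ep) (f_II m ep) => x y; rewrite scalerDr !scalerA mulrC.
  apply: op_inj; rewrite op0 -lie_p_op symK.
  have lNr (x y : A1) : lie x (- y) = - lie x y by rewrite -!scaleN1r lieZr.
  have : lie (f' ep - f_II m ep) (- p) = 0.
    by rewrite -scaleN1r lieDl lieZl -{1}f'em -{1}(f_II_em m) r3 t3 f'e0 f_II_e0 scaleN1r subrr.
  by rewrite lNr lieC opprK.
by rewrite f'em f_II_em.
Qed.

(** The scale of p is fixed by e_-; then [e_+, e_-] = e_0 determines a and m. *)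
Lemma conj_normal_I f a b m : sl2_embedding f -> f e0 = p * q + m%:A ->
  f ep = a *: q ^+ 2 -> f em = b *: p ^+ 2 -> conj_normal f.
Proof.
move=> femb fe0 fep fem.
have b0 : b != 0.
  have := emb_neq0 femb em_neq0; rewrite fem; apply: contra_neq => ->.
  by rewrite scale0r.
pose s := sqrtC (2 * b)^-1.
have s2 : s ^+ 2 = (2 * b)^-1 by rewrite sqrtCK.
have s0 : s != 0.
  have : s ^+ 2 != 0 by rewrite s2 invr_eq0 mulf_neq0 // two_neq0.
  by rewrite expf_eq0.
have [al [alp alq]] := aut_scale s0.
have [f' [f'emb f'E cf]] := conj_normal_alg al femb; apply: cf.
suff -> : f' = f_I (F := F) by apply: conj_normal_refl; left.
have f'em : f' em = 2^-1 *: p ^+ 2.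
  rewrite f'E fem hom_scale rmorphXn /= alp exprZn scalerA s2 invfM mulrCA mulfV //.
  by rewrite mulr1.
have f'e0 : f' e0 = p * q + m%:A.
  rewrite f'E fe0 rmorphD /= hom_scale rmorphM rmorph1 /= alp alq.
  by rewrite -scalerAl -scalerAr scalerA mulfV // scale1r.
pose a' := a * s^-1 ^+ 2.
have f'ep : f' ep = a' *: q ^+ 2.
  by rewrite f'E fep hom_scale rmorphXn /= alq exprZn scalerA.
have [_ _ r3] := emb_rel f'emb; have [_ _ t3] := emb_rel (f_I_embedding two_neq0).
have Iep : f_I (F := F) ep = - (2^-1 *: q ^+ 2) by exact: sl2_extend_ep.
have Iem : f_I (F := F) em = 2^-1 *: p ^+ 2 by exact: sl2_extend_em.
have f'epI : f' ep = (- 2 * a') *: f_I ep.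
  rewrite f'ep Iep scalerN -scaleNr scalerA; congr (_ *: _).
  by field.
have f'e0I : f' e0 = (- 2 * a') *: f_I e0.
  by rewrite -r3 f'epI f'em -Iem lieZl t3.
have a'E : - 2 * a' = 1.
  have := congr1 (fun x => (sym x)`_1`_1) f'e0I.
  rewrite f'e0 f_I_e0 symZ !coefCM -[p * q]scale1r !coef11_weight.
  by rewrite mulr1.
rewrite a'E scale1r in f'epI; rewrite a'E scale1r in f'e0I.
have [f'lin _ _] := f'emb; have [Ilin _ _] := f_I_embedding two_neq0.
by apply: emb_ext => //; rewrite f'em.
Qed.

End Embeddings.

Section PositiveWeight.
Variable F : numClosedFieldType.
Local Notation A1 := (weyl F).
Local Notation p := (weyl_p F).
Local Notation q := (weyl_q F).
Local Notation M := {poly {poly F}}.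
Local Notation sl2 := (sl2 F).
Local Notation ep := (sl2_ep F).
Local Notation em := (sl2_em F).
Local Notation e0 := (sl2_e0 F).
Implicit Types (f : sl2 -> A1) (al : alg_aut A1).

Lemma op_qpow (P : M) k : (forall i j, P`_j`_i != 0 -> i = k /\ j = 0%N) ->
  op P = P`_0`_k *: q ^+ k.
Proof.
move=> PE; have {1}-> : P = (P`_0`_k *: 'X^k)%:P.
  apply/polyP => j; apply/polyP => i; rewrite coefC; case: j => [|j] /=; last first.
    by rewrite coef0; apply/eqP; apply: contraT => /PE [].
  rewrite coefZ coefXn; case: eqP => [->|ik]; first by rewrite mulr1.
  by rewrite mulr0; apply/eqP; apply: contraT => /PE [].
by rewrite opC horner_alg_scale rmorphXn /= horner_algX.
Qed.

Lemma op_ppow (P : M) k : (forall i j, P`_j`_i != 0 -> i = 0%N /\ j = k) ->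
  op P = P`_k`_0 *: p ^+ k.
Proof.
move=> PE; have {1}-> : P = ((P`_k`_0)%:P)%:P * 'X^k.
  apply/polyP => j; apply/polyP => i; rewrite coefCM coefXn.
  case: (j =P k) => [->|jk]; last first.
    by rewrite mulr0 coef0; apply/eqP; apply: contraT => /PE [].
  rewrite mulr1 coefC; case: eqP => [->|i0] //.
  by apply/eqP; apply: contraT => /PE [].
rewrite opZ; congr (_ *: _).
by elim: k {PE} => [|k IHk]; rewrite ?op1 // !exprSr opMX IHk.
Qed.

(** The leading forms of f(e_+) and f(e_-) are monomials q^(J+k) p^J and q^I p^(I+k).
  Their Poisson bracket does not vanish, so that f(e_0) = [f(e_+), f(e_-)]
  has degree 2(I+J+k-1). This degree is 2, which leaves three possibilities; one
  of them becomes another by exchanging e_+ and e_- as well as p and q. *)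
Lemma conj_normal_pos f l m k : sl2_embedding f ->
  f e0 = l *: (p * q) + m%:A -> (0 < k)%N -> l * k%:R = 2 -> conj_normal f.
Proof.
move=> femb fe0 k0 lk; have [r1 r2 r3] := emb_rel femb.
have l0 : l != 0.
  by apply/eqP => l0; move: lk => /eqP; rewrite l0 mul0r eq_sym pnatr_eq0.
set P := sym (f ep); set Q := sym (f em).
have hP i j : P`_j`_i != 0 -> i = (j + k)%N.
  move=> Pij; have /eqP := congr1 (fun x => (sym x)`_j`_i) r1.
  rewrite fe0 coef_lie_weight symZ !coefCM -subr_eq0 -mulrBl mulf_eq0 (negPf Pij) orbF.
  rewrite -lk -mulrBr mulf_eq0 (negPf l0) /= -addrA -opprD -natrD subr_eq0 eqr_nat.
  by move/eqP.
have hQ i j : Q`_j`_i != 0 -> j = (i + k)%N.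
  move=> Qij; have /eqP := congr1 (fun x => (sym x)`_j`_i) r2.
  rewrite fe0 coef_lie_weight symZ !coefCM -subr_eq0 -mulrBl mulf_eq0 (negPf Qij) orbF.
  rewrite opprK -lk -mulrDr mulf_eq0 (negPf l0) /= addrAC -natrD subr_eq0 eqr_nat eq_sym.
  by move/eqP.
have P0 : P != 0 by rewrite sym_eq0 emb_neq0 // ep_neq0.
have Q0 : Q != 0 by rewrite sym_eq0 emb_neq0 // em_neq0.
have [n1 [Pn [i1 [J [n1E PJ]]]]] := degree_exists P0.
have [n2 [Qn [I [j2 [n2E QI]]]]] := degree_exists Q0.
have i1E := hP _ _ PJ; have j2E := hQ _ _ QI.
set Pt := top 1 1 n1%:Z P; set Qt := top 1 1 n2%:Z Q.
have PtE i j : Pt`_j`_i != 0 -> i = (J + k)%N /\ j = J.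
  rewrite coef_top !mul1n; case: ifP => [/eqP[E] Pij|]; last by rewrite eqxx.
  by have := hP _ _ Pij; lia.
have QtE i j : Qt`_j`_i != 0 -> i = I /\ j = (I + k)%N.
  rewrite coef_top !mul1n; case: ifP => [/eqP[E] Qij|]; last by rewrite eqxx.
  by have := hQ _ _ Qij; lia.
have PtX : 'X * Pt^`() = Pt *+ J.
  apply/polyP => j; apply/polyP => i; rewrite coef_Xdp !coefMn.
  by have [->|/PtE[_ ->]//] := eqVneq Pt`_j`_i 0; rewrite !mul0rn.
have Ptq : 'X%:P * dq Pt = Pt *+ (J + k).
  apply/polyP => j; apply/polyP => i; rewrite coef_qdq !coefMn.
  by have [->|/PtE[-> _]//] := eqVneq Pt`_j`_i 0; rewrite !mul0rn.
have QtX : 'X * Qt^`() = Qt *+ (I + k).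
  apply/polyP => j; apply/polyP => i; rewrite coef_Xdp !coefMn.
  by have [->|/QtE[_ ->]//] := eqVneq Qt`_j`_i 0; rewrite !mul0rn.
have Qtq : 'X%:P * dq Qt = Qt *+ I.
  apply/polyP => j; apply/polyP => i; rewrite coef_qdq !coefMn.
  by have [->|/QtE[-> _]//] := eqVneq Qt`_j`_i 0; rewrite !mul0rn.
have Pt0 : Pt != 0.
  apply: contra_neq PJ => /(congr1 (fun R : M => R`_J`_i1)).
  by rewrite coef_top !mul1n n1E eqxx !coef0.
have Qt0 : Qt != 0.
  apply: contra_neq QI => /(congr1 (fun R : M => R`_j2`_I)).
  by rewrite coef_top !mul1n n2E eqxx !coef0.
have W0 : poisson Pt Qt != 0.
  apply: contraTneq (mulf_neq0 Pt0 Qt0) => W0; rewrite negbK.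
  have : 'X * ('X%:P * poisson Pt Qt) = 0 by rewrite W0 !mulr0.
  have -> : 'X * ('X%:P * poisson Pt Qt) =
      ('X * Pt^`()) * ('X%:P * dq Qt) - ('X%:P * dq Pt) * ('X * Qt^`()).
    by rewrite /poisson; ring.
  rewrite PtX Ptq QtX Qtq !mulrnAl !mulrnAr -!mulrnA => /eqP.
  rewrite subr_eq0 eq_sym -subr_eq0.
  have -> : ((I + k) * (J + k) = I * J + (k * (I + J + k)).-1.+1)%N.
    by rewrite prednK; nia.
  by rewrite mulrnDr addrAC subrr add0r poly2_mulrn_eq0.
have [Wn WE] := lie_top (isT : (0 < 1 + 1)%N) Pn Qn.
rewrite !symK r3 -/Pt -/Qt in Wn WE.
have IJk : (I + J + k = 2)%N.
  have := Wn 1%N 1%N; rewrite {1}fe0 coef11_weight => /(_ l0) le4.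
  have ge4 : (n1 + n2 <= 4)%N.
    rewrite leqNgt; apply: contraNN W0 => gt4; apply/eqP; rewrite -WE.
    apply/polyP => j; apply/polyP => i; rewrite coef_top !coef0.
    case: ifP => // /eqP wij; rewrite fe0 sym_weight coefD coefMX !coefC.
    case: j wij => [|[|j]] /= wij; rewrite ?add0r ?addr0.
    - by rewrite coefC; case: i wij => [|i] //; lia.
    - by rewrite coefZ coefX; case: i wij => [|[|i]] //=; rewrite ?mulr0 //; lia.
    - by rewrite coef0.
  lia.
have fepE : J = 0%N -> f ep = P`_0`_k *: q ^+ k.
  move=> J0; rewrite -[LHS]symK; apply: op_qpow => i j Pij.
  by have := Pn _ _ Pij; have := hP _ _ Pij; rewrite !mul1n lez_nat; lia.
have femE : I = 0%N -> f em = Q`_k`_0 *: p ^+ k.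
  move=> I0; rewrite -[LHS]symK; apply: op_ppow => i j Qij.
  by have := Qn _ _ Qij; have := hQ _ _ Qij; rewrite !mul1n lez_nat; lia.
have [k1|k2] : k = 1%N \/ k = 2%N by lia.
  have l2 : l = 2 by rewrite -lk k1 mulr1.
  have [I0|J0] : I = 0%N \/ J = 0%N by lia.
    by apply: (conj_normal_II femb (b := Q`_1`_0) (m := m));
      [rewrite fe0 l2|rewrite femE // k1 expr1].
  have [w wE] := sl2_aut_flip F; have [f' [f'emb f'E cf]] := conj_normal_sl2 w femb.
  apply: cf; have [al [alp alq]] := aut_swap F.
  have [g [gemb gE cg]] := conj_normal_alg al f'emb; apply: cg.
  have wep : w ep = em.
    by have [w00 w01 w10] := wE ep; apply: sl2_eqP; rewrite ?w00 ?w01 ?w10 /= !mxE /= ?oppr0.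
  have we0 : w e0 = -1 *: e0.
    by have [w00 w01 w10] := wE e0; apply: sl2_eqP; rewrite ?w00 ?w01 ?w10 /= !mxE /= ?subrr ?mulr0 ?mulN1r.
  apply: (conj_normal_II gemb (b := P`_0`_1) (m := - m - 2)).
    have f'e0 : f' e0 = -1 *: f e0.
      by rewrite -f'E we0 (embZ _ _ f'emb) scalerA mulrNN mulr1 scale1r.
    rewrite gE f'e0 fe0 l2 hom_scale rmorphD /= !hom_scale rmorphM rmorph1 /= alp alq.
    rewrite pq_qp mulNr scaleN1r opprD scalerN opprK scalerDr -addrA -scaleNr -scalerDl.
    by congr (_ + _ *: _); ring.
  by rewrite gE -wep f'E fepE // k1 expr1 hom_scale alq.
have l1 : l = 1.
  by apply: (mulIf (two_neq0 F)); rewrite mul1r -[RHS]lk k2.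
apply: (conj_normal_I femb (a := P`_0`_2) (b := Q`_2`_0) (m := m)).
- by rewrite fe0 l1 scale1r.
- by rewrite fepE ?k2 //; lia.
- by rewrite femE ?k2 //; lia.
Qed.

End PositiveWeight.

Section NormalImages.
Variable F : numClosedFieldType.
Local Notation A1 := (weyl F).
Local Notation p := (weyl_p F).
Local Notation q := (weyl_q F).
Local Notation sl2 := (sl2 F).
Local Notation ep := (sl2_ep F).
Local Notation em := (sl2_em F).
Local Notation e0 := (sl2_e0 F).
Implicit Types (f : sl2 -> A1) (al : alg_aut A1).

Lemma conj_normal_e0 f l m : sl2_embedding f -> f e0 = l *: (p * q) + m%:A ->
  conj_normal f.
Proof.
move=> femb fe0; have [r1 _ _] := emb_rel femb.
have [i [j Pij]] : exists i j, (sym (f ep))`_j`_i != 0.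
  have P0 : sym (f ep) != 0 by rewrite sym_eq0 emb_neq0 // ep_neq0.
  by have [n [_ [i [j [_ Pij]]]]] := degree_exists P0; exists i, j.
have lij : l * (i%:R - j%:R) = 2.
  have /eqP := congr1 (fun x => (sym x)`_j`_i) r1.
  rewrite fe0 coef_lie_weight symZ !coefCM -subr_eq0 -mulrBl mulf_eq0 (negPf Pij) orbF.
  by rewrite subr_eq0 => /eqP.
have [ij|ji|E] := ltngtP i j; last first.
- by move: lij => /eqP; rewrite E subrr mulr0 eq_sym (negPf (two_neq0 F)).
- apply: (conj_normal_pos femb fe0 (k := (i - j)%N)); first by lia.
  by rewrite natrB // ltnW.
(* negative weights are reversed by exchanging p and q *)
have [al [alp alq]] := aut_swap F; have [g [gemb gE cg]] := conj_normal_alg al femb.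
apply: cg; apply: (conj_normal_pos gemb (l := - l) (m := l + m) (k := (j - i)%N)).
- rewrite gE fe0 rmorphD /= !hom_scale rmorphM rmorph1 /= alp alq pq_qp mulNr scalerN.
  by rewrite scalerDr !scaleNr scalerDl addrA addrNK.
- by lia.
- by rewrite natrB ?(ltnW ij) // mulNr -mulrN opprB.
Qed.

(** If z were nilpotent, then f(z) would be a bracket of itself with a multiple of
  f(e_0); but no bracket with l pq + m contains the monomial qp. *)
Lemma conj_normal_weight f z l m : sl2_embedding f -> z <> 0 -> l != 0 ->
  f z = l *: (p * q) + m%:A -> conj_normal f.
Proof.
move=> femb z0 l0 fz; apply: (conj_normal_jordan femb z0) => f' c f'emb c0 f'E.
  apply: (@conj_normal_e0 f' (c * l) (c * m)) => //.
  by rewrite f'E fz scalerDr !scalerA.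
have [_ r2 _] := emb_rel f'emb; exfalso.
have := congr1 (fun x => (sym x)`_1`_1) r2.
rewrite /= lieC f'E lieZl -scaleN1r scalerA !symZ !coefCM fz coef_lie_weight subrr.
rewrite coef11_weight mulr0 mul0r mulr0 => /esym/eqP.
by rewrite !mulf_eq0 oppr_eq0 (negPf (two_neq0 F)) (negPf c0) (negPf l0).
Qed.

(** As ad f(z) is locally nilpotent, z is nilpotent, so z = e_- may be assumed;
  the relation between e_0 and e_- then brings f(e_0) to l pq + m. *)
Lemma conj_normal_poly_q f z g : sl2_embedding f -> z <> 0 ->
  f z = horner_alg q g -> conj_normal f.
Proof.
move=> femb z0 fz; apply: (conj_normal_jordan femb z0) => f' c f'emb c0 f'E;
  rewrite fz -horner_alg_scale in f'E; have [r1 r2 _] := emb_rel f'emb.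
  exfalso; have := emb_neq0 f'emb (ep_neq0 F); apply/negP; rewrite negbK; apply/eqP.
  apply: (nil_eigen0 _ r1 (two_neq0 F)).
  by rewrite f'E; exact: ad_poly_q_nil.
have fem0 := emb_neq0 f'emb (em_neq0 F).
have cg0 : c *: g != 0.
  by apply: contra_neq fem0 => E; rewrite f'E E rmorph0.
have m20 : - 2 != 0 :> F by rewrite oppr_eq0 two_neq0.
rewrite f'E in r2; have [al [l [m [l0 alE]]]] := lie_poly_q_eigen m20 cg0 r2.
have [h [hemb hE ch]] := conj_normal_alg al f'emb; apply: ch.
by apply: (@conj_normal_e0 h l m) => //; rewrite hE.
Qed.

Lemma conj_normal_normalizable f z : sl2_embedding f -> z <> 0 ->
  normalizable (f z) -> conj_normal f.
Proof.
move=> femb z0 [al alz]; have [h [hemb hE ch]] := conj_normal_alg al femb; apply: ch.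
case: alz => [[g gE]|[l [m [l0 lE]]]].
  by apply: (@conj_normal_poly_q h z g) => //; rewrite hE.
by apply: (@conj_normal_weight h z l m) => //; rewrite hE.
Qed.

(** An element commuting with pq is a polynomial in qp. It is affine, since
  otherwise diagonal_lie_eigen excludes the relations that f(z) satisfies with
  f(e_+) or f(e_0). *)
Lemma conj_normal_comm_pq f z : sl2_embedding f -> z <> 0 ->
  lie (p * q) (f z) = 0 -> conj_normal f.
Proof.
move=> femb z0 pqz; set H := sym (f z).
have diagH : diagonal_symbol H.
  move=> i j ij; have /eqP := congr1 (fun x => (sym x)`_j`_i) pqz.
  rewrite coef_lie_pq sym0 !coef0 mulf_eq0 subr_eq0 eqr_nat (negPf ij).
  by move/eqP.
have fzE : f z = op H by rewrite symK.
have [szH|szH] := leqP (size H) 2.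
  have fzl : f z = H`_1`_1 *: (p * q) + (H`_0`_0 - H`_1`_1)%:A.
    rewrite fzE; apply: (can_inj (@symK F)); rewrite sym_weight [H`_1`_1 + _]addrC subrK opK.
    apply/polyP => j; apply/polyP => i; rewrite coefD coefMX !coefC.
    case: j => [|[|j]] /=; rewrite ?addr0 ?add0r.
    - rewrite coefC; case: eqP => [->//|/eqP i0]; exact: diagH.
    - rewrite coefZ coefX; case: (i =P 1%N) => [->|/eqP i1]; first by rewrite mulr1.
      by rewrite mulr0; exact: diagH.
    - by rewrite [H`_j.+2]nth_default // (leq_trans szH).
  have [l0|l0] := eqVneq H`_1`_1 0; last exact: conj_normal_weight fzl.
  apply: (@conj_normal_poly_q f z (H`_0`_0)%:P) => //.
  by rewrite fzl l0 scale0r subr0 add0r horner_algC.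
apply: (conj_normal_jordan femb z0) => f' c f'emb c0 f'E; exfalso;
  have [r1 r2 _] := emb_rel f'emb; rewrite fzE in f'E.
  have E : lie (op H) (f' ep) = (c^-1 * 2) *: f' ep + 0 *: op H.
    by rewrite scale0r addr0 -scalerA -r1 f'E lieZl scalerA mulVf // scale1r.
  have := diagonal_lie_eigen diagH szH E.
  rewrite E scale0r addr0 => /eqP; rewrite scaler_eq0 (negPf (emb_neq0 f'emb (ep_neq0 F))).
  by rewrite mulf_eq0 invr_eq0 (negPf c0) (negPf (two_neq0 F)).
have E : lie (op H) (f' e0) = 0 *: f' e0 + 2 *: op H.
  have opHE : op H = c^-1 *: f' em by rewrite f'E scalerA mulVf // scale1r.
  rewrite scale0r add0r opHE lieZl lieC r2 scaleNr opprK !scalerA.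
  by rewrite mulrC.
have := diagonal_lie_eigen diagH szH E; rewrite E scale0r add0r => /eqP.
rewrite scaler_eq0 (negPf (two_neq0 F)) /= -fzE.
by rewrite (negPf (emb_neq0 femb _)) //; apply/eqP.
Qed.

(** Normalise y. If it is a polynomial in q, then f(z) is one as well for c = 0,
  and conjugate to l pq + m otherwise. If it is l pq + m, the coefficient of qp
  shows that c = 0. *)
Lemma conj_normal_eigenvector f z y c : sl2_embedding f -> z <> 0 ->
  ~ is_scalar y -> locally_finite y -> lie (f z) y = c *: y -> conj_normal f.
Proof.
move=> femb z0 ynsc ylf yE.
have [al aly] := locally_finite_normalizable ylf.
have [h [hemb hE ch]] := conj_normal_alg al femb; apply: ch.
have {}yE : lie (h z) (al y) = c *: al y by rewrite hE -lie_morph yE hom_scale.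
have {}ynsc : ~ is_scalar (al y).
  case=> k kE; apply: ynsc; exists k; apply: (bij_inj (alg_aut_bij al)).
  by rewrite kE hom_scale rmorph1.
case: aly => [[g gE]|[l [m [l0 lE]]]].
  rewrite gE in yE ynsc.
  have g'0 : g^`() != 0.
    by apply/eqP => /deriv_eq0_const E; apply: ynsc; exists g`_0; rewrite E horner_algC coefC.
  have [c0|c0] := eqVneq c 0.
    rewrite c0 scale0r in yE; have [g' g'E] := lie_poly_q_eq0 g'0 yE.
    exact: conj_normal_poly_q g'E.
  have g0 : g != 0 by apply: contra_neq g'0 => ->; rewrite deriv0.
  have [be [l [m [l0 beE]]]] := lie_poly_q_eigen c0 g0 yE.
  have [h' [h'emb h'E ch']] := conj_normal_alg be hemb; apply: ch'.
  by apply: (@conj_normal_weight h' z l m) => //; rewrite h'E.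
have c0 : c = 0.
  have := congr1 (fun x => (sym x)`_1`_1) yE.
  rewrite /= lieC lE -scaleN1r !symZ !coefCM coef_lie_weight subrr coef11_weight.
  by rewrite mulr0 mul0r mulr0 => /esym/eqP; rewrite mulf_eq0 (negPf l0) orbF => /eqP.
apply: (@conj_normal_comm_pq h z) => //.
move: yE; rewrite c0 scale0r lE lieDr lie_scalar addr0 lieZr lieC => /eqP.
by rewrite scaler_eq0 (negPf l0) oppr_eq0 => /eqP.
Qed.

End NormalImages.

Import numFieldNormedType.Exports.

(** * Linear spans *)

Section LinSpan.
Variables (F : fieldType) (V : lmodType F).
Implicit Types (S : set V) (x y : V).

Lemma lin_span_sub S x : S x -> lin_span S x.
Proof. by move=> Sx; exists 1%N, (fun=> 1), (fun=> x); rewrite big_ord1 scale1r. Qed.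

Lemma lin_span0 S : lin_span S 0.
Proof. by exists 0%N, (fun=> 0), (fun=> 0); rewrite big_ord0; split=> // -[]. Qed.

Lemma lin_spanD S x y : lin_span S x -> lin_span S y -> lin_span S (x + y).
Proof.
move=> [n [c [s [sS ->]]]] [m [d [t [tS ->]]]].
exists (n + m)%N, (fun i => match fintype.split i with inl j => c j | inr j => d j end).
exists (fun i => match fintype.split i with inl j => s j | inr j => t j end); split.
  by move=> i; case: (fintype.split i).
rewrite big_split_ord /=; congr (_ + _); apply: eq_bigr => i _.
  by rewrite (unsplitK (inl i)).
by rewrite (unsplitK (inr i)).
Qed.

Lemma lin_spanZ S (a : F) x : lin_span S x -> lin_span S (a *: x).
Proof.
move=> [n [c [s [sS ->]]]]; exists n, (fun i => a * c i), s; split => //.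
by rewrite scaler_sumr; apply: eq_bigr => i _; rewrite scalerA.
Qed.

Lemma lin_span_sum S I (r : seq I) (P : pred I) (G : I -> V) :
  (forall i, P i -> lin_span S (G i)) -> lin_span S (\sum_(i <- r | P i) G i).
Proof.
by move=> GS; elim/big_ind: _ => // [|x y]; [exact: lin_span0|exact: lin_spanD].
Qed.

Lemma lin_span_min S S' x : (forall y, S y -> lin_span S' y) ->
  lin_span S x -> lin_span S' x.
Proof.
move=> SS' [n [c [s [sS ->]]]]; apply: lin_span_sum => i _.
by apply: lin_spanZ; exact: SS'.
Qed.

Lemma span_basis_exists n (u : 'I_n -> V) :
  exists N (v : 'I_N -> V) (M : 'I_n -> 'I_N -> F),
    [/\ forall c : 'I_N -> F, \sum_i c i *: v i = 0 -> forall i, c i = 0,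
        forall i, lin_span (range u) (v i) &
        forall k, u k = \sum_i M k i *: v i].
Proof.
elim: n u => [|n IHn] u.
  exists 0%N, (fun=> 0), (fun _ _ => 0).
  by split; [move=> c _ []|case|case].
have [N [v [M [v_free vu uv]]]] := IHn (u \o lift ord0).
have vu' i : lin_span (range u) (v i).
  apply: lin_span_min (vu i) => _ [j _ <-]; apply: lin_span_sub.
  by exists (lift ord0 j).
have [[d u0]|u0] := pselect (exists d : 'I_N -> F, u ord0 = \sum_i d i *: v i).
  exists N, v, (fun k => if unlift ord0 k is Some j then M j else d); split => // k.
  by case: (unliftP ord0 k) => [j|] ->; [exact: uv|].
exists N.+1, (fun i => if unlift ord0 i is Some j then v j else u ord0).
exists (fun k i => if unlift ord0 k is Some k' then
                     if unlift ord0 i is Some i' then M k' i' else 0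
                   else (i == ord0)%:R); split.
- move=> c; rewrite big_ord_recl unlift_none.
  under eq_bigr do rewrite liftK.
  have [c0|c0] := eqVneq (c ord0) 0.
    rewrite c0 scale0r add0r => /v_free cv i.
    by case: (unliftP ord0 i) => [j|] ->.
  move=> /eqP; rewrite addr_eq0 => /eqP cu; case: u0.
  exists (fun i => - ((c ord0)^-1 * c (lift ord0 i))).
  rewrite -[LHS]scale1r -(mulVf c0) -scalerA cu scalerN scaler_sumr -sumrN.
  by apply: eq_bigr => i _; rewrite scaleNr scalerA.
- move=> i; case: (unliftP ord0 i) => [j|] _ //.
  by apply: lin_span_sub; exists ord0.
move=> k; rewrite big_ord_recl unlift_none.
case: (unliftP ord0 k) => [j|] ->.
  rewrite scale0r add0r; apply: etrans (uv j) _.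
  by apply: eq_bigr => i _; rewrite liftK.
rewrite eqxx scale1r big1 ?addr0 // => i _.
by rewrite -[_ == _]/(lift ord0 i == ord0) eq_sym (negPf (neq_lift _ _)) scale0r.
Qed.

End LinSpan.

(** * One-parameter groups *)

Section Exponential.
Variable R : realType.
Local Notation C := R[i].

(** The span of the orbit of a is stable under the group, hence, by differentiation
  at 0, under ad Z. *)
Lemma exponentiable_locally_finite (A : algType C) (Z : A) :
  exponentiable Z -> locally_finite Z.
Proof.
case=> Phi PhiD Phi_basis a.
have Phi0 b : Phi 0 b = b.
  by apply: (bij_inj (alg_aut_bij (Phi 0))); rewrite -PhiD addr0.
pose V := lin_span (range (fun t => Phi t a)).
have stable b : V b -> V (lie Z b).
  case=> n [c [s [sV ->]]].
  rewrite (big_morph (lie Z) (@lieDr _ _ Z) (der0 (@lieDr _ _ Z))).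
  apply: lin_span_sum => k _; rewrite lieZr; apply: lin_spanZ.
  have [t0 _ <-] := sV k.
  have [N [v [d [[_ vE] _ _ <-]]]] := Phi_basis (Phi t0 a).
  apply: lin_span_sum => i _; apply: lin_spanZ.
  have : lin_span (range v) (v i) by apply: lin_span_sub; exists i.
  rewrite vE; apply: lin_span_min => _ [t _ <-]; apply: lin_span_sub.
  by exists (t + t0) => //; rewrite PhiD.
have [n [v [c [[_ vE] _ _ _]]]] := Phi_basis a.
exists n, v => m; rewrite vE -/V.
elim: m => [|m IHm]; last exact: stable.
by apply: lin_span_sub; exists 0.
Qed.

Lemma is_derive_horner (K : numFieldType) (p : {poly K}) (t : K) :
  is_derive t (1 : K) (horner p) p^`().[t].
Proof.
elim/poly_ind: p => [|p c IHp].
  have -> : horner (0 : {poly K}) = cst (0 : K) by apply/funext => x; rewrite horner0.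
  by rewrite deriv0 horner0; exact: is_derive_cst.
have -> : horner (p * 'X + c%:P) = ((horner p) * (@id K)) + cst (c : K).
  by apply/funext => x; rewrite hornerMXaddC.
rewrite derivD derivC addr0 derivM derivX mulr1 hornerD hornerMX.
have H : is_derive t (1 : K) (((horner p) * (@id K)) + cst c)
    ((p.[t] *: (1 : K) + t *: p^`().[t]) + 0) by apply: is_deriveD.
by apply: is_derive_eq H _; rewrite addr0 /GRing.scale /= mulr1 addrC mulrC.
Qed.

Lemma is_derive_horner_complex (p : {poly C}) (t : C) :
  is_derive (t : C^o) (1 : C^o) (horner p : C^o -> C^o) p^`().[t].
Proof. exact: is_derive_horner. Qed.

(** The coefficients of a polynomial curve lie in the span of its values: replace
  u(t) by u(2t) - 2^n u(t) to lower the degree. *)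
Lemma poly_curve_coef (V : lmodType C) (S : set V) n (u : nat -> V) :
  (forall t : C, lin_span S (\sum_(k < n) t ^+ k *: u k)) ->
  forall k, (k < n)%N -> lin_span S (u k).
Proof.
elim: n u => // n IHn u uS.
have lower k : (k < n)%N -> lin_span S (u k).
  move=> kn; pose b (j : nat) : C := 2 ^+ j - 2 ^+ n.
  have bk : b k != 0.
    by rewrite subr_eq0 -!natrX eqr_nat eqn_exp2l // ltn_eqF.
  rewrite -[u k]scale1r -(mulVf bk) -scalerA; apply: lin_spanZ.
  apply: (IHn (fun j => b j *: u j)) kn => t.
  have -> : \sum_(j < n) t ^+ j *: (b j *: u j) =
      \sum_(j < n.+1) (2 * t) ^+ j *: u j + (- 2 ^+ n) *: \sum_(j < n.+1) t ^+ j *: u j.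
    rewrite scaler_sumr -big_split /= [RHS]big_ord_recr /= scalerA -scalerDl.
    rewrite exprMn mulNr subrr scale0r addr0; apply: eq_bigr => j _.
    by rewrite !scalerA -scalerDl /b exprMn; congr (_ *: _); ring.
  by apply: lin_spanD; [|apply: lin_spanZ]; exact: uS.
move=> k; rewrite ltnS leq_eqVlt => /orP[/eqP ->|]; last exact: lower.
have -> : u n = \sum_(k < n.+1) 1 ^+ k *: u k + (-1) *: \sum_(k < n) u k.
  rewrite big_ord_recr /= expr1n scale1r scaleN1r addrAC.
  by under eq_bigr do rewrite expr1n scale1r; rewrite subrr add0r.
apply: lin_spanD => //; apply: lin_spanZ; apply: lin_span_sum => j _.
exact: lower.
Qed.

Lemma poly_curve_basis (V : lmodType C) n (u : nat -> V) (g : C -> V) :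
  (1 < n)%N -> (forall t, g t = \sum_(k < n) t ^+ k *: u k) ->
  exists N (v : 'I_N -> V) (c : 'I_N -> C -> C),
    [/\ is_basis v (lin_span (range g)),
        forall t, g t = \sum_i c i t *: v i,
        forall i, holomorphic (c i) &
        \sum_i 'D_1 (c i : C^o -> C^o) 0 *: v i = u 1%N].
Proof.
move=> n1 gE; have [N [v [M [v_free vu uv]]]] := span_basis_exists (fun k : 'I_n => u k).
pose P i : {poly C} := \poly_(k < n) (if insub k is Some k' then M k' i else 0).
have gv t : g t = \sum_i (P i).[t] *: v i.
  rewrite gE; under eq_bigr => k _ do rewrite uv scaler_sumr.
  rewrite exchange_big; apply: eq_bigr => i _ /=.
  rewrite horner_poly scaler_suml; apply: eq_bigr => k _.
  by rewrite valK scalerA mulrC.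
have ug k : lin_span (range g) (u (k : 'I_n)).
  apply: (@poly_curve_coef _ _ n) => // t; rewrite -gE; apply: lin_span_sub.
  by exists t.
exists N, v, (fun i => horner (P i)); split=> // [|i t|].
- split=> //; apply/seteqP; split=> y.
    apply: lin_span_min => _ [i _ <-]; apply: lin_span_min (vu i) => _ [k _ <-].
    exact: ug.
  apply: lin_span_min => _ [t _ <-]; rewrite gv; apply: lin_span_sum => i _.
  by apply: lin_spanZ; apply: lin_span_sub; exists i.
- by have [] := @is_derive_horner_complex (P i) t.
rewrite (uv (Ordinal n1)); apply: eq_bigr => i _.
have [_ ->] := @is_derive_horner_complex (P i) 0.
by rewrite horner_coef0 coef_deriv coef_poly n1 insubT.
Qed.

End Exponential.

(** * Properties of the normal forms *)

Section NormalProperties.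
Variable F : numClosedFieldType.
Local Notation A1 := (weyl F).
Local Notation p := (weyl_p F).
Local Notation q := (weyl_q F).
Local Notation M := {poly {poly F}}.
Implicit Types (x y : A1) (al be : alg_aut A1).

Lemma aut_surj al y : exists x, al x = y.
Proof. by have [b _ bK] := alg_aut_bij al; exists (b y). Qed.

Lemma aut_inj al : injective al.
Proof. exact: bij_inj (alg_aut_bij al). Qed.

Lemma aut_inv al : exists be, (forall x, al (be x) = x) /\ (forall x, be (al x) = x).
Proof.
have [P alP] := aut_surj al p; have [Q alQ] := aut_surj al q.
have PQ : P * Q - Q * P = 1.
  by apply: (@aut_inj al); rewrite rmorphB !rmorphM /= alP alQ rmorph1; exact: weyl_pq.
have [h [hp hq] _] := weyl_universal PQ.
have alh x : al (h x) = x.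
  by apply: (@weyl_hom_ext _ (al \o h) idfun) => /=; rewrite ?hp ?hq.
have hal x : h (al x) = x by apply: (@aut_inj al); rewrite alh.
by exists (AlgAut (Bijective alh hal)).
Qed.

Lemma coef_mono i0 j0 i j : (sym (q ^+ i0 * p ^+ j0))`_j`_i = ((i == i0) && (j == j0))%:R.
Proof.
have -> : q ^+ i0 * p ^+ j0 = op (('X^i0)%:P * 'X^j0).
  rewrite opCM rmorphXn /= horner_algX; congr (_ * _).
  by elim: j0 => [|j0 IH]; rewrite ?op1 // !exprSr opMX IH.
rewrite opK coefCM coefXn; case: (j == j0); rewrite ?mulr1 ?andbT ?coefXn //.
by rewrite mulr0 coef0 andbF.
Qed.

Lemma weight_strictly_semisimple al x (l m : F) : l != 0 ->
  al x = l *: (p * q) + m%:A -> strictly_semisimple x.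
Proof.
move=> l0 alx.
have diag : ad_diag x = setT.
  apply/seteqP; split=> // a _; have aE := opE (sym (al a)); rewrite symK in aE.
  have [be [alK beK]] := aut_inv al.
  have -> : a = be (al a) by rewrite beK.
  rewrite aE rmorph_sum /=; apply: lin_span_sum => j _.
  rewrite rmorph_sum /=; apply: lin_span_sum => i _.
  rewrite hom_scale; apply: lin_spanZ; apply: lin_span_sub.
  exists (l * (i%:R - j%:R)); apply: (@aut_inj al).
  rewrite lie_morph hom_scale !alK alx; apply: (can_inj (@symK F)).
  apply/polyP => j'; apply/polyP => i'; rewrite coef_lie_weight symZ !coefCM coef_mono.
  by case: (i' =P i) => [->|_]; case: (j' =P j) => [->|_]; rewrite /= ?mulr0.
have nc : exists y, lie x y <> 0.
  have [y yE] := aut_surj al q; exists y => xy.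
  have := congr1 al xy; rewrite lie_morph alx yE rmorph0 => /(congr1 (@sym F)).
  move=> /(congr1 (fun P : M => P`_0`_1)); rewrite coef_lie_weight sym0 !coef0.
  rewrite -[q]mulr1 -(expr0 p) -[q]expr1 coef_mono /= subr0 !mulr1.
  by move/eqP; rewrite (negPf l0).
split.
- case=> c cE; have [y] := nc; rewrite cE; apply.
  exact: lie_scalarl.
- by rewrite diag => E; have [y] := nc; apply; have : (setT : set A1) y by []; rewrite E.
- apply/seteqP; split=> y; last by move=> xy; exists 1%N.
  case=> n _ /(congr1 al); rewrite iter_lie_morph rmorph0 alx => yn.
  apply: (@aut_inj al); rewrite lie_morph rmorph0 alx.
  apply: (can_inj (@symK F)); apply/polyP => j; apply/polyP => i.
  rewrite coef_lie_weight sym0 !coef0.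
  have it k : (sym (iter k (lie (l *: (p * q) + m%:A)) (al y)))`_j`_i =
      (l * (i%:R - j%:R)) ^+ k * (sym (al y))`_j`_i.
    elim: k => [|k IHk]; first by rewrite mul1r.
    by rewrite iterS coef_lie_weight IHk mulrA -exprS.
  have /eqP := it n; rewrite yn sym0 !coef0 eq_sym mulf_eq0 expf_eq0.
  by case/orP=> [/andP[_ /eqP ->]|/eqP ->]; rewrite ?mul0r ?mulr0.
- exact: diag.
Qed.

Lemma poly_q_strictly_nilpotent al x g : g^`() != 0 ->
  al x = horner_alg q g -> strictly_nilpotent x.
Proof.
move=> g'0 alx.
have nil a : der_nil (lie x) a.
  have [n an] := ad_poly_q_nil g (al a); exists n; apply: (@aut_inj al).
  by rewrite iter_lie_morph alx an rmorph0.
have nc : exists y, lie x y <> 0.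
  have [y yE] := aut_surj al p; exists y => xy.
  have := congr1 al xy; rewrite lie_morph alx yE rmorph0 lieC lie_pq_poly => /eqP.
  rewrite oppr_eq0 -opC -op0 => /eqP/op_inj/eqP.
  by rewrite polyC_eq0 (negPf g'0).
split.
- by case=> c cE; have [y] := nc; rewrite cE; apply; exact: lie_scalarl.
- apply/seteqP; split=> y; last first.
    by move=> xy; apply: lin_span_sub; exists 0; rewrite scale0r.
  case=> n [c [s [sE ->]]]; rewrite /centralizer /=.
  rewrite (big_morph (lie x) (@lieDr _ _ x) (der0 (@lieDr _ _ x))) big1 // => i _.
  have [k xs] := sE i; rewrite lieZr; have [k0|k0] := eqVneq k 0.
    by rewrite xs k0 scale0r scaler0.
  by rewrite (nil_eigen0 (nil _) xs k0) /lie mulr0 mul0r subrr scaler0.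
- move=> E; have [y xy] := nc; apply: xy.
  suff : ad_nil x y by rewrite E.
  by have [n yn] := nil y; exists n.+1; rewrite // iterS yn /lie mulr0 mul0r subrr.
- apply/seteqP; split=> // y _; have [n yn] := nil y.
  by exists n.+1; rewrite // iterS yn /lie mulr0 mul0r subrr.
Qed.

Lemma sl2_aut_inv_neq0 (w : sl2_aut F) (x : sl2 F) : x != 0 -> sl2_aut_inv w x <> 0.
Proof.
move=> x0 wx; case/eqP: x0; rewrite -[x](sl2_aut_invK w) wx.
by have := sl2_aut_linear w (-1) 0 0; rewrite scaler0 addr0 scaleN1r addNr.
Qed.

Lemma conj_normal_semisimple (f : sl2 F -> A1) : conj_normal f ->
  exists2 z, z <> 0 & strictly_semisimple (f z).
Proof.
case=> -[al w] nf; exists (sl2_aut_inv w (sl2_e0 F)).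
  exact: sl2_aut_inv_neq0 (e0_neq0 F).
have [l [m [l0 fe0]]] : exists l m, l != 0 /\
    aut_act (al, w) f (sl2_e0 F) = l *: (p * q) + m%:A.
  case: nf => [->|[b _ <-]].
    by exists 1, (- 2^-1); rewrite oner_neq0 scale1r f_I_e0.
  by exists 2, b; rewrite two_neq0 f_II_e0.
exact: weight_strictly_semisimple l0 fe0.
Qed.

(** In the normal forms e_- is mapped to a polynomial in p, and exchanging p and q
  turns it into one in q. *)
Lemma conj_normal_nilpotent (f : sl2 F -> A1) : conj_normal f ->
  exists2 z, z <> 0 & exists al g, g^`() != 0 /\ al (f z) = horner_alg q g.
Proof.
case=> -[al w] nf; exists (sl2_aut_inv w (sl2_em F)).
  exact: sl2_aut_inv_neq0 (em_neq0 F).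
have [be [bep beq]] := aut_swap F; have [ga gaE] := aut_comp be al; exists ga.
have -> : ga (f (sl2_aut_inv w (sl2_em F))) = be (aut_act (al, w) f (sl2_em F)).
  by rewrite gaE.
case: nf => [->|[b _ <-]].
  exists (2^-1 *: 'X^2); split.
    apply/eqP => /(congr1 (fun h : {poly F} => h`_1))/eqP.
    by rewrite coef_deriv coefZ coefXn mulr1 coef0 mulrn_eq0 invr_eq0 (negPf (two_neq0 F)).
  rewrite [f_I _]sl2_extend_em hom_scale rmorphXn /= bep sqrrN.
  by rewrite horner_alg_scale rmorphXn /= horner_algX.
exists 'X; rewrite derivX oner_neq0; split => //.
by rewrite f_II_em rmorphN /= bep opprK horner_algX.
Qed.

End NormalProperties.

Section NormalExponential.
Variable R : realType.
Local Notation C := R[i].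
Local Notation A1 := (weyl C).
Local Notation p := (weyl_p C).
Local Notation q := (weyl_q C).

(** The group is p -> p - t g'(q), q -> q. The elements whose orbit is polynomial
  in t, with the expected derivative at 0, form a subalgebra; so it suffices to
  look at p and q. *)
Lemma poly_q_exponentiable (al : alg_aut A1) x g :
  al x = horner_alg q g -> exponentiable x.
Proof.
move=> alx; have [be [alK beK]] := aut_inv al.
have [Phi PhiE] := choice (fun t : C => aut_triangular (- t *: g^`())).
have Phip t : Phi t p = p - t *: horner_alg q g^`().
  by have [-> _] := PhiE t; rewrite scaleNr rmorphN /= horner_alg_scale.
have Phiq t : Phi t q = q by have [_ ->] := PhiE t.
have Phi_poly t h : Phi t (horner_alg q h) = horner_alg q h.
  by rewrite aut_horner Phiq.
have PhiD s t a : Phi (s + t) a = Phi s (Phi t a).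
  apply: (@weyl_hom_ext _ (Phi (s + t)) (Phi s \o Phi t)) => /=; last by rewrite !Phiq.
  rewrite !Phip rmorphB /= hom_scale Phi_poly Phip scalerDl opprD addrA.
  by [].
have Phi0 a : Phi 0 a = a.
  by apply: (@aut_inj _ (Phi 0)); rewrite -PhiD addr0.
have curve a : exists W : {poly A1},
    (forall t : C, Phi t a = W.[t%:A]) /\ W`_1 = lie (horner_alg q g) a.
  have central (W : {poly A1}) (t : C) : comm_poly W t%:A.
    by rewrite /comm_poly mulr_algl mulr_algr.
  have curveC h : exists W : {poly A1},
      (forall t : C, Phi t (horner_alg q h) = W.[t%:A]) /\
      W`_1 = lie (horner_alg q g) (horner_alg q h).
    exists (horner_alg q h)%:P; split=> [t|]; first by rewrite hornerC Phi_poly.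
    by rewrite coefC /lie -!rmorphM mulrC subrr.
  rewrite -[a]symK; elim/poly_ind: (sym a) => [|P h [W [WE W1]]].
    by have := curveC 0; rewrite rmorph0 op0.
  have [U [UE U1]] := curveC h.
  pose Y : {poly A1} := p%:P - (horner_alg q g^`())%:P * 'X.
  have YE t : Phi t p = Y.[t%:A].
    by rewrite Phip hornerD hornerN hornerMX !hornerC mulr_algr.
  have Y1 : Y`_1 = lie (horner_alg q g) p.
    by rewrite coefB coefMX !coefC sub0r lieC lie_pq_poly.
  have at0 (W' : {poly A1}) b : (forall t : C, Phi t b = W'.[t%:A]) -> W'`_0 = b.
    by move=> /(_ 0); rewrite Phi0 scale0r horner_coef0.
  exists (W * Y + U); split=> [t|].
    by rewrite opD opMX opC rmorphD rmorphM /= WE YE UE [RHS]hornerD hornerM_comm.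
  rewrite coefD coefM big_ord_recl big_ord1 /= U1 W1 Y1 (at0 _ _ WE) (at0 _ _ YE).
  by rewrite opD opMX opC lieDr lieMr [X in X + _ = _]addrC.
have [Q1 Q1E] := choice (fun t : C => aut_comp (Phi t) al).
have [Q2 Q2E] := choice (fun t : C => aut_comp be (Q1 t)).
exists Q2 => [s t a|a]; first by rewrite !Q2E !Q1E alK PhiD.
have [W [WE W1]] := curve (al a).
have QE t : Q2 t a = \sum_(k < (size W).+2) t ^+ k *: be W`_k.
  rewrite Q2E Q1E WE (@horner_coef_wide _ (size W).+2); last by rewrite ltnW.
  rewrite rmorph_sum /=; apply: eq_bigr => k _.
  by rewrite -hom_scale -(rmorphXn (in_alg A1)) /= mulr_algr.
have [N [v [c [vb vc ch vd]]]] := @poly_curve_basis R A1 (size W).+2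
  (fun k => be W`_k) (fun t => Q2 t a) isT QE.
by exists N, v, c; split => //; rewrite vd W1 -alx lie_morph !beK.
Qed.

End NormalExponential.

Theorem theorem1p2 (R : realType) (f : sl2 R[i] -> weyl R[i])
    (f_emb : sl2_embedding f) :
  [<-> exists g : alg_aut (weyl R[i]) * sl2_aut R[i],
         normal_forms (aut_act g f);
       exists2 z : sl2 R[i], z <> 0 &
         exists2 y : weyl R[i],
           ad_eigenvector (f z) y & strictly_semisimple y;
       exists2 z : sl2 R[i], z <> 0 & strictly_semisimple (f z);
       exists2 z : sl2 R[i], z <> 0 &
         exists2 y : weyl R[i],
           ad_eigenvector (f z) y & strictly_nilpotent y;
       exists2 z : sl2 R[i], z <> 0 & strictly_nilpotent (f z);
       exists2 z : sl2 R[i], z <> 0 & exponentiable (f z)].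
Proof.
have nil_eigen z : lie (f z) (f z) = 0 *: f z by rewrite liexx scale0r.
have f_neq0 z : z <> 0 -> f z <> 0.
  by move=> z0; apply/eqP/emb_neq0 => //; apply/eqP.
have ii_i : (exists2 z, z <> 0 & exists2 y, ad_eigenvector (f z) y &
    strictly_semisimple y) -> conj_normal f.
  move=> [z z0 [y [_ [c yE]] /strictly_semisimple_lf[ysc ylf]]].
  exact: conj_normal_eigenvector yE.
have iv_i : (exists2 z, z <> 0 & exists2 y, ad_eigenvector (f z) y &
    strictly_nilpotent y) -> conj_normal f.
  move=> [z z0 [y [_ [c yE]] /strictly_nilpotent_lf[ysc ylf]]].
  exact: conj_normal_eigenvector yE.
have iii_ii : (exists2 z, z <> 0 & strictly_semisimple (f z)) ->
    exists2 z, z <> 0 & exists2 y, ad_eigenvector (f z) y & strictly_semisimple y.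
  move=> [z z0 ssz]; exists z => //; exists (f z) => //; split; first exact: f_neq0.
  by exists 0.
have v_iv : (exists2 z, z <> 0 & strictly_nilpotent (f z)) ->
    exists2 z, z <> 0 & exists2 y, ad_eigenvector (f z) y & strictly_nilpotent y.
  move=> [z z0 nz]; exists z => //; exists (f z) => //; split; first exact: f_neq0.
  by exists 0.
have i_iii := @conj_normal_semisimple _ f.
have i_v : conj_normal f -> exists2 z, z <> 0 & strictly_nilpotent (f z).
  move=> /conj_normal_nilpotent[z z0 [al [g [g'0 fzE]]]]; exists z => //.
  exact: poly_q_strictly_nilpotent g'0 fzE.
have i_vi : conj_normal f -> exists2 z, z <> 0 & exponentiable (f z).
  move=> /conj_normal_nilpotent[z z0 [al [g [_ fzE]]]]; exists z => //.
  exact: poly_q_exponentiable fzE.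
have vi_i : (exists2 z, z <> 0 & exponentiable (f z)) -> conj_normal f.
  move=> [z z0 /exponentiable_locally_finite/locally_finite_normalizable zE].
  exact: conj_normal_normalizable zE.
split; first by move=> /i_iii/iii_ii.
split; first by move=> /ii_i/i_iii.
split; first by move=> /iii_ii/ii_i/i_v/v_iv.
split; first by move=> /iv_i/i_v.
by split; [move=> /v_iv/iv_i/i_vi|].
Qed.
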